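(* Let $1\le p\le\infty$ with conjugate exponent $p'$, $\varsigma\in M^1(\mathbb{Z}^n\times\mathbb{T}^n)$, $g_1\in M^{p'}(\mathbb{Z}^n)$ and $g_2\in M^p(\mathbb{Z}^n)$. Then the localization operator $\mathfrak{L}^{g_1,g_2}_\varsigma:M^p(\mathbb{Z}^n)\to M^p(\mathbb{Z}^n)$ is a bounded linear operator, and $$\|\mathfrak{L}^{g_1,g_2}_\varsigma\|_{\mathcal{B}(M^p(\mathbb{Z}^n))}\le\|\varsigma\|_{M^1(\mathbb{Z}^n\times\mathbb{T}^n)}\,\|g_1\|_{M^{p'}(\mathbb{Z}^n)}\,\|g_2\|_{M^p(\mathbb{Z}^n)}.$$
   Context: $\mathbb{T}^n$ is the torus with normalized Haar measure $dw$; $\mathbb{Z}^n\times\mathbb{T}^n$ carries the product of counting measure and $dw$. $T_mf(k)=f(k-m)$, $M_wf(k)=e^{2\pi i w\cdot k}f(k)$, and the short-time Fourier transform is $V_gf(m,w)=\langle f,M_wT_mg\rangle=\sum_{k\in\mathbb{Z}^n}f(k)\overline{g(k-m)}e^{-2\pi i w\cdot k}$ (the pairing $\langle\cdot,\cdot\rangle$ being the sesquilinear duality extending the $\ell^2(\mathbb{Z}^n)$ inner product, in particular that between $M^p(\mathbb{Z}^n)$ and $M^{p'}(\mathbb{Z}^n)$). $\mathcal{S}(\mathbb{Z}^n)$ is the space of rapidly decreasing functions on $\mathbb{Z}^n$, $\mathcal{S}'(\mathbb{Z}^n)$ its dual (tempered distributions); $\mathcal{S}(\mathbb{Z}^n\times\mathbb{T}^n)$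 and $\mathcal{S}'(\mathbb{Z}^n\times\mathbb{T}^n)$ are the Schwartz functions and tempered distributions on the group $\mathbb{Z}^n\times\mathbb{T}^n$. Modulation spaces: fix a non-zero window $g\in\mathcal{S}(\mathbb{Z}^n)$; for $1\le p\le\infty$, $M^p(\mathbb{Z}^n)=\{f\in\mathcal{S}'(\mathbb{Z}^n): V_gf\in L^p(\mathbb{Z}^n\times\mathbb{T}^n)\}$ with $\|f\|_{M^p(\mathbb{Z}^n)}=\|V_gf\|_{L^p}$. Similarly, fix a non-zero $g\in\mathcal{S}(\mathbb{Z}^n\times\mathbb{T}^n)$ and set $$V_gF(m,\omega,\xi,k)=\sum_{j\in\mathbb{Z}^n}\int_{\mathbb{T}^n}e^{-2\pi i j\xi}e^{-2\pi i\eta k}F(j,\eta)\overline{g(j-m,\eta-\omega)}\,d\eta,\quad m,k\in\mathbb{Z}^n,\ \omega,\xi\in\mathbb{T}^n;$$ $M^p(\mathbb{Z}^n\times\mathbb{T}^n)$ is the space of $F\in\mathcal{S}'(\mathbb{Z}^n\times\mathbb{T}^n)$ with $\|F\|_{M^p(\mathbb{Z}^n\times\mathbb{T}^n)}=\|V_gF\|_{L^p((\mathbb{Z}^n\times\mathbb{T}^n)\times(\mathbb{T}^n\times\mathbb{Z}^n))}<\infty$. Different windows give equivalent norms. Localization operator: $\mathfrak{L}^{g_1,g_2}_\varsigma f(k)=\sum_{m\in\mathbb{Z}^n}\int_{\mathbb{T}^n}\varsigma(m,w)V_{g_1}f(m,w)\,M_wT_mg_2(k)\,dw$, or in the weak sense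 $$\langle\mathfrak{L}^{g_1,g_2}_\varsigma f,h\rangle=\sum_{m\in\mathbb{Z}^n}\int_{\mathbb{T}^n}\varsigma(m,w)\,V_{g_1}f(m,w)\,\overline{V_{g_2}h(m,w)}\,dw,\qquad f\in M^p(\mathbb{Z}^n),\ h\in M^{p'}(\mathbb{Z}^n).$$ $\mathcal{B}(X)$ denotes the bounded linear operators on $X$ with operator norm.
   Formalization: The inequality with constant 1 fails for arbitrary windows (shrinking the window on Z^n×T^n sends the right side to 0), so it is proved after multiplying that window by some c>0 depending only on the two windows, uniformly in p, ς, g1, g2. *)

(* Defs.v *)
From HB Require Import structures.
From mathcomp Require Import all_boot all_order all_algebra.
From mathcomp Require Import all_classical all_reals all_analysis.
From mathcomp Require Import complex.

Set Implicit Arguments.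
Unset Strict Implicit.
Unset Printing Implicit Defensive.

Import Order.TTheory GRing.Theory Num.Theory.
Import numFieldNormedType.Exports.
Import ComplexField.

Local Open Scope classical_set_scope.
Local Open Scope ring_scope.

(** * The group Z^n, with the discrete sigma-algebra *)

Definition Zn (n : nat) : Type := 'rV[int]_n.

HB.instance Definition _ n := Countable.on (Zn n).
HB.instance Definition _ n := GRing.Zmodule.on (Zn n).
HB.instance Definition _ n := isPointed.Build (Zn n) 0.
HB.instance Definition _ n := @isMeasurable.Build default_measure_display
  (Zn n) (@discrete_measurable (Zn n)) (@discrete_measurable0 (Zn n))
  (@discrete_measurableC (Zn n)) (@discrete_measurableU (Zn n)).

Lemma sigma_finite_counting_Zn (R : realType) (n : nat) :
  sigma_finite [set: Zn n] (@counting (Zn n) R).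
Proof.
exists (fun i => [set k : Zn n | pickle k = i]).
  by apply/seteqP; split => // k _; exists (pickle k).
move=> i; split; first by [].
have fin : finite_set [set k : Zn n | pickle k = i].
  have [[k ki]|no] := pselect (exists k : Zn n, pickle k = i); last first.
    suff -> : [set k : Zn n | pickle k = i] = set0 by exact: finite_set0.
    by apply/seteqP; split => // k /= ki; apply: no; exists k.
  suff -> : [set k' : Zn n | pickle k' = i] = [set k] by exact: finite_set1.
  apply/seteqP; split => k' /=; last by move=> ->.
  by move=> k'i; apply: (pcan_inj pickleK); rewrite k'i.
by rewrite /counting/= asboolT// ltry.
Qed.

(* An alias, because the canonical sigma-finite structure of [counting] is the
   one over [nat]. *)
Definition countZ (R : realType) (n : nat) : set (Zn n) -> \bar R :=
  @counting (Zn n) R.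

HB.instance Definition _ (R : realType) (n : nat) :=
  Measure.copy (@countZ R n) (@counting (Zn n) R).
HB.instance Definition _ (R : realType) (n : nat) :=
  Measure_isSigmaFinite.Build _ (Zn n) R (@countZ R n)
    (sigma_finite_counting_Zn R n).

(** * The torus T^n = R^n / Z^n *)

(* A function on T^n is a Z^n-periodic function on R^n (see [periodic] below);
   [Tn R n] is R^n with the sigma-algebra generated by the coordinates. *)
Definition Tn (R : realType) (n : nat) : Type := 'rV[R]_n.

Section torus.
Variables (R : realType) (n : nat).

Definition Tn_coord (i : 'I_n) (x : Tn R n) : measurableTypeR R :=
  (x : 'rV[R]_n) ord0 i.

HB.instance Definition _ := Choice.on (Tn R n).
HB.instance Definition _ := GRing.Zmodule.on (Tn R n).
HB.instance Definition _ := isPointed.Build (Tn R n) 0.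

Let Tn_set0 : g_sigma_preimage Tn_coord set0.
Proof. exact: sigma_algebra0. Qed.

Let Tn_setC A : g_sigma_preimage Tn_coord A -> g_sigma_preimage Tn_coord (~` A).
Proof. exact: sigma_algebraC. Qed.

Let Tn_bigcup (F : (set (Tn R n))^nat) :
  (forall i, g_sigma_preimage Tn_coord (F i)) ->
  g_sigma_preimage Tn_coord (\bigcup_i (F i)).
Proof. exact: sigma_algebra_bigcup. Qed.

HB.instance Definition _ := @isMeasurable.Build default_measure_display
  (Tn R n) (g_sigma_preimage Tn_coord) Tn_set0 Tn_setC Tn_bigcup.

End torus.

Lemma measurable_Tn_coord (R : realType) (n : nat) (i : 'I_n) :
  measurable_fun [set: Tn R n] (@Tn_coord R n i).
Proof.
move=> _ Y mY; rewrite setTI; apply: sub_sigma_algebra => /=.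
rewrite -bigcup_seq/=; exists i => /=; first by rewrite mem_index_enum.
by exists Y => //; rewrite setTI.
Qed.

Lemma measurable_fun_TnP (R : realType) (n : nat) d (T : measurableType d)
    (f : T -> Tn R n) :
  (forall i, measurable_fun [set: T] (@Tn_coord R n i \o f)) ->
  measurable_fun [set: T] f.
Proof.
move=> mf.
suff H : g_sigma_preimage (@Tn_coord R n) `<=`
    [set A | measurable (f @^-1` A)] by move=> _ A /H; rewrite setTI.
apply: smallest_sub.
  split => /=.
  - by rewrite preimage_set0.
  - by move=> A mA; rewrite setTD preimage_setC; exact: measurableC.
  - by move=> F mF; rewrite preimage_bigcup; exact: bigcup_measurable.
rewrite -bigcup_seq/= => A [i _ [B mB <-]] /=.
by rewrite setTI -comp_preimage -[X in measurable X]setTI; exact: mf.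
Qed.

Definition Tn_cons (R : realType) (n : nat) (p : measurableTypeR R * Tn R n) :
    Tn R n.+1 :=
  \row_(i < n.+1) oapp (fun j : 'I_n => (p.2 : 'rV[R]_n) ord0 j) p.1
                       (unlift ord0 i).

Lemma measurable_Tn_cons (R : realType) (n : nat) :
  measurable_fun [set: measurableTypeR R * Tn R n] (@Tn_cons R n).
Proof.
apply: measurable_fun_TnP => i.
have [i0|[j ij]] : i = ord0 \/ exists j : 'I_n, i = lift ord0 j.
  by case: (unliftP ord0 i) => [j ->|->]; [right; exists j|left].
- rewrite (_ : _ \o _ = fst); first exact: measurable_fst.
  by apply/funext => p /=; rewrite /Tn_coord/Tn_cons mxE i0 unlift_none.
- rewrite (_ : _ \o _ = @Tn_coord R n j \o snd).
    by apply: measurableT_comp; [exact: measurable_Tn_coord|].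
  by apply/funext => p /=; rewrite /Tn_coord/Tn_cons mxE ij liftK.
Qed.

HB.instance Definition _ (R : realType) (n : nat) :=
  isMeasurableFun.Build _ _ (measurableTypeR R * Tn R n)%type (Tn R n.+1)
    (@Tn_cons R n) (@measurable_Tn_cons R n).

(* Normalized Haar measure of T^n, carried by the fundamental domain [0, 1]^n:
   the n-fold product of the uniform probability on [0, 1]. *)
Fixpoint haar (R : realType) (n : nat) : probability (Tn R n) R :=
  match n with
  | 0%N => dirac (0 : Tn R 0)
  | n'.+1 => distribution (uniform_prob (@ltr01 R) \x haar R n')%E (@Tn_cons R n')
  end.

(* The library's canonical sigma-finite structure of a product only applies to
   products of sub-probabilities. *)
Lemma sigma_finite_product d1 d2 (T1 : measurableType d1)
    (T2 : measurableType d2) (R : realType)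
    (m1 : {sigma_finite_measure set T1 -> \bar R})
    (m2 : {sigma_finite_measure set T2 -> \bar R}) :
  sigma_finite [set: T1 * T2] (m1 \x m2)%E.
Proof.
have /sigma_finiteP[F [TF ndF Foo]] := sigma_finiteT m1.
have /sigma_finiteP[G [TG ndG Goo]] := sigma_finiteT m2.
exists (fun n => F n `*` G n).
  rewrite -setXTT TF TG predeqE => -[x y]; split.
    move=> [/= [n _ Fnx] [k _ Gky]]; exists (maxn n k) => //; split.
    - by move: x Fnx; exact/subsetPset/ndF/leq_maxl.
    - by move: y Gky; exact/subsetPset/ndG/leq_maxr.
  by move=> [n _ []/= ? ?]; split; exists n.
move=> k; have [? ?] := Foo k; have [? ?] := Goo k.
split; first exact: measurableX.
by rewrite product_measure1E// lte_mul_pinfty// ge0_fin_numE.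
Qed.

Section product_measures.
Variables (R : realType) (n : nat).

Definition muZT : set (Zn n * Tn R n) -> \bar R := (@countZ R n \x haar R n)%E.

HB.instance Definition _ := Measure.copy muZT (@countZ R n \x haar R n)%E.
HB.instance Definition _ := Measure_isSigmaFinite.Build _ _ _ muZT
  (sigma_finite_product (@countZ R n) (haar R n)).

Definition muTZ : set (Tn R n * Zn n) -> \bar R := (haar R n \x @countZ R n)%E.

HB.instance Definition _ := Measure.copy muTZ (haar R n \x @countZ R n)%E.
HB.instance Definition _ := Measure_isSigmaFinite.Build _ _ _ muTZ
  (sigma_finite_product (haar R n) (@countZ R n)).

Definition muZTTZ : set ((Zn n * Tn R n) * (Tn R n * Zn n)) -> \bar R :=
  (muZT \x muTZ)%E.

HB.instance Definition _ := Measure.copy muZTTZ (muZT \x muTZ)%E.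
HB.instance Definition _ := Measure_isSigmaFinite.Build _ _ _ muZTTZ
  (sigma_finite_product muZT muTZ).

End product_measures.

Section defs.
Variables (R : realType) (n : nat).
Local Notation C := R[i].
Local Notation ZT := (Zn n * Tn R n)%type.
Local Notation TZ := (Tn R n * Zn n)%type.
Local Notation muZT := (@muZT R n).
Local Notation muZTTZ := (@muZTTZ R n).

Definition cmod (z : C) : R := Normc.normc z.

(* expi t = e^{2 pi i t} *)
Definition expi (t : R) : C := Complex (cos (2 * pi * t)) (sin (2 * pi * t)).

Definition dotp (w : Tn R n) (k : Zn n) : R :=
  \sum_(i < n) (w : 'rV[R]_n) ord0 i * ((k : 'rV[int]_n) ord0 i)%:~R.

(** ** Complex-valued integration *)

Section integration.
Context d (T : measurableType d).
Variable mu : {measure set T -> \bar R}.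
Implicit Types f : T -> C.

Definition cmeasurable f : Prop :=
  measurable_fun [set: T] (fun x => complex.Re (f x)) /\
  measurable_fun [set: T] (fun x => complex.Im (f x)).

Definition cintegrable f : Prop :=
  mu.-integrable [set: T] (fun x => (complex.Re (f x))%:E) /\
  mu.-integrable [set: T] (fun x => (complex.Im (f x))%:E).

Definition cintegral f : C :=
  Complex (\int[mu]_x complex.Re (f x)) (\int[mu]_x complex.Im (f x)).

Definition LpNorm (p : \bar R) f : \bar R :=
  Lnorm mu p (fun x => (cmod (f x))%:E).

Definition inLp (p : \bar R) f : Prop :=
  cmeasurable f /\ (LpNorm p f < +oo)%E.

End integration.

(** ** Schwartz functions and tempered distributions *)

Definition absZ (k : Zn n) : R := \sum_(i < n) `|(k : 'rV[int]_n) ord0 i|%:~R.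

Definition schwartzZ (phi : Zn n -> C) : Prop :=
  forall N : nat, exists B : R,
    forall k, (1 + absZ k) ^+ N * cmod (phi k) <= B.

(* The distribution phi |-> \sum_k u(k) phi(k) is identified with the function
   u; the continuous functionals on the Schwartz space of Z^n are exactly those
   given by functions u of at most polynomial growth. *)
Definition temperedZ (u : Zn n -> C) : Prop :=
  exists (N : nat) (B : R), forall k, cmod (u k) <= B * (1 + absZ k) ^+ N.

Definition periodic (f : Tn R n -> C) : Prop :=
  forall (x : Tn R n) (k : Zn n),
    f (x + (map_mx (fun a : int => a%:~R : R) k : 'rV[R]_n)) = f x.

Definition has_partial (i : 'I_n) (f : Tn R n -> C) : Prop :=
  forall x : 'rV[R]_n,
    derivable (fun y : 'rV[R]_n => complex.Re (f y)) x (delta_mx ord0 i) /\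
    derivable (fun y : 'rV[R]_n => complex.Im (f y)) x (delta_mx ord0 i).

Definition partial (i : 'I_n) (f : Tn R n -> C) : Tn R n -> C := fun x =>
  Complex ('D_(delta_mx ord0 i) (fun y : 'rV[R]_n => complex.Re (f y)) x)
          ('D_(delta_mx ord0 i) (fun y : 'rV[R]_n => complex.Im (f y)) x).

Definition partials (l : seq 'I_n) (f : Tn R n -> C) : Tn R n -> C :=
  foldr partial f l.

(* pZT N F B : the N-th Schwartz seminorm of F is at most B *)
Definition pZT (N : nat) (F : ZT -> C) (B : R) : Prop :=
  forall l : seq 'I_n, (size l <= N)%N -> forall (j : Zn n) (eta : Tn R n),
    (1 + absZ j) ^+ N * cmod (partials l (fun x => F (j, x)) eta) <= B.

(* Continuity of the derivatives need not be required: the iterated partial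
   derivatives are bounded, hence Lipschitz. *)
Definition schwartzZT (F : ZT -> C) : Prop :=
  [/\ forall j, periodic (fun x => F (j, x)),
      forall j l i, has_partial i (partials l (fun x => F (j, x))) &
      forall N, exists B, pZT N F B].

(* Continuous linear functionals on the Schwartz functions; the values outside
   [schwartzZT] are irrelevant. *)
Definition temperedZT (U : (ZT -> C) -> C) : Prop :=
  (forall (a : C) (F G : ZT -> C), schwartzZT F -> schwartzZT G ->
     U (fun x => a * F x + G x) = a * U F + U G) /\
  (exists (N : nat) (K : R), forall (F : ZT -> C) (B : R),
     schwartzZT F -> pZT N F B -> cmod (U F) <= K * B).

(* U is given by integration against the function s on Z^n x T^n *)
Definition represents (U : (ZT -> C) -> C) (s : ZT -> C) : Prop :=
  [/\ forall j, periodic (fun x => s (j, x)),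
      cmeasurable s &
      forall F, schwartzZT F ->
        cintegrable muZT (fun x => s x * F x) /\
        U F = cintegral muZT (fun x => s x * F x)].

(** ** Modulation spaces *)

(* M_w T_m g *)
Definition tfshift (g : Zn n -> C) (x : ZT) : Zn n -> C :=
  fun k => expi (dotp x.2 k) * g (k - x.1).

(* <f, h> = \sum_k f(k) conj(h(k)) *)
Definition pairing (f h : Zn n -> C) : C :=
  cintegral (@countZ R n) (fun k => f k * conjc (h k)).

(* [stft g f] is V_g f *)
Definition stft (g f : Zn n -> C) : ZT -> C := fun x => pairing f (tfshift g x).

Definition normMZ (phi : Zn n -> C) (p : \bar R) (f : Zn n -> C) : \bar R :=
  LpNorm muZT p (stft phi f).

Definition MZ (phi : Zn n -> C) (p : \bar R) : set (Zn n -> C) :=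
  [set f | temperedZ f /\ inLp muZT p (stft phi f)].

(* V_G U (m, omega, xi, k), where the pairing of U and F is bilinear:
   U F = \sum_j \int U(j, eta) F(j, eta) d eta *)
Definition stftZT (G : ZT -> C) (U : (ZT -> C) -> C) : ZT * TZ -> C := fun z =>
  let: ((m, omega), (xi, k)) := z in
  U (fun y => expi (- dotp xi y.1) * expi (- dotp y.2 k) *
              conjc (G (y.1 - m, y.2 - omega))).

(* Multiplying the window by c > 0 multiplies every norm [normMZT] by c. *)
Definition scale_window (c : R) (G : ZT -> C) : ZT -> C :=
  fun y => real_complex R c * G y.

Definition normMZT (G : ZT -> C) (p : \bar R) (U : (ZT -> C) -> C) : \bar R :=
  LpNorm muZTTZ p (stftZT G U).

Definition MZT (G : ZT -> C) (p : \bar R) : set ((ZT -> C) -> C) :=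
  [set U | temperedZT U /\ inLp muZTTZ p (stftZT G U)].

(** ** Bounded operators on M^p(Z^n) *)

Definition bounded_operator (phi : Zn n -> C) (p : \bar R)
    (L : (Zn n -> C) -> (Zn n -> C)) : Prop :=
  [/\ forall f, MZ phi p f -> MZ phi p (L f),
      forall (a : C) f h, MZ phi p f -> MZ phi p h ->
        L (fun k => a * f k + h k) = (fun k => a * L f k + L h k) &
      exists K : R, forall f, MZ phi p f ->
        (normMZ phi p (L f) <= K%:E * normMZ phi p f)%E].

Definition opnorm (phi : Zn n -> C) (p : \bar R)
    (L : (Zn n -> C) -> (Zn n -> C)) : \bar R :=
  ereal_sup [set normMZ phi p (L f) | f in
    [set f | MZ phi p f /\ (normMZ phi p f <= 1)%E]].

(** ** Localization operators *)

Definition locop (s : ZT -> C) (g1 g2 : Zn n -> C) (f : Zn n -> C) : Zn n -> C :=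
  fun k => cintegral muZT (fun x => s x * stft g1 f x * tfshift g2 x k).

(* On M^p the integral defining [locop] converges absolutely, and [locop] is
   also the localization operator in the weak sense. *)
Definition locop_well_defined (phi : Zn n -> C) (p : \bar R) (s : ZT -> C)
    (g1 g2 : Zn n -> C) : Prop :=
  forall f, MZ phi p f ->
    (forall k, cintegrable muZT (fun x => s x * stft g1 f x * tfshift g2 x k)) /\
    (forall h, MZ phi (hoelder_conjugate p) h ->
       cintegrable muZT (fun x => s x * stft g1 f x * conjc (stft g2 h x)) /\
       pairing (locop s g1 g2 f) h =
         cintegral muZT (fun x => s x * stft g1 f x * conjc (stft g2 h x))).

End defs.

(* Main.v *)
(* The modulation spaces reduce to sequence spaces. Writing V_phi f(m, .) as a
   Fourier series, a single Fourier coefficient in the frequency variable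
   recovers f(k) conj(phi(k - m)); hence M^p(Z^n) = l^p(Z^n), with norm
   equivalence constants that depend on phi only (Young's inequality in one
   direction, Jensen's in the other).
   In the same way every Schwartz function on Z^n x T^n is a rapidly decreasing
   Fourier series, so a tempered distribution sigma is determined by the numbers
   b(j, k) = sigma(delta_j (x) e_k), and the Fourier coefficients in
   (omega, xi) of V_Phi sigma(m, omega, xi, k) are the products
   conj(d(j - m, - (l + k))) b(j, l), where d are the Fourier coefficients of
   Phi. Choosing d(j0, k0) <> 0 gives
     |d(j0, k0)| \sum |b| <= || V_Phi sigma ||_1,
   so sigma is a function s with |s(j, eta)| <= beta(j), where \sum_j beta(j) is
   at most a multiple of the norm of sigma. Then, V_g1 f being bounded by
   ||f||_p ||g1||_p' and time-frequency shifts being isometries of l^p,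
   Young's inequality yields
     ||L f||_p <= (\sum_j beta(j)) ||f||_p ||g1||_p' ||g2||_p. *)

(* That sigma is determined by its coefficients [b] rests on two facts: a Schwartz function equals
   its Fourier series, and sigma may be applied to that series termwise. The first reduces to a
   uniqueness theorem for bounded Lipschitz periodic functions, proved with the Fejér kernel and a
   second moment estimate. Both use only the orthogonality of characters, which comes from the
   vanishing integral of a partial derivative, so that [haar] is never translated. The second does
   not follow from linearity alone: the coefficients are cut off to a cube, and continuity of sigma
   controls the rest. The target inequality has constant 1, so all losses due to the windows must be
   absorbed into Phi before sigma, p, g1 and g2 are known. They are a factor 1/|phi(k0)| for each of
   f, g1, g2 in passing to l^p, a bound of the l^1 norm of phi for the way back, and 1/|d(j0, k0)|
   for the symbol. None depends on p, so a single rescaling serves all exponents. *)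
Require Import Defs.
From mathcomp Require Import all_boot all_order all_algebra perm.
From mathcomp Require Import all_classical all_reals all_analysis.
From mathcomp Require Import measurable_realfun ess_sup_inf complex ring lra
  zify.

Set Implicit Arguments.
Unset Strict Implicit.
Unset Printing Implicit Defensive.

Import Order.TTheory GRing.Theory Num.Theory.
Import numFieldNormedType.Exports.

Local Open Scope classical_set_scope.
Local Open Scope ring_scope.

(** * Complex-valued integrals *)

Section complex_modulus.
Variable R : realType.
Implicit Types (x y z : R[i]) (t : R).

Lemma cReD x y : complex.Re (x + y) = complex.Re x + complex.Re y.
Proof. by case: x; case: y. Qed.

Lemma cImD x y : complex.Im (x + y) = complex.Im x + complex.Im y.
Proof. by case: x; case: y. Qed.

Lemma cReN x : complex.Re (- x) = - complex.Re x.
Proof. by case: x. Qed.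

Lemma cImN x : complex.Im (- x) = - complex.Im x.
Proof. by case: x. Qed.

Lemma cReM x y :
  complex.Re (x * y) = complex.Re x * complex.Re y - complex.Im x * complex.Im
    y.
Proof. by case: x; case: y. Qed.

Lemma cImM x y :
  complex.Im (x * y) = complex.Re x * complex.Im y + complex.Im x * complex.Re
    y.
Proof. by case: x; case: y. Qed.

Lemma cRe_conj x : complex.Re (conjc x) = complex.Re x.
Proof. by case: x. Qed.

Lemma cIm_conj x : complex.Im (conjc x) = - complex.Im x.
Proof. by case: x. Qed.

Lemma conjcM x y : conjc (x * y) = conjc x * conjc y.
Proof. exact: rmorphM. Qed.

Lemma conjcB x y : conjc (x - y) = conjc x - conjc y.
Proof. exact: rmorphB. Qed.

Lemma complexP x y :
  complex.Re x = complex.Re y -> complex.Im x = complex.Im y -> x = y.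
Proof. by case: x => a b; case: y => c d /= -> ->. Qed.

Lemma cmodE x : cmod x = Num.sqrt (complex.Re x ^+ 2 + complex.Im x ^+ 2).
Proof. by case: x. Qed.

Lemma cmod_ge0 x : 0 <= cmod x.
Proof. by rewrite cmodE sqrtr_ge0. Qed.

Lemma cmod0 : cmod (0 : R[i]) = 0.
Proof. exact: ComplexField.Normc.normc0. Qed.

Lemma cmod1 : cmod (1 : R[i]) = 1.
Proof. exact: ComplexField.Normc.normc1. Qed.

Lemma cmod_eq0 x : cmod x = 0 -> x = 0.
Proof. exact: ComplexField.Normc.eq0_normc. Qed.

Lemma cmodM x y : cmod (x * y) = cmod x * cmod y.
Proof. exact: ComplexField.Normc.normcM. Qed.

Lemma cmodN x : cmod (- x) = cmod x.
Proof. by rewrite !cmodE cReN cImN !sqrrN. Qed.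

Lemma cmod_conj x : cmod (conjc x) = cmod x.
Proof. by rewrite !cmodE cRe_conj cIm_conj !sqrrN. Qed.

Lemma cmod_real t : cmod (real_complex R t) = `|t|.
Proof. by rewrite cmodE/= expr0n/= addr0 sqrtr_sqr. Qed.

Lemma cmodD x y : cmod (x + y) <= cmod x + cmod y.
Proof. exact: le_normcD. Qed.

Lemma cmodB x y : cmod (x - y) <= cmod x + cmod y.
Proof. by rewrite -(cmodN y) cmodD. Qed.

Lemma normr_Re_le x : `|complex.Re x| <= cmod x.
Proof. by rewrite cmodE -sqrtr_sqr ler_wsqrtr// lerDl sqr_ge0. Qed.

Lemma normr_Im_le x : `|complex.Im x| <= cmod x.
Proof. by rewrite cmodE -sqrtr_sqr ler_wsqrtr// lerDr sqr_ge0. Qed.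

Lemma cmod_le_ReIm x : cmod x <= `|complex.Re x| + `|complex.Im x|.
Proof.
case: x => a b; have -> : Complex a b = Complex a 0 + Complex 0 b.
  by apply: complexP => /=; rewrite ?addr0 ?add0r.
apply: (le_trans (cmodD _ _)).
by rewrite !cmodE/= expr0n/= !addr0 !add0r !sqrtr_sqr lexx.
Qed.

Lemma mul_conjc x : x * conjc x = real_complex R (cmod x ^+ 2).
Proof.
rewrite cmodE sqr_sqrtr ?addr_ge0 ?sqr_ge0//.
by apply: complexP; rewrite ?cReM ?cImM cRe_conj cIm_conj/=; ring.
Qed.

Lemma expiD s t : expi (s + t) = expi s * expi t :> R[i].
Proof.
rewrite /expi; apply: complexP; rewrite ?cReM ?cImM/= mulrDr ?cosD// sinD.
by ring.
Qed.

Lemma expi0 : expi 0 = 1 :> R[i].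
Proof. by rewrite /expi mulr0 cos0 sin0. Qed.

Lemma cmod_expi t : cmod (expi t) = 1.
Proof. by rewrite cmodE/= cos2Dsin2 sqrtr1. Qed.

Lemma conj_expi t : conjc (expi t) = expi (- t).
Proof. by rewrite /expi/= mulrN cosN sinN. Qed.

Lemma expi_nat (m : nat) : expi m%:R = 1 :> R[i].
Proof.
elim: m => [|m IH]; first exact: expi0.
rewrite -addn1 natrD expiD IH mul1r /expi mulr1 (_ : 2 * pi = pi *+ 2).
  by rewrite cos2pi sin2pi.
by rewrite mulr_natl.
Qed.

Lemma expi_int (m : int) : expi m%:~R = 1 :> R[i].
Proof.
case: m => m; first exact: expi_nat.
by rewrite NegzE mulrNz -conj_expi expi_nat conjc1.
Qed.

End complex_modulus.

Section complex_integral.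
Context d (T : measurableType d) (R : realType).
Implicit Types (f g : T -> R[i]) (mu : {measure set T -> \bar R}).

Lemma cmeasurable_cst (z : R[i]) : cmeasurable (fun _ : T => z).
Proof. by split; exact: measurable_cst. Qed.

Lemma cmeasurableM f g :
  cmeasurable f -> cmeasurable g -> cmeasurable (fun x => f x * g x).
Proof.
move=> [f1 f2] [g1 g2]; split.
  under eq_fun do rewrite cReM.
  by apply: measurable_funB; exact: measurable_funM.
under eq_fun do rewrite cImM.
by apply: measurable_funD; exact: measurable_funM.
Qed.

Lemma cmeasurable_conj f : cmeasurable f -> cmeasurable (fun x => conjc (f x)).
Proof.
move=> [f1 f2]; split; first by under eq_fun do rewrite cRe_conj.
by under eq_fun do rewrite cIm_conj; exact: measurable_funN.
Qed.

Lemma measurable_cmod f :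
  cmeasurable f -> measurable_fun [set: T] (fun x => cmod (f x)).
Proof.
move=> [f1 f2]; under eq_fun do rewrite cmodE.
apply: (measurableT_comp (f := @Num.sqrt R)).
  by apply: continuous_measurable_fun; exact: sqrt_continuous.
by apply: measurable_funD; exact: measurable_funX.
Qed.

Lemma measurable_ecmod f :
  cmeasurable f -> measurable_fun [set: T] (fun x => (cmod (f x))%:E).
Proof. by move=> mf; apply/measurable_EFinP; exact: measurable_cmod. Qed.

Lemma cmeasurable_comp d' (T' : measurableType d') (h : T' -> T) f :
  measurable_fun [set: T'] h -> cmeasurable f -> cmeasurable (f \o h).
Proof.
move=> mh [f1 f2].
by split; [exact: (measurableT_comp f1 mh)|exact: (measurableT_comp f2 mh)].
Qed.

Variable mu : {measure set T -> \bar R}.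

(** Both directions come from |Re z|, |Im z| <= |z| <= |Re z| + |Im z|. Integrability is mostly
    checked through the modulus below. *)
Lemma cintegrableP f : cintegrable mu f <->
  cmeasurable f /\ (\int[mu]_x (cmod (f x))%:E < +oo)%E.
Proof.
have abs_meas (h : T -> R) : measurable_fun [set: T] h ->
    measurable_fun [set: T] (fun x => `|(h x)%:E|%E).
  by move=> mh; apply/measurable_EFinP; exact: measurableT_comp.
split=> [[/integrableP[m1 f1] /integrableP[m2 f2]]|[[m1 m2] fi]].
  have mf : cmeasurable f by split; exact/measurable_EFinP.
  have [n1 n2] := (abs_meas _ mf.1, abs_meas _ mf.2).
  split=> //; apply: (@le_lt_trans _ _ (\int[mu]_x
      (`|(complex.Re (f x))%:E| + `|(complex.Im (f x))%:E|))%E).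
    apply: ge0_le_integral => //.
    - by move=> x _; rewrite lee_fin cmod_ge0.
    - exact: measurable_ecmod.
    - exact: emeasurable_funD.
    - by move=> x _; rewrite -EFinD lee_fin cmod_le_ReIm.
  by rewrite ge0_integralD//=; exact: lte_add_pinfty.
have mf : cmeasurable f by [].
split; apply/integrableP; split; try exact/measurable_EFinP.
- apply: le_lt_trans fi; apply: ge0_le_integral => //; first exact: abs_meas.
  + exact: measurable_ecmod.
  + by move=> x _; rewrite lee_fin normr_Re_le.
- apply: le_lt_trans fi; apply: ge0_le_integral => //; first exact: abs_meas.
  + exact: measurable_ecmod.
  + by move=> x _; rewrite lee_fin normr_Im_le.
Qed.

Lemma cintegrable_le f (g : T -> \bar R) : cmeasurable f ->
  measurable_fun [set: T] g ->
  (forall x, (cmod (f x))%:E <= g x)%E -> (\int[mu]_x g x < +oo)%E ->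
  cintegrable mu f.
Proof.
move=> mf mg fg gi; apply/cintegrableP; split => //.
apply: le_lt_trans gi; apply: ge0_le_integral => //.
- by move=> x _; rewrite lee_fin cmod_ge0.
- exact: measurable_ecmod.
Qed.

Lemma cintegrableD f g : cintegrable mu f -> cintegrable mu g ->
  cintegrable mu (fun x => f x + g x).
Proof.
move=> [f1 f2] [g1 g2]; split.
  by under eq_fun do rewrite cReD EFinD; exact: integrableD.
by under eq_fun do rewrite cImD EFinD; exact: integrableD.
Qed.

Lemma cintegrableZ (a : R[i]) f : cintegrable mu f ->
  cintegrable mu (fun x => a * f x).
Proof.
move=> [f1 f2]; split.
  under eq_fun do rewrite cReM EFinB !EFinM.
  by apply: integrableB => //; exact: integrableZl.
under eq_fun do rewrite cImM EFinD !EFinM.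
by apply: integrableD => //; exact: integrableZl.
Qed.

Lemma cintegrableN f : cintegrable mu f -> cintegrable mu (fun x => - f x).
Proof.
by move=> /(cintegrableZ (-1)); under eq_fun do rewrite mulN1r.
Qed.

Lemma cintegrableB f g : cintegrable mu f -> cintegrable mu g ->
  cintegrable mu (fun x => f x - g x).
Proof. by move=> fi gi; apply: cintegrableD => //; exact: cintegrableN. Qed.

Lemma cintegrable_conj f : cintegrable mu f ->
  cintegrable mu (fun x => conjc (f x)).
Proof.
move=> [f1 f2]; split; first by under eq_fun do rewrite cRe_conj.
by under eq_fun do rewrite cIm_conj EFinN; exact: integrableN.
Qed.

Lemma eq_cintegral f g : f =1 g -> cintegral mu f = cintegral mu g.
Proof. by move=> fg; congr cintegral; exact/funext. Qed.

Lemma cintegralD f g : cintegrable mu f -> cintegrable mu g ->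
  cintegral mu (fun x => f x + g x) = cintegral mu f + cintegral mu g.
Proof.
move=> [f1 f2] [g1 g2]; rewrite /cintegral; apply: complexP => /=.
  by under eq_fun do rewrite cReD; rewrite RintegralD.
by under eq_fun do rewrite cImD; rewrite RintegralD.
Qed.

Lemma cintegralZ (a : R[i]) f : cintegrable mu f ->
  cintegral mu (fun x => a * f x) = a * cintegral mu f.
Proof.
move=> [f1 f2]; rewrite /cintegral; apply: complexP.
  rewrite cReM/=; under eq_fun do rewrite cReM.
  rewrite RintegralB//; [|exact: (integrableZl _ _ f1)|exact: (integrableZl _ _
    f2)].
  by rewrite !RintegralZl.
rewrite cImM/=; under eq_fun do rewrite cImM.
rewrite RintegralD//; [|exact: (integrableZl _ _ f2)|exact: (integrableZl _ _
  f1)].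
by rewrite !RintegralZl.
Qed.

Lemma cintegralN f : cintegrable mu f ->
  cintegral mu (fun x => - f x) = - cintegral mu f.
Proof.
move=> fi; rewrite -[RHS]mulN1r -cintegralZ//.
by apply: eq_cintegral => x; rewrite mulN1r.
Qed.

Lemma cintegralB f g : cintegrable mu f -> cintegrable mu g ->
  cintegral mu (fun x => f x - g x) = cintegral mu f - cintegral mu g.
Proof.
move=> fi gi; rewrite cintegralD ?cintegralN//; exact: cintegrableN.
Qed.

Lemma cintegral_conj f : cintegrable mu f ->
  cintegral mu (fun x => conjc (f x)) = conjc (cintegral mu f).
Proof.
move=> [f1 f2]; rewrite /cintegral; apply: complexP;
  rewrite ?cRe_conj ?cIm_conj/=.
  by under eq_fun do rewrite cRe_conj.
under eq_fun do rewrite cIm_conj -mulN1r.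
by rewrite RintegralZl// mulN1r.
Qed.

(** Rotation trick: with I the integral of f, |I|^2 is the real part of the integral of conj(I) f,
    hence at most |I| times the integral of |f|; divide by |I| unless it is 0. *)
Lemma cmod_cintegral_le f : cintegrable mu f ->
  ((cmod (cintegral mu f))%:E <= \int[mu]_x (cmod (f x))%:E)%E.
Proof.
move=> fi; have [m fi'] := (cintegrableP f).1 fi.
set I := cintegral mu f; have [I0|I0] := eqVneq (cmod I) 0.
  by rewrite I0; apply: integral_ge0 => x _; rewrite lee_fin cmod_ge0.
have Igt0 : 0 < cmod I by rewrite lt_neqAle eq_sym I0 cmod_ge0.
have mm := measurable_cmod m.
have ii : mu.-integrable [set: T] (EFin \o (fun x => cmod (f x))).
  apply/integrableP; split; first exact/measurable_EFinP.
  by under eq_integral do rewrite /= ger0_norm ?cmod_ge0//.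
suff H : cmod I <= \int[mu]_x cmod (f x).
  rewrite (le_trans (y := (\int[mu]_x cmod (f x))%:E)) ?lee_fin//.
  by rewrite /Rintegral fineK// integrable_fin_num.
rewrite -(ler_pM2l Igt0).
have -> : cmod I * cmod I = complex.Re (cintegral mu (fun x => conjc I * f x)).
  by rewrite cintegralZ// -/I [conjc I * I]mulrC mul_conjc/= expr2.
rewrite -RintegralZl//; apply: le_Rintegral => //.
- by case: (cintegrableZ (conjc I) fi).
- exact: (integrableZl _ _ ii).
- move=> x _; apply: (le_trans (ler_norm _)).
  by apply: (le_trans (normr_Re_le _)); rewrite cmodM cmod_conj.
Qed.

Lemma cmod_cintegral_le_bound f (M : R) : cintegrable mu f ->
  (\int[mu]_x (cmod (f x))%:E <= M%:E)%E -> cmod (cintegral mu f) <= M.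
Proof.
by move=> fi fM; rewrite -lee_fin (le_trans (cmod_cintegral_le fi)).
Qed.

Lemma cintegral0 : cintegral mu (fun _ : T => 0 : R[i]) = 0.
Proof. by rewrite /cintegral/= Rintegral_cst// mul0r. Qed.

End complex_integral.

Section complex_fubini.
Context d1 d2 (T1 : measurableType d1) (T2 : measurableType d2) (R : realType).
Variable m1 : {sigma_finite_measure set T1 -> \bar R}.
Variable m2 : {sigma_finite_measure set T2 -> \bar R}.
Variable f : T1 * T2 -> R[i].
Hypothesis fi : cintegrable (m1 \x m2)%E f.
(** Fubini by itself gives integrable sections almost everywhere. Having them everywhere lets
    [fineK] identify the complex inner integral with the extended real one at each point. *)
Hypothesis fi1 : forall x, cintegrable m2 (fun y => f (x, y)).
Hypothesis fi2 : forall y, cintegrable m1 (fun x => f (x, y)).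

Lemma cintegrable_fubini1 : cintegrable m1 (fun x => cintegral m2 (fun y =>
  f (x, y))).
Proof.
case: fi => i1 i2; split.
  apply: eq_integrable (integrable_fubini_F i1) => //= x _.
  by rewrite /fubini_F /Rintegral fineK// integrable_fin_num//; case: (fi1 x).
apply: eq_integrable (integrable_fubini_F i2) => //= x _.
by rewrite /fubini_F /Rintegral fineK// integrable_fin_num//; case: (fi1 x).
Qed.

Lemma cintegral12 : cintegral m1 (fun x => cintegral m2 (fun y => f (x, y))) =
  cintegral (m1 \x m2)%E f.
Proof.
case: fi => i1 i2; rewrite /cintegral/=; congr Complex.
  rewrite /Rintegral; congr fine; rewrite -integral12_prod_meas1//=.
  apply: eq_integral => x _.
  by rewrite /Rintegral fineK// integrable_fin_num//; case: (fi1 x).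
rewrite /Rintegral; congr fine; rewrite -integral12_prod_meas1//=.
apply: eq_integral => x _.
  by rewrite /Rintegral fineK// integrable_fin_num//; case: (fi1 x).
Qed.

Lemma cintegral21 : cintegral m2 (fun y => cintegral m1 (fun x => f (x, y))) =
  cintegral (m1 \x m2)%E f.
Proof.
case: fi => i1 i2; rewrite /cintegral/=; congr Complex.
  rewrite /Rintegral; congr fine; rewrite -integral21_prod_meas1//=.
  apply: eq_integral => y _.
  by rewrite /Rintegral fineK// integrable_fin_num//; case: (fi2 y).
rewrite /Rintegral; congr fine; rewrite -integral21_prod_meas1//=.
apply: eq_integral => y _.
  by rewrite /Rintegral fineK// integrable_fin_num//; case: (fi2 y).
Qed.

Lemma cFubini : cintegral m1 (fun x => cintegral m2 (fun y => f (x, y))) =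
  cintegral m2 (fun y => cintegral m1 (fun x => f (x, y))).
Proof. by rewrite cintegral12 cintegral21. Qed.

End complex_fubini.

(** * Counting measure on Z^n *)

Section counting_Zn.
Variable R : realType.

Lemma measurable_Zn (n : nat) (A : set (Zn n)) : measurable A.
Proof. by []. Qed.

Lemma measurable_fun_Zn (n : nat) d' (T' : measurableType d') (f : Zn n -> T') :
  measurable_fun [set: Zn n] f.
Proof. by move=> _ A _. Qed.

(** Z^n is countable and discrete, so a preimage is a countable union of rectangles over single
    points k. *)
Lemma measurable_fun_Znprod (n : nat) d (T : measurableType d)
    d' (T' : measurableType d') (f : Zn n * T -> T') :
  (forall k, measurable_fun [set: T] (fun x => f (k, x))) ->
  measurable_fun [set: Zn n * T] f.
Proof.
move=> mf _ A mA; rewrite setTI.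
rewrite (_ : f @^-1` A =
    \bigcup_k ([set k] `*` ((fun x => f (k, x)) @^-1` A))); last first.
  apply/seteqP; split => [[k x] /= Akx|[k x] [l _ /= [-> //]]].
  by exists k.
apply: countable_bigcupT_measurable; first exact: countableP.
move=> k; apply: measurableX; first exact: measurable_Zn.
by rewrite -[X in measurable X]setTI; exact: mf.
Qed.

Lemma measurable_fun_prodZn (n : nat) d (T : measurableType d)
    d' (T' : measurableType d') (f : T * Zn n -> T') :
  (forall k, measurable_fun [set: T] (fun x => f (x, k))) ->
  measurable_fun [set: T * Zn n] f.
Proof.
move=> mf; rewrite (_ : f = (fun z => f (z.2, z.1)) \o (fun z : T * Zn n =>
  (z.2, z.1))); last first.
  by apply/funext => -[].
apply: measurableT_comp; first exact: measurable_fun_Znprod.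
exact: measurable_fun_pair.
Qed.

Lemma cmeasurable_Zn (n : nat) (f : Zn n -> R[i]) : cmeasurable f.
Proof. by split; exact: measurable_fun_Zn. Qed.

Lemma cmeasurable_Znprod (n : nat) d (T : measurableType d)
  (f : Zn n * T -> R[i]) :
  (forall k, cmeasurable (fun x => f (k, x))) -> cmeasurable f.
Proof.
move=> mf; split; apply: measurable_fun_Znprod => k;
  exact: (mf k).1 || exact: (mf k).2.
Qed.

Lemma cmeasurable_prodZn (n : nat) d (T : measurableType d)
  (f : T * Zn n -> R[i]) :
  (forall k, cmeasurable (fun x => f (x, k))) -> cmeasurable f.
Proof.
move=> mf; split; apply: measurable_fun_prodZn => k;
  exact: (mf k).1 || exact: (mf k).2.
Qed.

Variable n : nat.
Local Notation muZ := (@countZ R n).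

Lemma countZ_set1 (k : Zn n) : muZ [set k] = 1%E.
Proof.
rewrite /countZ /counting/= asboolT ?finite_set1// fset_set1.
by rewrite finmap.cardfs1.
Qed.

Lemma integral_countZ_set1 (f : Zn n -> \bar R) k :
  (\int[muZ]_(l in [set k]) f l = f k)%E.
Proof.
transitivity (\int[muZ]_(l in [set k]) (cst (f k)) l)%E.
  by apply: eq_integral => l; rewrite inE/= => ->.
rewrite integral_cst// [X in (_ * X)%E](_ : _ = 1%E) ?mule1//.
exact: countZ_set1.
Qed.

Lemma integral_countZ_point (f : Zn n -> \bar R) k :
  (forall l, l != k -> f l = 0%E) -> (\int[muZ]_l f l = f k)%E.
Proof.
move=> f0; rewrite -(integral_countZ_set1 f k) [RHS]integral_mkcond.
apply: eq_integral => l _; rewrite patchE; case: ifPn => //.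
rewrite notin_setE/= => /eqP; exact: f0.
Qed.

Lemma le_integral_countZ (f : Zn n -> \bar R) k :
  (forall l, 0 <= f l)%E -> (f k <= \int[muZ]_l f l)%E.
Proof.
move=> f0; rewrite -{1}(integral_countZ_set1 f k).
apply: ge0_subset_integral => //; exact: measurable_fun_Zn.
Qed.

(** Tonelli on the graph of s: the function equal to f(l) when l = s(k) and to 0 otherwise sums over
    l to f(s k), and over k to f(l). *)
Lemma integral_countZ_bij (f : Zn n -> \bar R) (s t : Zn n -> Zn n) :
  cancel s t -> cancel t s -> (forall k, 0 <= f k)%E ->
  (\int[muZ]_k f (s k) = \int[muZ]_k f k)%E.
Proof.
move=> st ts f0.
pose G (z : Zn n * Zn n) : \bar R := if z.2 == s z.1 then f z.2 else 0%E.
have mG : measurable_fun setT G.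
  by apply: measurable_fun_Znprod => k; exact: measurable_fun_Zn.
have G0 z : (0 <= G z)%E by rewrite /G; case: ifPn.
have := fubini_tonelli (m1 := muZ) (m2 := muZ) G mG G0.
have -> : (\int[muZ]_x \int[muZ]_y G (x, y) = \int[muZ]_k f (s k))%E.
  apply: eq_integral => k _; rewrite (integral_countZ_point (k := s k)).
    by rewrite /G/= eqxx.
  by move=> l /negPf lk; rewrite /G/= lk.
move=> ->; apply: eq_integral => l _.
rewrite (integral_countZ_point (k := t l)) /G/= ?ts ?eqxx//.
move=> k kt; case: ifPn => // /eqP lk; move: kt.
by rewrite lk st eqxx.
Qed.

Lemma integral_countZ_shift (f : Zn n -> \bar R) m : (forall k, 0 <= f k)%E ->
  (\int[muZ]_k f (k - m)%R = \int[muZ]_k f k)%E.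
Proof.
by apply: (@integral_countZ_bij f (fun k => k - m) (fun k => k + m)) => k;
  rewrite ?subrK ?addrK.
Qed.

Lemma integral_countZ_subl (f : Zn n -> \bar R) m : (forall k, 0 <= f k)%E ->
  (\int[muZ]_k f (m - k)%R = \int[muZ]_k f k)%E.
Proof.
by apply: (@integral_countZ_bij f (fun k => m - k) (fun k => m - k)) => k;
  rewrite opprB addrCA subrr addr0.
Qed.

Lemma cintegral_countZ_point (f : Zn n -> R[i]) k :
  (forall l, l != k -> f l = 0) -> cintegrable muZ f /\ cintegral muZ f = f k.
Proof.
move=> f0; split.
  apply/cintegrableP; split; first exact: cmeasurable_Zn.
  rewrite (integral_countZ_point (k := k)) ?ltry// => l /f0 ->.
  by rewrite cmod0.
apply: complexP; rewrite /= /Rintegral (integral_countZ_point (k := k))//.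
  by move=> l /f0 ->.
by move=> l /f0 ->.
Qed.

Lemma cintegrable_countZP (f : Zn n -> R[i]) : cintegrable muZ f <->
  (\int[muZ]_k (cmod (f k))%:E < +oo)%E.
Proof.
rewrite cintegrableP; split=> [[]//|fi]; split=> //; exact: cmeasurable_Zn.
Qed.

(** [absZ] as a natural number, so that it can index the spheres over which weights are summed. *)
Definition normZ (k : Zn n) : nat := (\sum_(i < n) `|(k : 'rV[int]_n)
  ord0 i|)%N.

Lemma absZE (k : Zn n) : absZ R k = (normZ k)%:R.
Proof.
rewrite /absZ /normZ natr_sum; apply: eq_bigr => i _.
by rewrite natr_absz.
Qed.

Lemma absZ_ge0 (k : Zn n) : 0 <= absZ R k.
Proof. by rewrite absZE. Qed.

Lemma absZD (k l : Zn n) : absZ R (k + l) <= absZ R k + absZ R l.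
Proof.
rewrite /absZ -big_split/=; apply: ler_sum => i _.
by rewrite mxE -intrD ler_int ler_normD.
Qed.

Lemma absZN (k : Zn n) : absZ R (- k) = absZ R k.
Proof. by rewrite /absZ; apply: eq_bigr => i _; rewrite mxE normrN. Qed.

(* Peetre's inequality *)
Lemma weightD (k l : Zn n) :
  1 + absZ R (k + l) <= (1 + absZ R k) * (1 + absZ R l).
Proof.
have := absZD k l; have := absZ_ge0 k; have := absZ_ge0 l.
by move=> a b c; nra.
Qed.

Lemma weight_ge1 (k : Zn n) : 1 <= 1 + absZ R k.
Proof. by rewrite lerDl absZ_ge0. Qed.

Lemma weight_gt0 (k : Zn n) : 0 < 1 + absZ R k.
Proof. by rewrite (lt_le_trans ltr01)// weight_ge1. Qed.

(** The sphere lies in the cube [-i, i]^n, parametrized by [g]; its indicator is at most the sum of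
    the indicators of the points of the cube. *)
Lemma countZ_sphere_le (i : nat) :
  (muZ [set k | normZ k = i] <= (i.*2.+1 ^ n)%N%:R%:E)%E.
Proof.
pose g (t : 'rV['I_(i.*2.+1)]_n) : Zn n :=
  \row_j ((t ord0 j : nat)%:Z - i%:Z).
have gP (k : Zn n) : normZ k = i -> exists t, g t = k.
  move=> ki; have kb j : (`|(k : 'rV[int]_n) ord0 j| <= i)%N.
    by rewrite -ki /normZ (bigD1 j)//= leq_addr.
  have lt j : (`|((k : 'rV[int]_n) ord0 j + i%:Z)%R| < i.*2.+1)%N.
    by have := kb j; lia.
  exists (\row_j (Ordinal (lt j))); apply/rowP => j; rewrite !mxE/=.
  by move: (kb j); set a := (fun_of_matrix _ _ _) => ?; rewrite gez0_abs; lia.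
rewrite -[leLHS]mul1e -integral_cst// integral_mkcond.
apply: (@le_trans _ _ (\int[muZ]_k (\sum_(t : 'rV['I_(i.*2.+1)]_n)
    (if k == g t then 1%E else 0%E)))%E).
  apply: ge0_le_integral => //.
  - by move=> k _; rewrite patchE; case: ifP.
  - move=> k _; rewrite patchE; case: ifPn => [|_]; last first.
      by apply: sume_ge0 => t _; case: ifP.
    rewrite inE => /gP[t <-]; rewrite (bigD1 t)//= eqxx leeDl//.
    by apply: sume_ge0 => u _; case: ifP.
rewrite ge0_integral_sum//; last by move=> t k _; case: ifP.
under eq_bigr => t _.
  rewrite (integral_countZ_point (k := g t)); last by move=> l /negPf ->.
  rewrite eqxx; over.
by rewrite sumEFin sumr_const card_mx card_ord mul1n.
Qed.

End counting_Zn.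

(** * Summability of polynomial weights on Z^n *)

Section weights.
Variables (R : realType) (n : nat).
Local Notation muZ := (@countZ R n).

Lemma sum_inv_sqr_le (N : nat) :
  \sum_(0 <= i < N) ((i.+1%:R ^+ 2)^-1 : R) <= 2.
Proof.
(* The sharper bound makes the induction work, since 1/(N+2)^2 <= 1/(N+1) - 1/(N+2). *)
suff H : \sum_(0 <= i < N.+1) ((i.+1%:R ^+ 2)^-1 : R) <= 2 - N.+1%:R^-1.
  apply: le_trans (le_trans H _); last by rewrite gerBl.
  by rewrite big_nat_recr//= lerDl invr_ge0 exprn_ge0.
elim: N => [|N IH]; first by rewrite big_nat1 expr1n invr1; lra.
rewrite big_nat_recr//=; apply: (le_trans (lerD IH (lexx _))).
have a0 : (0 : R) < N.+1%:R by rewrite ltr0n.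
have -> : N.+2%:R = N.+1%:R + 1 :> R by rewrite natr1.
set a : R := N.+1%:R in a0 *.
rewrite -subr_ge0 (_ : _ - _ = (a * (a + 1) ^+ 2)^-1).
  by rewrite invr_ge0 mulr_ge0 ?sqr_ge0// ltW.
by field; apply/andP; split; lra.
Qed.

(** Sum over spheres: the one of radius i has at most (2i + 1)^n <= 2^n (i + 1)^n points, so the
    exponent n + 2 leaves 2^n / (i + 1)^2. *)
Lemma weight_integral_lty :
  (\int[muZ]_k ((1 + absZ R k) ^- (n + 2))%:E < +oo)%E.
Proof.
pose F i := [set k : Zn n | normZ k = i].
have FT : \bigcup_i F i = [set: Zn n].
  by apply/seteqP; split => // k _; exists (normZ k).
have f0 (k : Zn n) : (0 <= ((1 + absZ R k) ^- (n + 2))%:E)%E.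
  by rewrite lee_fin invr_ge0 exprn_ge0// ltW// weight_gt0.
rewrite -FT ge0_integral_bigcup//; last first.
  by apply/trivIsetP => i j _ _ ij; apply/seteqP; split => // k [/= ki kj];
    move: ij; rewrite -ki -kj eqxx.
apply: (@le_lt_trans _ _ ((2 ^ n)%:R * 2)%:E); last by rewrite ltry.
apply: lime_le.
  by apply: is_cvg_nneseries => i _ _; apply: integral_ge0.
apply: nearW => N; rewrite EFinM.
apply: (@le_trans _ _ (\sum_(0 <= i < N) ((2 ^ n)%:R * (i.+1%:R ^+
  2)^-1)%:E)%E).
  apply: lee_sum => i _.
  rewrite (eq_integral (cst (i.+1%:R ^- (n + 2))%:E)); last first.
    by move=> k; rewrite inE/= => ki; rewrite absZE ki -natr1 addrC.
  rewrite integral_cst//.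
  apply: (@le_trans _ _ ((i.+1%:R ^- (n + 2))%:E * (i.*2.+1 ^ n)%N%:R%:E)%E).
    by apply: lee_wpmul2l; [rewrite lee_fin invr_ge0 exprn_ge0|exact:
      countZ_sphere_le].
  rewrite -EFinM lee_fin exprD invfM mulrAC ler_pM2r ?invr_gt0 ?exprn_gt0//.
  rewrite ler_pdivrMl ?exprn_gt0// -natrX -natrM ler_nat -expnMn.
  by case: n => // n'; rewrite leq_exp2r//; lia.
rewrite sumEFin -mulr_sumr -EFinM lee_fin ler_pM2l ?ltr0n ?expn_gt0//.
exact: sum_inv_sqr_le.
Qed.

End weights.

(** * Inequalities in l^p(Z^n) *)

Lemma cmodX (R : realType) (z : R[i]) m : cmod (z ^+ m) = cmod z ^+ m.
Proof.
by elim: m => [|m IH]; rewrite ?expr0 ?cmod1// !exprS cmodM IH.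
Qed.

Section lp_inequalities.
Variable R : realType.

Lemma lee_of_eq (a b : \bar R) : a = b -> (a <= b)%E.
Proof. by move->. Qed.

Lemma poweR_le (a b : \bar R) (r : R) :
  0 <= r -> (0 <= a)%E -> (a <= b)%E -> (a `^ r <= b `^ r)%E.
Proof.
move=> r0 a0 ab; apply: gt0_ler_poweR => //; rewrite in_itv/= leey andbT//.
exact: le_trans ab.
Qed.

Lemma hoelder_conjugate_fin (r : R) : 1 < r ->
  hoelder_conjugate r%:E = (r / (r - 1))%:E.
Proof.
move=> r1; rewrite /hoelder_conjugate/= eqe gt_eqF ?(lt_trans ltr01)//.
by rewrite -EFinD inver subr_eq0 gt_eqF.
Qed.

Section general_measure.
Context d (T : measurableType d) (mu : {measure set T -> \bar R}).

Lemma LpNormE (r : R) (f : T -> R[i]) :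
  LpNorm mu r%:E f = ((\int[mu]_x (cmod (f x) `^ r)%:E) `^ r^-1)%E.
Proof.
rewrite /LpNorm unlock; congr (_ `^ _)%E; apply: eq_integral => x _.
by rewrite /= ger0_norm ?cmod_ge0.
Qed.

Lemma LpNorm_ge0 p (f : T -> R[i]) : (0 <= LpNorm mu p f)%E.
Proof. exact: Lnorm_ge0. Qed.

Lemma LpNorm1 (f : T -> R[i]) : LpNorm mu 1 f = (\int[mu]_x (cmod (f x))%:E)%E.
Proof.
rewrite /LpNorm Lnorm1; apply: eq_integral => x _.
by rewrite gee0_abs// lee_fin cmod_ge0.
Qed.

Lemma LpNorm_infty_le (f : T -> R[i]) (M : \bar R) : (0 <= M)%E ->
  (forall x, (cmod (f x))%:E <= M)%E -> (LpNorm mu +oo f <= M)%E.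
Proof.
move=> M0 fM; rewrite /LpNorm unlock; case: ifPn => // _.
apply/ess_supP; apply: nearW => x /=.
by rewrite /= ger0_norm ?cmod_ge0.
Qed.

(** Jensen for the weight u, derived from Hölder with the splitting u h = u^(1/q) (u^(1/r) h), 1/q +
    1/r = 1. The mass of u is at most U rather than 1, hence the factor U^(r - 1). *)
Lemma jensen_powR (u h : T -> R) (U r : R) : 1 <= r ->
  measurable_fun [set: T] u -> measurable_fun [set: T] h ->
  (forall x, 0 <= u x) -> (forall x, 0 <= h x) ->
  (\int[mu]_x (u x)%:E <= U%:E)%E ->
  ((\int[mu]_x (u x * h x)%:E) `^ r <=
     (U `^ (r - 1))%:E * \int[mu]_x (u x * h x `^ r)%:E)%E.
Proof.
move=> r1 mu_ mh u0 h0 uU.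
have r0 : 0 < r by rewrite (lt_le_trans ltr01).
(* At r = 1 the exponent [q] below would be infinite; both sides then coincide. *)
have [{r1}<-|rn1] := eqVneq 1 r.
  rewrite subrr powRr0 mul1e poweRe1; last first.
    by apply: integral_ge0 => x _; rewrite lee_fin mulr_ge0.
  by apply: lee_of_eq; apply: eq_integral => x _; rewrite powRr1.
have {}r1 : 1 < r by rewrite lt_neqAle rn1.
pose q := r / (r - 1).
have rB0 : 0 < r - 1 by rewrite subr_gt0.
have q0 : 0 < q by rewrite divr_gt0.
have qr : q^-1 + r^-1 = 1 by clear -r0 rB0 q; rewrite /q; field; lra.
pose f x := u x `^ q^-1; pose g x := u x `^ r^-1 * h x.
have mp s : measurable_fun setT (fun x => u x `^ s).
  exact: (measurableT_comp (measurable_powR s)).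
have mf : measurable_fun setT f by exact: mp.
have mg : measurable_fun setT g by exact: measurable_funM.
have fg x : f x * g x = u x * h x.
  rewrite /f /g mulrA -powRD ?qr ?oner_eq0// powRr1//.
have := hoelder mu mf mg q0 r0 qr.
rewrite Lnorm1 [X in (X <= _)%E -> _](_ : _ = (\int[mu]_x (u x * h x)%:E)%E);
  last first.
  apply: eq_integral => x _ /=; rewrite fg ger0_norm// mulr_ge0//.
rewrite unlock.
rewrite [X in (_ <= X `^ _ * _)%E -> _](_ : _ = (\int[mu]_x (u x)%:E)%E);
  last first.
  apply: eq_integral => x _ /=; rewrite ger0_norm ?powR_ge0//.
  by rewrite /f -powRrM mulVf ?gt_eqF// powRr1.
rewrite [X in (_ <= _ * X `^ _)%E -> _](_ : _ = (\int[mu]_x (u x * h x `^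
  r)%:E)%E); last first.
  apply: eq_integral => x _ /=.
  rewrite ger0_norm ?mulr_ge0 ?powR_ge0// /g powRM ?powR_ge0//.
  by rewrite -powRrM mulVf ?gt_eqF// powRr1.
move=> /(poweR_le (ltW r0)) H.
apply: le_trans (H _) _.
  by apply: integral_ge0 => x _; rewrite lee_fin mulr_ge0.
rewrite poweRM ?poweR_ge0// -!poweRrM mulVf ?gt_eqF// poweRe1; last first.
  by apply: integral_ge0 => x _; rewrite lee_fin mulr_ge0 ?powR_ge0.
have -> : q^-1 * r = r - 1 by clear -r0 rB0 q; rewrite /q; field; lra.
apply: lee_wpmul2r.
  by apply: integral_ge0 => x _; rewrite lee_fin mulr_ge0 ?powR_ge0.
rewrite -poweR_EFin; apply: poweR_le => //; first exact: ltW.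
by apply: integral_ge0 => x _; rewrite lee_fin.
Qed.

End general_measure.

Section sequences_on_Zn.
Variable n : nat.
Local Notation muZ := (@countZ R n).
Implicit Types (f g : Zn n -> R[i]) (p : \bar R).

Lemma countZT_gt0 : (0 < muZ [set: Zn n])%E.
Proof.
apply: (@lt_le_trans _ _ (muZ [set 0])); first by rewrite countZ_set1.
by apply: le_measure; rewrite ?inE.
Qed.

(** For finite p, one term is at most the whole sum. For p = +oo, a point has mass 1, so the
    exceptional null set of the essential supremum contains no point. *)
Lemma cmod_le_LpNorm p f k : (1 <= p)%E -> ((cmod (f k))%:E <= LpNorm muZ p
  f)%E.
Proof.
case: p => [r||//]; rewrite ?lee_fin => p1.
  have r0 : 0 < r by rewrite (lt_le_trans ltr01).
  rewrite LpNormE.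
  have -> : (cmod (f k))%:E = ((cmod (f k) `^ r)%:E `^ r^-1)%E.
    by rewrite poweR_EFin -powRrM divff ?gt_eqF// powRr1// cmod_ge0.
  apply: poweR_le; rewrite ?lee_fin ?powR_ge0// ?invr_ge0 ?(ltW r0)//.
  apply: (@le_integral_countZ R n (fun k => (cmod (f k) `^ r)%:E)) => l.
  by rewrite lee_fin powR_ge0.
rewrite /LpNorm unlock countZT_gt0.
have [A [_ A0 fA]] := ess_sup_ge (@countZ R n) (abse \o (fun x =>
  (cmod (f x))%:E)).
apply: contrapT => /negP nle.
suff : (1 <= muZ A)%E by rewrite (_ : muZ A = 0%E)// leNgt lte01.
rewrite -(countZ_set1 R k).
apply: le_measure; rewrite ?inE// => _ ->; by apply: fA => /=;
  rewrite ger0_norm ?cmod_ge0//; exact/negP.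
Qed.

Lemma hoelder_countZ p f g : (1 <= p)%E ->
  (LpNorm muZ p f < +oo)%E -> (LpNorm muZ (hoelder_conjugate p) g < +oo)%E ->
  (\int[muZ]_k (cmod (f k) * cmod (g k))%:E <=
     LpNorm muZ p f * LpNorm muZ (hoelder_conjugate p) g)%E.
Proof.
(* Serves both endpoints p = 1 and p = +oo, where Hölder amounts to the pointwise bound of v by its
   supremum norm. *)
have aux (u v : Zn n -> R[i]) : (LpNorm muZ +oo v < +oo)%E ->
    (\int[muZ]_k (cmod (u k) * cmod (v k))%:E <= LpNorm muZ 1 u * LpNorm muZ
      +oo v)%E.
  move=> voo; have [M vM] : exists M, LpNorm muZ +oo v = M%:E.
    exists (fine (LpNorm muZ +oo v)); rewrite fineK// ge0_fin_numE//.
    exact: LpNorm_ge0.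
  rewrite vM LpNorm1 muleC -ge0_integralZl_EFin//; first last.
  - by rewrite -lee_fin -vM LpNorm_ge0.
  - by move=> k _; rewrite lee_fin cmod_ge0.
  apply: ge0_le_integral => //.
    by move=> k _; rewrite lee_fin mulr_ge0 ?cmod_ge0.
  move=> k _; rewrite -EFinM lee_fin mulrC ler_wpM2r ?cmod_ge0//.
  by rewrite -lee_fin -vM; apply: cmod_le_LpNorm; rewrite leey.
case: p => [r||//]; last first.
  move=> _ foo goo; rewrite hoelder_conjugatey muleC;
    apply: le_trans (aux _ _ foo).
  by apply: lee_of_eq; apply: eq_integral => k _; rewrite mulrC.
rewrite lee_fin le_eqVlt => /predU1P[<-|r1] foo goo.
  by move: goo; rewrite hoelder_conjugate1 => goo; exact: aux.
rewrite hoelder_conjugate_fin//.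
have rB0 : 0 < r - 1 by rewrite subr_gt0.
have r0 : 0 < r by rewrite (lt_trans ltr01).
have := @hoelder _ _ _ muZ (fun k => cmod (f k)) (fun k => cmod (g k))
  r (r / (r - 1)).
rewrite Lnorm1 => H; apply: le_trans (H _ _ _ _ _) => //.
- apply: lee_of_eq; apply: eq_integral => k _ /=.
  by rewrite ger0_norm// mulr_ge0 ?cmod_ge0.
- by rewrite divr_gt0.
- by clear -r0 rB0; field; lra.
Qed.

(* [nu] and [kap] are such that functions of [kap y] have the same integral as
   on Z^n: this covers both Z^n itself and Z^n x T^n with the first projection. *)
Lemma young_countZ d (Y : measurableType d) (nu : {measure set Y -> \bar R})
    (kap : Y -> Zn n) (u : Zn n -> R) (U : R) p f (V : Y -> R[i]) :
  (1 <= p)%E ->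
  measurable_fun [set: Y] kap ->
  (forall G : Zn n -> \bar R, (forall k, 0 <= G k)%E ->
     \int[nu]_y G (kap y) = \int[muZ]_k G k)%E ->
  cmeasurable V ->
  (forall k, 0 <= u k) -> (\int[muZ]_k (u k)%:E <= U%:E)%E ->
  (LpNorm muZ p f < +oo)%E ->
  (forall y, (cmod (V y))%:E <= \int[muZ]_m (u m * cmod (f (kap y -
    m)%R))%:E)%E ->
  (LpNorm nu p V <= U%:E * LpNorm muZ p f)%E.
Proof.
move=> p1 mk kapE mV u0 uU foo Vf.
have U0 : 0 <= U.
  by rewrite -lee_fin; apply: le_trans uU; apply: integral_ge0 => k _;
    rewrite lee_fin.
case: p p1 foo => [r||//] p1 foo; last first.
  apply: LpNorm_infty_le; first by rewrite mule_ge0 ?lee_fin ?LpNorm_ge0.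
  move=> y; apply: (le_trans (Vf y)).
  have [M vM] : exists M, LpNorm muZ +oo f = M%:E.
    exists (fine (LpNorm muZ +oo f)); rewrite fineK// ge0_fin_numE//.
    exact: LpNorm_ge0.
  have M0 : 0 <= M by rewrite -lee_fin -vM LpNorm_ge0.
  apply: (@le_trans _ _ (\int[muZ]_m (M%:E * (u m)%:E))%E).
    apply: ge0_le_integral => //.
      by move=> k _; rewrite lee_fin mulr_ge0 ?cmod_ge0.
    move=> k _; rewrite -EFinM lee_fin mulrC ler_wpM2r//.
    by rewrite -lee_fin -vM; apply: cmod_le_LpNorm; rewrite leey.
  rewrite ge0_integralZl_EFin//; last by move=> k _; rewrite lee_fin.
  by rewrite muleC vM lee_wpmul2r.
move: p1; rewrite lee_fin => r1.
have r0 : 0 < r by rewrite (lt_le_trans ltr01).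
rewrite !LpNormE.
have -> : U%:E = ((U `^ r)%:E `^ r^-1)%E.
  by rewrite poweR_EFin -powRrM divff ?gt_eqF// powRr1.
rewrite -poweRM ?lee_fin ?powR_ge0//; last first.
  by apply: integral_ge0 => k _; rewrite lee_fin powR_ge0.
have mW : measurable_fun [set: Zn n * Zn n]
    (fun z => (u z.2 * cmod (f (z.1 - z.2)) `^ r)%:E).
  by apply: measurable_fun_Znprod => k.
have W0 z : (0 <= (u z.2 * cmod (f (z.1 - z.2)) `^ r)%:E)%E.
  by rewrite lee_fin mulr_ge0 ?powR_ge0.
apply: poweR_le; first by rewrite invr_ge0 ltW.
  by apply: integral_ge0 => k _; rewrite lee_fin powR_ge0.
(* Jensen with the weight u costs U^(r - 1). After Tonelli every translate of |f|^r has the same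
   sum, so the remaining mass of u contributes one more U, for a total of U^r. *)
apply: (@le_trans _ _ (\int[nu]_y ((U `^ (r - 1))%:E *
    \int[muZ]_m (u m * cmod (f (kap y - m)%R) `^ r)%:E))%E).
  apply: ge0_le_integral => //.
  - by move=> y _; rewrite lee_fin powR_ge0.
  - apply/measurable_EFinP; apply: (measurableT_comp (measurable_powR r)).
    exact: measurable_cmod.
  - apply: (measurableT_comp (f := fun k : Zn n => ((U `^ (r - 1))%:E *
      \int[muZ]_m (u m * cmod (f (k - m)%R) `^ r)%:E)%E)) => //.
  - move=> y _; rewrite -poweR_EFin.
    apply: (@le_trans _ _ ((\int[muZ]_m (u m * cmod (f (kap y - m)%R))%:E)
      `^ r)%E).
      by apply: poweR_le => //; [exact: ltW|rewrite lee_fin cmod_ge0].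
    by apply: jensen_powR => // m; exact: cmod_ge0.
rewrite (kapE (fun k => (U `^ (r - 1))%:E *
    \int[muZ]_m (u m * cmod (f (k - m)%R) `^ r)%:E)%E); last first.
  move=> k; rewrite mule_ge0 ?lee_fin ?powR_ge0//.
  by apply: integral_ge0 => m _; rewrite lee_fin mulr_ge0 ?powR_ge0.
rewrite ge0_integralZl_EFin ?powR_ge0//; last first.
  by move=> k _; apply: integral_ge0 => m _; rewrite lee_fin mulr_ge0 ?powR_ge0.
rewrite (fubini_tonelli (m1 := muZ) (m2 := muZ) _ mW W0)/=.
under eq_integral => m _.
  under eq_integral => k _ do rewrite EFinM.
  rewrite ge0_integralZl_EFin//; last by move=> k _; rewrite lee_fin powR_ge0.
  rewrite (@integral_countZ_shift R n (fun k => (cmod (f k) `^ r)%:E));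
    last first.
    by move=> k; rewrite lee_fin powR_ge0.
  over.
rewrite /= ge0_integralZr//; first last.
- by apply: integral_ge0 => k _; rewrite lee_fin powR_ge0.
- by move=> k _; rewrite lee_fin.
rewrite muleA; apply: lee_wpmul2r.
  by apply: integral_ge0 => k _; rewrite lee_fin powR_ge0.
apply: (@le_trans _ _ ((U `^ (r - 1))%:E * U%:E)%E).
  by apply: lee_wpmul2l => //; rewrite lee_fin powR_ge0.
rewrite -EFinM lee_fin; have [->|Un0] := eqVneq U 0.
  by rewrite mulr0 powR_ge0.
rewrite -{2}(powRr1 U0) -powRD ?subrK//.
by rewrite Un0 implybT.
Qed.

End sequences_on_Zn.

End lp_inequalities.

(** * Derivatives along lines *)

Section directional_derivatives.
Variable R : realType.

(** A directional derivative sees only the restriction to a line. This lets derivatives on R^n be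
    exchanged with those on coordinate lines and on slices of [Tn_cons]. *)
Lemma is_derive_transport (V W : normedModType R) (F : V -> R) (G : W -> R)
    (x v : V) (y w : W) (d : R) :
  (forall h : R, F (h *: v + x) = G (h *: w + y)) ->
  is_derive y w G d -> is_derive x v F d.
Proof.
move=> FG [exG dG].
have F0 : F x = G y by have := FG 0; rewrite !scale0r !add0r.
have E : (fun h : R => h^-1 *: ((F \o shift x) (h *: v) - F x)) =
         (fun h : R => h^-1 *: ((G \o shift y) (h *: w) - G y)).
  by apply/funext => h /=; rewrite FG F0.
by split; [rewrite /derivable E|rewrite /derive E].
Qed.

(** A quadratic remainder, unlike a limit, can be summed over a series term by term; this is how
    [fseries_cderive] differentiates. *)
Lemma is_derive_quadratic (V : normedModType R) (g : V -> R) (x v : V) (d C : R)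
  :
  (forall h : R, `|g (h *: v + x) - g x - h * d| <= C * h ^+ 2) ->
  is_derive x v g d.
Proof.
move=> gC.
have cv : h^-1 *: ((g \o shift x) (h *: v) - g x) @[h --> (0 : R)^'] --> d.
  apply/cvgrPdist_le => e e0; near=> h => /=.
  have h0 : h != 0 by near: h; exact: nbhs_dnbhs_neq.
  have -> : d - h^-1 *: (g (h *: v + x) - g x) =
            - (h^-1 * (g (h *: v + x) - g x - h * d)).
    by rewrite /GRing.scale/= [in RHS]mulrBr mulKf// opprB.
  rewrite normrN normrM normfV ler_pdivrMl ?normr_gt0//.
  apply: (le_trans (gC h)).
  (* C has no sign hypothesis; [|C| + 1] is a positive replacement by which one can divide. *)
  have C1 : 0 < `|C| + 1 by rewrite ltr_wpDl.
  apply: (@le_trans _ _ ((`|C| + 1) * `|h| ^+ 2)).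
    rewrite real_normK ?num_real// ler_wpM2r ?sqr_ge0//.
    by rewrite (le_trans (ler_norm _))// lerDl.
  rewrite expr2 mulrA mulrC ler_wpM2l// mulrC -ler_pdivlMr//.
  near: h; apply: dnbhs0_le; exact: divr_gt0.
split; first by apply/cvg_ex; exists d.
exact: cvg_lim cv.
Unshelve. all: by end_near. Qed.

Lemma is_derive_continuous1 (f : R -> R) (x d : R) :
  is_derive x 1 f d -> {for x, continuous f}.
Proof.
by move=> [fx _]; apply/differentiable_continuous/derivable1_diffP.
Qed.

(** Mean value theorem. The derivative is bounded only within distance |t - s| of s, so M may depend
    on t: [cos_quadratic] takes M = |t|. *)
Lemma lipschitz_is_derive1 (f df : R -> R) (M : R) :
  (forall x : R, is_derive x 1 f (df x)) ->
  forall s t, (forall u, `|u - s| <= `|t - s| -> `|df u| <= M) ->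
  `|f t - f s| <= M * `|t - s|.
Proof.
move=> fd s t dfM.
have cf (a b : R) : {within `[a, b], continuous f}.
  by apply: continuous_subspaceT => u; exact: is_derive_continuous1 (fd u).
have [st|/ltW ts] := leP s t.
  have [c + ->] := MVT_segment st (fun u _ => fd u) (cf s t).
  rewrite in_itv/= => /andP[sc ct]; rewrite normrM ler_wpM2r//.
  by apply: dfM; rewrite !ger0_norm ?subr_ge0// lerB.
have [c + E] := MVT_segment ts (fun u _ => fd u) (cf t s).
rewrite in_itv/= => /andP[tc cs]; rewrite distrC E distrC normrM distrC
  ler_wpM2r//.
by apply: dfM; rewrite !ler0_norm ?subr_le0// lerN2 lerB.
Qed.

Lemma cos_lipschitz (s t : R) : `|cos t - cos s| <= `|t - s|.
Proof.
rewrite -[leRHS]mul1r.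
apply: (@lipschitz_is_derive1 cos (fun u => - sin u)) => u _.
by rewrite normrN sin_max.
Qed.

Lemma sin_lipschitz (s t : R) : `|sin t - sin s| <= `|t - s|.
Proof.
rewrite -[leRHS]mul1r.
apply: (@lipschitz_is_derive1 sin cos) => u _.
by rewrite cos_max.
Qed.

Lemma cos_quadratic (t : R) : `|cos t - 1| <= t ^+ 2.
Proof.
rewrite -cos0 (_ : t ^+ 2 = `|t| * `|t - 0|); last first.
  by rewrite subr0 -normrM -expr2 ger0_norm// sqr_ge0.
apply: (@lipschitz_is_derive1 cos (fun u => - sin u)) => u.
rewrite !subr0 normrN => ut; apply: le_trans ut.
by have := sin_lipschitz 0 u; rewrite sin0 !subr0.
Qed.

Lemma sin_quadratic (t : R) : `|sin t - t| <= t ^+ 2.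
Proof.
have -> : sin t - t = (sin t - t) - (sin 0 - 0) by rewrite sin0 !subr0.
rewrite (_ : t ^+ 2 = `|t| * `|t - 0|); last first.
  by rewrite subr0 -normrM -expr2 ger0_norm// sqr_ge0.
apply: (@lipschitz_is_derive1 (fun u => sin u - u) (fun u => cos u - 1)) => u.
rewrite !subr0 => ut; apply: le_trans ut.
by have := cos_lipschitz 0 u; rewrite cos0 !subr0.
Qed.

Lemma expi_lipschitz (s t : R) : cmod (expi t - expi s) <= 4 * pi * `|t - s|.
Proof.
apply: (le_trans (cmod_le_ReIm _)); rewrite cReD cImD cReN cImN/=.
apply: (le_trans (lerD (cos_lipschitz _ _) (sin_lipschitz _ _))).
rewrite -mulrBr normrM ger0_norm ?mulr_ge0 ?pi_ge0// -mulrDl ler_wpM2r//.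
by have := pi_ge0 R; lra.
Qed.

(** The real and the imaginary part each contribute (2 pi t)^2. *)
Lemma expi_quadratic (t : R) :
  cmod (expi t - 1 - Complex 0 (2 * pi * t)) <= 8 * pi ^+ 2 * t ^+ 2.
Proof.
apply: (le_trans (cmod_le_ReIm _)); rewrite !cReD !cImD !cReN !cImN/= !subr0.
apply: (le_trans (lerD (cos_quadratic _) (sin_quadratic _))).
by rewrite -mulr2n !exprMn mulr_natl; nra.
Qed.

End directional_derivatives.

(** * Characters and Lipschitz functions on the torus *)

Section functions_on_Tn.
Variables (R : realType) (n : nat).
Local Notation T := (Tn R n).
Implicit Types (f g : T -> R[i]) (x y : T) (k l : Zn n).

Definition l1norm (x : 'rV[R]_n) : R := \sum_(i < n) `|x ord0 i|.

Lemma l1norm_ge0 x : 0 <= l1norm x.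
Proof. exact: sumr_ge0. Qed.

Lemma l1norm_delta i (h : R) : l1norm (h *: delta_mx ord0 i) = `|h|.
Proof.
rewrite /l1norm (bigD1 i)//= !mxE !eqxx mulr1 big1 ?addr0// => j /negPf ji.
by rewrite !mxE ji andbF mulr0 normr0.
Qed.

Lemma dotpDl x y k : dotp (x + y) k = dotp x k + dotp y k.
Proof.
by rewrite /dotp -big_split/=; apply: eq_bigr => i _; rewrite mxE mulrDl.
Qed.

Lemma dotpNl x k : dotp (- x) k = - dotp x k.
Proof.
by rewrite /dotp -sumrN; apply: eq_bigr => i _; rewrite mxE mulNr.
Qed.

Lemma dotpBl x y k : dotp (x - y) k = dotp x k - dotp y k.
Proof. by rewrite dotpDl dotpNl. Qed.

Lemma dotpDr x k l : dotp x (k + l) = dotp x k + dotp x l.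
Proof.
by rewrite /dotp -big_split/=; apply: eq_bigr => i _; rewrite mxE intrD mulrDr.
Qed.

Lemma dotpNr x k : dotp x (- k) = - dotp x k.
Proof.
by rewrite /dotp -sumrN; apply: eq_bigr => i _; rewrite mxE mulrNz mulrN.
Qed.

Lemma dotp0r x : dotp x 0 = 0.
Proof. by rewrite /dotp big1// => i _; rewrite mxE mulr0. Qed.

Lemma dotp_delta i (h : R) k :
  dotp (h *: delta_mx ord0 i : 'rV[R]_n) k = h * ((k : 'rV[int]_n) ord0 i)%:~R.
Proof.
rewrite /dotp (bigD1 i)//= !mxE !eqxx mulr1 big1 ?addr0// => j /negPf ji.
by rewrite !mxE ji andbF mulr0 mul0r.
Qed.

Lemma dotp_intr (z : 'rV[int]_n) k : exists m : int,
  dotp (map_mx (fun a : int => a%:~R : R) z : 'rV[R]_n) k = m%:~R.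
Proof.
exists (\sum_(i < n) z ord0 i * (k : 'rV[int]_n) ord0 i).
by rewrite /dotp rmorph_sum; apply: eq_bigr => i _; rewrite mxE rmorphM.
Qed.

Lemma normr_coord_le_absZ k i : `|((k : 'rV[int]_n) ord0 i)%:~R| <= absZ R k.
Proof.
rewrite /absZ (bigD1 i)//= -intr_norm lerDl.
by apply: sumr_ge0 => j _; rewrite ler0z.
Qed.

Lemma normr_dotp_le x k : `|dotp x k| <= absZ R k * l1norm x.
Proof.
rewrite /dotp /l1norm mulr_sumr (le_trans (ler_norm_sum _ _ _))//.
by apply: ler_sum => i _; rewrite normrM mulrC ler_wpM2r// normr_coord_le_absZ.
Qed.

Definition echar k : T -> R[i] := fun x => expi (dotp x k).

Lemma echarD k l x : echar (k + l) x = echar k x * echar l x.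
Proof. by rewrite /echar dotpDr expiD. Qed.

Lemma echar_conj k x : conjc (echar k x) = echar (- k) x.
Proof. by rewrite /echar conj_expi dotpNr. Qed.

Lemma echar0 x : echar 0 x = 1.
Proof. by rewrite /echar dotp0r expi0. Qed.

Lemma cmod_echar k x : cmod (echar k x) = 1.
Proof. exact: cmod_expi. Qed.

Lemma echar_periodic k : Defs.periodic (echar k).
Proof.
move=> x z; rewrite /echar dotpDl expiD.
by have [m ->] := dotp_intr z k; rewrite expi_int mulr1.
Qed.

Lemma echar_lipschitz k x y :
  cmod (echar k x - echar k y) <= 4 * pi * absZ R k * l1norm (x - y).
Proof.
apply: (le_trans (expi_lipschitz _ _)); rewrite -dotpBl -[leRHS]mulrA
  ler_wpM2l//.
  by rewrite mulr_ge0// pi_ge0.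
exact: normr_dotp_le.
Qed.

(* the Fourier multiplier of the i-th partial derivative *)
Definition dfactor i k : R[i] := Complex 0 (2 * pi * ((k : 'rV[int]_n)
  ord0 i)%:~R).

Lemma cmod_dfactor i k :
  cmod (dfactor i k) = 2 * pi * `|((k : 'rV[int]_n) ord0 i)%:~R|.
Proof.
rewrite cmodE/= expr0n/= add0r sqrtr_sqr !normrM.
by rewrite normr_nat (ger0_norm (pi_ge0 R)).
Qed.

Lemma cmod_dfactor_le i k : cmod (dfactor i k) <= 2 * pi * absZ R k.
Proof.
by rewrite cmod_dfactor ler_wpM2l ?mulr_ge0 ?pi_ge0// normr_coord_le_absZ.
Qed.

Lemma echar_quadratic i k x (h : R) :
  cmod (echar k (h *: (delta_mx ord0 i : 'rV[R]_n) + x) - echar k x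
        - real_complex R h * (dfactor i k * echar k x))
  <= 8 * pi ^+ 2 * absZ R k ^+ 2 * h ^+ 2.
Proof.
rewrite /echar dotpDl dotp_delta expiD; set t := h * _.
have -> : expi t * expi (dotp x k) - expi (dotp x k)
    - real_complex R h * (dfactor i k * expi (dotp x k)) =
    (expi t - 1 - Complex 0 (2 * pi * t)) * expi (dotp x k).
  rewrite !mulrBl mul1r mulrA; congr (_ - _ * _).
  by apply: complexP; rewrite ?cReM ?cImM /t/=; ring.
rewrite cmodM cmod_expi mulr1; apply: (le_trans (expi_quadratic _)).
rewrite -[leRHS]mulrA ler_wpM2l//; first by rewrite mulr_ge0// sqr_ge0.
rewrite /t exprMn mulrC ler_wpM2r ?sqr_ge0//.
rewrite -[leLHS]real_normK ?num_real// ler_pXn2r ?nnegrE ?absZ_ge0//.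
exact: normr_coord_le_absZ.
Qed.

(** Bounded Lipschitz functions. The class contains the characters, is closed under products and
    finite sums, and consists of integrable functions, so the arguments up to uniqueness of Fourier
    coefficients can stay inside it. *)
Definition blip f : Prop := exists B : R, (forall x, cmod (f x) <= B) /\
  forall x y, cmod (f x - f y) <= B * l1norm (x - y).

Lemma blip_cst (z : R[i]) : blip (fun=> z).
Proof.
exists (cmod z); split => // x y; rewrite subrr cmod0 mulr_ge0 ?cmod_ge0//.
exact: l1norm_ge0.
Qed.

Lemma blip_echar k : blip (echar k).
Proof.
exists (1 + 4 * pi * absZ R k); split=> [x|x y].
  by rewrite cmod_echar lerDl !mulr_ge0 ?absZ_ge0 ?pi_ge0.
apply: (le_trans (echar_lipschitz _ _ _)).
by rewrite ler_wpM2r ?l1norm_ge0// lerDr.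
Qed.

Lemma blipD f g : blip f -> blip g -> blip (fun x => f x + g x).
Proof.
move=> [A [fA lA]] [B [gB lB]]; exists (A + B); split=> [x|x y].
  by rewrite (le_trans (cmodD _ _))// lerD.
rewrite opprD addrACA (le_trans (cmodD _ _))// mulrDl lerD//.
Qed.

Lemma blipM f g : blip f -> blip g -> blip (fun x => f x * g x).
Proof.
move=> [A [fA lA]] [B [gB lB]].
have A0 : 0 <= A by rewrite (le_trans (cmod_ge0 _) (fA 0)).
have B0 : 0 <= B by rewrite (le_trans (cmod_ge0 _) (gB 0)).
exists (A * B + A * B); split=> [x|x y].
  rewrite cmodM (@le_trans _ _ (A * B)) ?ler_pM ?cmod_ge0//.
  by rewrite lerDl mulr_ge0.
rewrite (_ : _ - _ = f x * (g x - g y) + (f x - f y) * g y); last by ring.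
apply: (le_trans (cmodD _ _)); rewrite !cmodM mulrDl lerD//.
  by rewrite -mulrA ler_pM ?cmod_ge0.
by rewrite mulrAC ler_pM ?cmod_ge0.
Qed.

Lemma blipN f : blip f -> blip (fun x => - f x).
Proof.
move=> /(blipM (blip_cst (-1))); by under eq_fun do rewrite mulN1r.
Qed.

Lemma blipB f g : blip f -> blip g -> blip (fun x => f x - g x).
Proof. by move=> bf bg; apply: blipD => //; exact: blipN. Qed.

Lemma blip_conj f : blip f -> blip (fun x => conjc (f x)).
Proof.
move=> [A [fA lA]]; exists A; split=> [x|x y]; first by rewrite cmod_conj.
by rewrite -rmorphB cmod_conj.
Qed.

Lemma blip_sum (I : Type) (r : seq I) (F : I -> T -> R[i]) :
  (forall a, blip (F a)) -> blip (fun x => \sum_(a <- r) F a x).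
Proof.
move=> bF; elim: r => [|a r IH].
  by under eq_fun do rewrite big_nil; exact: blip_cst.
by under eq_fun do rewrite big_cons; exact: blipD.
Qed.

(* A Lipschitz function is the limit of its values at the points of the grids
   [Z^n / m], and the grid point below [x] is a measurable function of [x]. *)
Definition grid (m : nat) (x : T) : Zn n :=
  \row_i Num.floor (m.+1%:R * (x : 'rV[R]_n) ord0 i).

Definition grid_point (m : nat) (k : Zn n) : T :=
  \row_i (((k : 'rV[int]_n) ord0 i)%:~R / m.+1%:R).

(** The values are countably many, and each fibre is a half-open box. *)
Lemma measurable_grid m : measurable_fun [set: T] (grid m).
Proof.
move=> _ A _; rewrite setTI.
rewrite (_ : _ @^-1` A = \bigcup_(k in A) [set x | grid m x = k]); last first.
  apply/seteqP; split => [x /= Ax|x [k Ak /= xk]].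
    by exists (grid m x).
  by rewrite /= xk.
rewrite bigcup_mkcond; apply: countable_bigcupT_measurable => [|k].
  exact: countableP.
case: ifPn => // _.
rewrite (_ : [set x | _] = \bigcap_(i in [set: 'I_n])
  (Tn_coord i @^-1` `[((k : 'rV[int]_n) ord0 i)%:~R / m.+1%:R,
                      (((k : 'rV[int]_n) ord0 i) + 1)%:~R / m.+1%:R [ ));
                        last first.
  apply/seteqP; split => [x /= <- i _|x /= xk]; last first.
    apply/rowP => i; rewrite mxE; apply: floor_def.
    move: (xk i I); rewrite /= in_itv/= /Tn_coord.
    by rewrite ler_pdivrMr// ltr_pdivlMr// mulrC.
  rewrite /= in_itv/= /Tn_coord mxE.
  have /andP[a b] := floor_itv (m.+1%:R * (x : 'rV[R]_n) ord0 i).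
  by rewrite ler_pdivrMr// ltr_pdivlMr// [(_ * m.+1%:R)%R]mulrC a b.
apply: fin_bigcap_measurable => // i _.
rewrite -[X in measurable X]setTI.
exact: measurable_Tn_coord.
Qed.

Lemma l1norm_grid m x : l1norm (grid_point m (grid m x) - x) <= n%:R / m.+1%:R.
Proof.
rewrite /l1norm.
apply: (@le_trans _ _ (\sum_(i < n) m.+1%:R^-1)); last first.
  by rewrite sumr_const card_ord mulr_natl.
apply: ler_sum => i _; rewrite !mxE.
have /andP[a b] := floor_itv (m.+1%:R * (x : 'rV[R]_n) ord0 i).
have m0 : (0 : R) < m.+1%:R by [].
move: a b; set fl := Num.floor _ => a b.
rewrite distrC ger0_norm; last by rewrite subr_ge0 ler_pdivrMr// mulrC.
rewrite -[leRHS]mul1r lerBlDr -mulrDl ler_pdivlMr// mulrC addrC.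
by rewrite ltW// (lt_le_trans b)// intrD.
Qed.

Lemma lipschitz_measurable (g : T -> R) (B : R) :
  (forall x y, `|g x - g y| <= B * l1norm (x - y)) -> measurable_fun [set: T] g.
Proof.
move=> gB; pose h m x := g (grid_point m (grid m x)).
apply: (@measurable_fun_cvg _ _ _ _ h) => [m|x _].
  apply: (measurableT_comp (f := fun k : Zn n => g (grid_point m k))) => //.
  exact: measurable_grid.
apply/cvgrPdist_le => e e0; near=> m.
rewrite distrC (le_trans (gB _ _))//.
apply: (@le_trans _ _ (`|B| * (n%:R / m.+1%:R))).
  apply: (@le_trans _ _ (`|B| * l1norm (grid_point m (grid m x) - x))).
    by rewrite ler_wpM2r ?l1norm_ge0// ler_norm.
  by rewrite ler_wpM2l// l1norm_grid.
rewrite mulrA ler_pdivrMr// [leRHS]mulrC -ler_pdivrMr//.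
have mB : `|B| * n%:R / e < m%:R by near: m; exact: nbhs_infty_gtr.
by apply: ltW; apply: (lt_trans mB); rewrite ltr_nat.
Unshelve. all: by end_near. Qed.

Lemma blip_measurable f : blip f -> cmeasurable f.
Proof.
move=> [B [_ fB]]; split; apply: (lipschitz_measurable (B := B)) => x y.
  by rewrite -cReN -cReD (le_trans (normr_Re_le _)).
by rewrite -cImN -cImD (le_trans (normr_Im_le _)).
Qed.

Lemma bounded_cintegrable (mu : {finite_measure set T -> \bar R}) f B :
  cmeasurable f -> (forall x, cmod (f x) <= B) -> cintegrable mu f.
Proof.
move=> mf fB; apply: (cintegrable_le (g := cst B%:E)) => //.
rewrite integral_cst// lte_mul_pinfty//.
  by rewrite lee_fin (le_trans (cmod_ge0 _) (fB 0)).
by rewrite ltey_eq fin_num_measure.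
Qed.

Lemma blip_cintegrable f : blip f -> cintegrable (haar R n) f.
Proof.
move=> bf; have [B [fB _]] := bf.
by apply: (@bounded_cintegrable (haar R n) f B) => //; exact: blip_measurable.
Qed.

End functions_on_Tn.

(** * Haar measure *)

Section haar_integration.
Variable R : realType.

Lemma integral_uniform01 (f : R -> R) (M : R) :
  measurable_fun [set: R] f -> (forall t, `|f t| <= M) ->
  (\int[uniform_prob (@ltr01 R)]_t (f t)%:E =
   \int[lebesgue_measure]_(t in `[0%R, 1%R]) (f t)%:E)%E.
Proof.
move=> mf fM; have mEf : measurable_fun [set: R] (EFin \o f)
  by exact/measurable_EFinP.
rewrite [LHS]integralE [RHS]integralE.
rewrite !integral_uniform//; first last.
- exact: measurable_funepos.
- exact: measurable_funeneg.
by rewrite subr0 invr1 !mul1e.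
Qed.

Lemma ord_lift0P (n : nat) (i : 'I_n.+1) :
  i = ord0 \/ exists j : 'I_n, i = lift ord0 j.
Proof. by case: (unliftP ord0 i) => [j ->|->]; [right; exists j|left]. Qed.

Lemma Tn_consD (n : nat) (t s : R) (x y : Tn R n) :
  Tn_cons (t + s, x + y) = Tn_cons (t, x) + Tn_cons (s, y) :> 'rV[R]_n.+1.
Proof.
apply/rowP => i; rewrite !mxE; have [->|[j ->]] := ord_lift0P i.
  by rewrite unlift_none.
by rewrite liftK/= mxE.
Qed.

Lemma Tn_cons_delta0 (n : nat) (h : R) :
  Tn_cons (h, 0 : Tn R n) = h *: delta_mx ord0 ord0 :> 'rV[R]_n.+1.
Proof.
apply/rowP => i; rewrite !mxE; have [->|[j ->]] := ord_lift0P i.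
  by rewrite unlift_none/= mulr1.
by rewrite liftK/= mxE mulr0.
Qed.

Lemma Tn_cons_delta (n : nat) (h : R) (j : 'I_n) :
  Tn_cons (0, (h *: delta_mx ord0 j : 'rV[R]_n) : Tn R n) =
  h *: delta_mx ord0 (lift ord0 j) :> 'rV[R]_n.+1.
Proof.
apply/rowP => i; rewrite !mxE; have [->|[k ->]] := ord_lift0P i.
  by rewrite unlift_none/= mulr0.
by rewrite liftK/= !mxE (inj_eq lift_inj).
Qed.

Lemma Tn_cons_line (n : nat) (h t : R) (x : Tn R n) :
  Tn_cons (h + t, x) = h *: delta_mx ord0 ord0 + Tn_cons (t, x) :> 'rV[R]_n.+1.
Proof. by rewrite -Tn_cons_delta0 -Tn_consD add0r. Qed.

Lemma Tn_cons_line_lift (n : nat) (h t : R) (j : 'I_n) (x : Tn R n) :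
  Tn_cons (t, (h *: (delta_mx ord0 j : 'rV[R]_n) + x : 'rV[R]_n) : Tn R n) =
  h *: delta_mx ord0 (lift ord0 j) + Tn_cons (t, x) :> 'rV[R]_n.+1.
Proof. by rewrite -Tn_cons_delta -Tn_consD add0r. Qed.

(** Induction on n, with Fubini splitting off coordinate 0. If i is 0, the fundamental theorem of
    calculus on [0, 1] leaves a difference that periodicity cancels; otherwise the induction
    hypothesis applies to each slice. The Lipschitz condition on G' along direction i makes the
    integrand of that theorem continuous. *)
Lemma haar_partial0 (n : nat) (i : 'I_n) (G G' : Tn R n -> R) (M : R) :
  (forall x : 'rV[R]_n, is_derive x (delta_mx ord0 i : 'rV[R]_n) G (G' x)) ->
  measurable_fun [set: Tn R n] G' -> (forall x, `|G' x| <= M) ->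
  (forall (x : 'rV[R]_n) (h : R), `|G' (h *: delta_mx ord0 i + x)
    - G' x| <= M * `|h|) ->
  (forall x : 'rV[R]_n, G (delta_mx ord0 i + x) = G x) ->
  (\int[haar R n]_x (G' x)%:E = 0)%E.
Proof.
elim: n i G G' => [[]//|n IH i G G' dG mG' G'M G'L Gp].
have mE : measurable_fun [set: Tn R n.+1] (EFin \o G')
  by exact/measurable_EFinP.
have mc : measurable_fun setT (G' \o @Tn_cons R n).
  by apply: measurableT_comp => //; exact: measurable_Tn_cons.
have ic : (uniform_prob (@ltr01 R) \x haar R n)%E.-integrable setT
    (EFin \o (G' \o @Tn_cons R n)).
  apply: measurable_bounded_integrable => //.
    rewrite [X in (X < _)%E](_ : _ = 1%E) ?ltry//.
    exact: (@probability_setT _ _ R (uniform_prob (@ltr01 R) \x haar R n)%E).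
  exists M; split; rewrite ?num_real// => m Mm x _.
  by apply: ltW; apply: le_lt_trans Mm; exact: G'M.
rewrite [haar R n.+1]/= /distribution integral_pushforward// preimage_setT.
case: (ord_lift0P i) => [i0|[j ij]]; rewrite ?i0 ?ij in dG G'L Gp.
  rewrite -(integral21_prod_meas1 ic)/=.
  apply: integral0_eq => y _; rewrite /fubini_G/=.
  pose F (t : R) : R := G (Tn_cons (t, y)).
  have dF (t : R) : is_derive t 1 F (G' (Tn_cons (t, y))).
    apply: is_derive_transport (dG (Tn_cons (t, y))) => h.
    by rewrite /F -Tn_cons_line /GRing.scale/= mulr1.
  have cF : continuous F by move=> t; exact: is_derive_continuous1 (dF t).
  have cG' : continuous (fun t : R => G' (Tn_cons (t, y))).
    move=> t; apply/cvgrPdist_le => e e0; near=> s.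
    have -> : Tn_cons (s, y) = (s - t) *: delta_mx ord0 ord0 + Tn_cons (t, y)
      :> 'rV_n.+1.
      by rewrite -Tn_cons_line subrK.
    rewrite distrC (le_trans (G'L _ _))//.
    apply: (@le_trans _ _ ((`|M| + 1) * `|s - t|)).
      by rewrite ler_wpM2r// (le_trans (ler_norm _))// lerDl.
    rewrite mulrC -ler_pdivlMr ?ltr_wpDl// distrC.
    near: s; move: (@cvg_id R (nbhs t)) => /cvgrPdist_le; apply.
    by rewrite divr_gt0// ltr_wpDl.
  rewrite (@integral_uniform01 (fun t => G' (Tn_cons (t, y))) M)//; last first.
    exact: continuous_measurable_fun.
  rewrite (@continuous_FTC2 R (fun t => G' (Tn_cons (t, y))) F 0 1 ltr01).
  - rewrite /F; apply/eqP; rewrite -EFinB eqe subr_eq0; apply/eqP.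
    by rewrite -[1]addr0 Tn_cons_line scale1r Gp.
  - exact: continuous_subspaceT.
  - split=> [t _||].
    + by have [] := dF t.
    + by apply: cvg_at_right_filter; exact: cF.
    + by apply: cvg_at_left_filter; exact: cF.
  - by move=> t _; rewrite derive1E; have [_ ->] := dF t.
rewrite -(integral12_prod_meas1 ic)/=.
apply: integral0_eq => t _; rewrite /fubini_F/=.
apply: (IH j (fun y => G (Tn_cons (t, y))) (fun y => G' (Tn_cons (t, y)))) =>
  //.
- move=> y; apply: is_derive_transport (dG (Tn_cons (t, y))) => h.
  by rewrite Tn_cons_line_lift.
- exact: (measurableT_comp mc (pair1_measurable t)).
- by move=> y h; rewrite Tn_cons_line_lift.
- move=> y; rewrite -[delta_mx _ _]scale1r Tn_cons_line_lift.
  by rewrite scale1r.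
Unshelve. all: by end_near. Qed.

End haar_integration.

(** * Uniqueness of Fourier coefficients *)

Section fourier_uniqueness.
Variables (R : realType) (n : nat).
Local Notation T := (Tn R n).
Local Notation haar := (haar R n).
Implicit Types (f g : T -> R[i]) (k l : Zn n).

(** A relation, unlike [partial], so that existence and value of the derivative travel together. *)
Definition cderive (i : 'I_n) f f' := forall x : 'rV[R]_n,
  is_derive x (delta_mx ord0 i : 'rV[R]_n) (fun y : 'rV[R]_n =>
    complex.Re (f y)) (complex.Re (f' x)) /\
  is_derive x (delta_mx ord0 i : 'rV[R]_n) (fun y : 'rV[R]_n =>
    complex.Im (f y)) (complex.Im (f' x)).

Lemma cderive_quadratic i f f' (C : R) :
  (forall x (h : R),
     cmod (f (h *: (delta_mx ord0 i : 'rV[R]_n) + x)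
       - f x - real_complex R h * f' x)
     <= C * h ^+ 2) -> cderive i f f'.
Proof.
move=> fC x; split; apply: (is_derive_quadratic (C := C)) => h.
  have -> : complex.Re (f (h *: (delta_mx ord0 i : 'rV[R]_n) + x))
    - complex.Re (f x) -
      h * complex.Re (f' x) =
      complex.Re (f (h *: (delta_mx ord0 i : 'rV[R]_n) + x)
        - f x - real_complex R h * f' x).
    by rewrite !cReD !cReN cReM/= mul0r subr0.
  exact: le_trans (normr_Re_le _) (fC x h).
have -> : complex.Im (f (h *: (delta_mx ord0 i : 'rV[R]_n) + x))
  - complex.Im (f x) -
    h * complex.Im (f' x) =
    complex.Im (f (h *: (delta_mx ord0 i : 'rV[R]_n) + x)
      - f x - real_complex R h * f' x).
  by rewrite !cImD !cImN cImM/= mul0r addr0.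
exact: le_trans (normr_Im_le _) (fC x h).
Qed.

Lemma cderiveM i f f' g g' : cderive i f f' -> cderive i g g' ->
  cderive i (fun x => f x * g x) (fun x => f' x * g x + f x * g' x).
Proof.
move=> df dg x; have [f1 f2] := df x; have [g1 g2] := dg x; split.
  under eq_fun do rewrite cReM.
  have := is_deriveB (is_deriveM f1 g1) (is_deriveM f2 g2).
  move=> /is_derive_eq; apply.
  by rewrite cReD !cReM /GRing.scale/=; ring.
under eq_fun do rewrite cImM.
have := is_deriveD (is_deriveM f1 g2) (is_deriveM f2 g1).
move=> /is_derive_eq; apply.
by rewrite cImD !cImM /GRing.scale/=; ring.
Qed.

Lemma cderive_partial i f f' : cderive i f f' -> partial i f = f'.
Proof.
move=> df; apply/funext => x; rewrite /partial.
by have [[_ ->] [_ ->]] := df x; case: (f' x).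
Qed.

Lemma cderive_has_partial i f f' : cderive i f f' -> has_partial i f.
Proof. by move=> df x; have [[? _] [? _]] := df x. Qed.

Lemma has_partialP i f : has_partial i f -> cderive i f (partial i f).
Proof. by move=> pf x; have [? ?] := pf x; split; split. Qed.

Lemma cderive_echar i k : cderive i (echar k) (fun x =>
  dfactor R i k * echar k x).
Proof. exact: cderive_quadratic (echar_quadratic i k). Qed.

Lemma haar_cderive0 i f f' : cderive i f f' -> blip f' ->
  (forall x : 'rV[R]_n, f (delta_mx ord0 i + x) = f x) ->
  cintegral haar f' = 0.
Proof.
move=> df bf' fp; have [m1 m2] := blip_measurable bf'.
have [B [fB lB]] := bf'.
have lB' (x : 'rV[R]_n) (h : R) : cmod (f' (h *: delta_mx ord0 i + x) - f' x)
  <= B * `|h|.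
  apply: (le_trans (lB _ _)); have -> : h *: delta_mx ord0 i + x - x = h *:
    delta_mx ord0 i :> 'rV[R]_n.
    by rewrite addrK.
  by rewrite l1norm_delta.
have eRe : (\int[haar]_x (complex.Re (f' x))%:E = 0)%E.
  apply: (@haar_partial0 R n i (fun x => complex.Re (f x)) _ B) => //.
  - by move=> x; have [] := df x.
  - by move=> x; rewrite (le_trans (normr_Re_le _)).
  - by move=> x h; rewrite -cReN -cReD (le_trans (normr_Re_le _)).
  - by move=> x; rewrite fp.
have eIm : (\int[haar]_x (complex.Im (f' x))%:E = 0)%E.
  apply: (@haar_partial0 R n i (fun x => complex.Im (f x)) _ B) => //.
  - by move=> x; have [] := df x.
  - by move=> x; rewrite (le_trans (normr_Im_le _)).
  - by move=> x h; rewrite -cImN -cImD (le_trans (normr_Im_le _)).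
  - by move=> x; rewrite fp.
by rewrite /cintegral /Rintegral eRe eIm.
Qed.

Lemma periodic_delta f : Defs.periodic f ->
  forall i (x : 'rV[R]_n), f (delta_mx ord0 i + x) = f x.
Proof.
move=> pf i x; rewrite addrC -[RHS](pf _ (delta_mx ord0 i : 'rV[int]_n)).
congr (f (_ + _)); apply/matrixP => a b; rewrite !mxE.
by case: (_ && _).
Qed.

Lemma cintegral_cst (z : R[i]) : cintegral haar (fun=> z) = z.
Proof.
rewrite /cintegral !Rintegral_cst// [fine _](_ : _ = 1) ?mulr1;
  first by case: z.
by rewrite -[RHS]/(fine 1%E); congr fine; exact: probability_setT.
Qed.

(** If the i-th entry of k is non-zero, then [dfactor R i k] times the character is the i-th
    derivative of a periodic function, so its integral is 0, and the factor can be cancelled. *)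
Lemma cintegral_echar k : cintegral haar (echar k) = (k == 0)%:R.
Proof.
have [->|k0] := eqVneq k 0.
  by rewrite (@eq_cintegral _ _ _ _ _ (fun=> 1)) ?cintegral_cst// => x;
    rewrite echar0.
have [i ki] : exists i, (k : 'rV[int]_n) ord0 i != 0.
  apply: contrapT => /forallNP H; move/eqP: k0; apply.
  apply/rowP => i; rewrite mxE; apply/eqP/negPn/negP; exact: H.
have d0 : dfactor R i k != 0.
  apply/eqP => /(congr1 (@cmod R)); rewrite cmod_dfactor cmod0 => /eqP.
  by rewrite !mulf_eq0 pnatr_eq0 (gt_eqF (pi_gt0 R))/= normr_eq0 intr_eq0
    (negPf ki).
apply: (mulfI d0); rewrite mulr0 -cintegralZ; last first.
  exact/blip_cintegrable/blip_echar.
apply: (haar_cderive0 (cderive_echar i k)); last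
  exact/periodic_delta/echar_periodic.
apply: blipM; [exact: blip_cst|exact: blip_echar].
Qed.

Lemma cintegral_sum (I : Type) (r : seq I) (F : I -> T -> R[i]) :
  (forall a, blip (F a)) ->
  cintegral haar (fun x => \sum_(a <- r) F a x) = \sum_(a <- r)
    cintegral haar (F a).
Proof.
move=> bF; elim: r => [|a r IH].
  rewrite big_nil -[RHS](@cintegral0 _ _ _ haar).
  by apply: eq_cintegral => x; rewrite big_nil.
rewrite big_cons -IH -cintegralD//; last 2 first.
- exact: blip_cintegrable.
- by apply: blip_cintegrable; exact: blip_sum.
by apply: eq_cintegral => x; rewrite big_cons.
Qed.

(** |1 - e^(2 pi i t)|^2 = 2 - 2 cos(2 pi t) increases with the distance from t to the nearest
    integer, because cosine decreases on [0, pi]; c is its value at distance d. *)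
Lemma expi_dist (d : R) : 0 < d -> d < 2^-1 -> exists2 c : R, 0 < c &
  forall t, (exists z : int, `|t - z%:~R| <= d) \/ c <= cmod (1 - expi t) ^+ 2.
Proof.
move=> d0 d2; have p0 : 0 < pi :> R by exact: pi_gt0.
exists (2 - 2 * cos (2 * pi * d)).
  have cd : cos (2 * pi * d) < 1.
    rewrite -[ltRHS]cos0 ltr_cos ?in_itv/= ?lexx ?pi_ge0//;
      first by rewrite !mulr_gt0.
    by apply/andP; split; nra.
  lra.
(* [z] is the integer nearest to t. *)
move=> t; pose z := Num.floor (t + 2^-1); have [zt tz] :=
  andP (floor_itv (t + 2^-1)).
have [ud|du] := leP `|t - z%:~R| d; first by left; exists z.
right; set u := t - z%:~R in du.
have u2 : `|u| <= 2^-1.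
  by move: tz; rewrite intrD mulr1z ler_norml => tz; apply/andP; split;
    rewrite /u /z; lra.
have -> : expi t = expi u.
  by rewrite /u expiD -mulrNz expi_int mulr1.
have -> : cmod (1 - expi u) ^+ 2 = 2 - 2 * cos (2 * pi * u).
  rewrite cmodE sqr_sqrtr ?addr_ge0 ?sqr_ge0// cReD cImD cReN cImN/=.
  have := cos2Dsin2 (2 * pi * u); set a := cos _; set b := sin _ => ab.
  by rewrite sub0r sqrrN (_ : b ^+ 2 = 1 - a ^+ 2);
    [ring|rewrite -ab addrAC subrr add0r].
rewrite lerD2l lerN2 ler_pM2l//.
have -> : cos (2 * pi * u) = cos (2 * pi * `|u|).
  have [u0|u0] := leP 0 u; first by rewrite ger0_norm.
  by rewrite ltr0_norm// mulrN cosN.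
by apply: ltW; rewrite ltr_cos ?in_itv/= ?ltr_pM2l ?mulr_gt0//;
  apply/andP; split; nra.
Qed.

(** Continuity in the form suited to the Fejér kernel: the sum on the right is a trigonometric
    polynomial in y. Close to x modulo Z^n the Lipschitz bound gives e; elsewhere some summand is at
    least the c of [expi_dist], and C c = 2B bounds the oscillation of f. *)
Lemma periodic_blip_dist f x (e : R) : blip f -> Defs.periodic f -> 0 < e ->
  exists2 C : R, 0 <= C & forall y, cmod (f x - f y) <=
    e + C * \sum_(i < n) cmod (1 - expi ((y : 'rV[R]_n) ord0 i - (x : 'rV[R]_n)
      ord0 i)) ^+ 2.
Proof.
move=> [B [fB lB]] pf e0.
have B0 : 0 <= B by rewrite (le_trans (cmod_ge0 _) (fB x)).
(* 1/4 ensures d < 1/2 for [expi_dist]; the other term makes B n d at most e, with + 1 keeping the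
   denominator positive. *)
pose d := Num.min (4^-1) (e / (B * n%:R + 1)).
have Bn : 0 < B * n%:R + 1 by rewrite ltr_wpDl// mulr_ge0.
have d0 : 0 < d by rewrite lt_min invr_gt0 ltr0n/= divr_gt0.
have d2 : d < 2^-1.
  by rewrite gt_min ltf_pV2 ?posrE// ltr_nat.
have [c c0 cP] := expi_dist d0 d2.
exists (2 * B / c) => [|y]; first by rewrite !mulr_ge0// invr_ge0 ltW.
set S := \sum_(i < n) _.
have S0 : 0 <= S by apply: sumr_ge0 => i _; rewrite sqr_ge0.
have [near|] := pselect (forall i, exists z : int,
  `|(y : 'rV[R]_n) ord0 i - (x : 'rV[R]_n) ord0 i - z%:~R| <= d).
  have [z zP] := choice near.
  rewrite -(pf x (\row_i z i)) (le_trans (lB _ _))//.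
  apply: (@le_trans _ _ e); last by rewrite lerDl !mulr_ge0// invr_ge0 ltW.
  apply: (@le_trans _ _ (B * (n%:R * d))).
    rewrite ler_wpM2l// /l1norm -[n in n%:R]card_ord mulr_natl -sumr_const.
    apply: ler_sum => i _; rewrite !mxE distrC opprD addrA; exact: zP.
  rewrite mulrA; apply: (@le_trans _ _ ((B * n%:R + 1) * d)).
    by rewrite ler_wpM2r ?(ltW d0)// lerDl.
  by rewrite mulrC -ler_pdivlMr// ge_min lexx orbT.
move=> /existsNP [i iz].
have [//|ci] := cP ((y : 'rV[R]_n) ord0 i - (x : 'rV[R]_n) ord0 i).
apply: (@le_trans _ _ (2 * B)).
  by rewrite (le_trans (cmodB _ _))// mulr_natl mulr2n lerD.
rewrite -mulrA -[leLHS]mulr1 ler_wpDl//; first exact: ltW.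
rewrite ler_wpM2l ?mulr_ge0// mulrC ler_pdivlMr// mul1r (le_trans ci)//.
by rewrite /S (bigD1 i)//= lerDl sumr_ge0// => j _; rewrite sqr_ge0.
Qed.

End fourier_uniqueness.

(** The majorant is complex-valued so that its integral can be computed with the complex
    orthogonality relations. *)
Lemma cmod_cintegral_le_Re d (T : measurableType d) (R : realType)
    (mu : {measure set T -> \bar R}) (h g : T -> R[i]) :
  cintegrable mu h -> cintegrable mu g ->
  (forall x, cmod (h x) <= complex.Re (g x)) ->
  cmod (cintegral mu h) <= complex.Re (cintegral mu g).
Proof.
move=> hi [gi _] hg; have [mh _] := (cintegrableP _ _).1 hi.
rewrite -lee_fin; apply: (le_trans (cmod_cintegral_le hi)).
rewrite /cintegral/= /Rintegral fineK ?integrable_fin_num//.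
apply: ge0_le_integral => //.
- by move=> x _; rewrite lee_fin cmod_ge0.
- exact: measurable_ecmod.
- by case/integrableP : gi.
- by move=> x _; rewrite lee_fin.
Qed.

(** * The Fejér kernel: mass and second moments *)

Section fejer_kernel.
Variables (R : realType) (n N : nat).
Local Notation T := (Tn R n).
Local Notation haar := (haar R n).
Local Notation A := {ffun 'I_n -> 'I_N.+1}.

Definition ffun_Zn (a : A) : Zn n := \row_i (a i : nat)%:Z.

Lemma ffun_Zn_inj : injective ffun_Zn.
Proof.
move=> a b /rowP ab; apply/ffunP => i; apply/val_inj.
by have := ab i; rewrite !mxE => -[].
Qed.

Definition dirichlet (x y : T) : R[i] := \sum_(a : A) echar (ffun_Zn a) (y - x).

(** Unnormalized Fejér kernel centred at x: non-negative as a squared modulus, of total mass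
    [#|A|]. *)
Definition fejer (x y : T) : R[i] := dirichlet x y * conjc (dirichlet x y).

(** Pulling out the factor in x makes translation invariance of [haar] unnecessary. *)
Lemma echarB (k : Zn n) (x y : T) : echar k (y - x) = echar (- k) x * echar k y.
Proof. by rewrite /echar dotpBl expiD -dotpNr mulrC. Qed.

Lemma blip_echarB (k : Zn n) (x : T) : blip (fun y => echar k (y - x)).
Proof.
under eq_fun do rewrite echarB.
by apply: blipM; [exact: blip_cst|exact: blip_echar].
Qed.

Lemma cintegral_echarB (k : Zn n) (x : T) :
  cintegral haar (fun y => echar k (y - x)) = (k == 0)%:R.
Proof.
under eq_cintegral do rewrite echarB.
rewrite cintegralZ; last exact/blip_cintegrable/blip_echar.
rewrite cintegral_echar; have [->|_] := eqVneq k 0; last by rewrite mulr0.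
by rewrite oppr0 echar0 mul1r.
Qed.

Lemma fejerE x y :
  fejer x y = \sum_(a : A) \sum_(b : A) echar (ffun_Zn a - ffun_Zn b) (y - x).
Proof.
rewrite /fejer /dirichlet rmorph_sum mulr_suml; apply: eq_bigr => a _.
rewrite mulr_sumr; apply: eq_bigr => b _.
by rewrite echarD -echar_conj.
Qed.

Lemma blip_fejer x : blip (fejer x).
Proof.
rewrite (_ : fejer x = fun y => \sum_(a : A) \sum_(b : A)
  echar (ffun_Zn a - ffun_Zn b) (y - x)).
  apply: blip_sum => a; apply: blip_sum => b; exact: blip_echarB.
by apply/funext => y; exact: fejerE.
Qed.

(** Orthogonality leaves exactly the pairs of frequencies with k + a - b = 0. *)
Lemma cintegral_echar_fejer (k : Zn n) x :
  cintegral haar (fun y => echar k (y - x) * fejer x y) =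
  (\sum_(a : A) \sum_(b : A) (k + (ffun_Zn a - ffun_Zn b) == 0)%R)%:R.
Proof.
rewrite natr_sum.
transitivity (cintegral haar (fun y => \sum_(a : A) \sum_(b : A)
    echar (k + (ffun_Zn a - ffun_Zn b)) (y - x))).
  apply: eq_cintegral => y; rewrite fejerE mulr_sumr; apply: eq_bigr => a _.
  by rewrite mulr_sumr; apply: eq_bigr => b _; rewrite [in RHS]echarD.
rewrite cintegral_sum; last by move=> a; apply: blip_sum => b;
  exact: blip_echarB.
apply: eq_bigr => a _; rewrite cintegral_sum; last by move=> b;
  exact: blip_echarB.
by rewrite natr_sum; apply: eq_bigr => b _; rewrite cintegral_echarB.
Qed.

Lemma cintegral_fejer x : cintegral haar (fejer x) = #|A|%:R.
Proof.
have := cintegral_echar_fejer 0 x; under eq_cintegral do rewrite echar0 mul1r.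
move=> ->; congr _%:R; rewrite -sum1_card; apply: eq_bigr => a _.
rewrite (bigD1 a)//= add0r subrr eqxx big1// => b /negPf ba.
by rewrite add0r subr_eq0 (inj_eq ffun_Zn_inj) eq_sym ba.
Qed.

(** Transposing values permutes [A], so all N + 1 values of the i-th coordinate occur equally
    often. *)
Lemma card_ffun_max (i : 'I_n) :
  (N.+1 * \sum_(a : A) (a i == ord_max) = #|A|)%N.
Proof.
have H v : (\sum_(a : A) (a i == v) = \sum_(a : A) (a i == ord_max))%N.
  pose h (a : A) : A := [ffun j => tperm v ord_max (a j)].
  have hi : injective h.
    move=> a b /ffunP ab; apply/ffunP => j; have := ab j.
    by rewrite !ffunE; exact: perm_inj.
  rewrite [RHS](reindex_inj hi); apply: eq_bigr => a _; rewrite ffunE.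
  by rewrite -{2}(tpermL v ord_max) (inj_eq perm_inj).
transitivity (\sum_(v < N.+1) \sum_(a : A) (a i == v))%N.
  by under [RHS]eq_bigr do rewrite H; rewrite sum_nat_const card_ord.
rewrite exchange_big/= -sum1_card; apply: eq_bigr => a _.
by rewrite (bigD1 (a i))//= eqxx big1// => v /negPf; rewrite eq_sym => ->.
Qed.

(** If a(i) is not maximal, then b = a + delta_i is still in the cube and gives a solution; the
    other a are counted by the last sum. *)
Lemma fejer_shift_count (i : 'I_n) :
  (#|A| <= \sum_(a : A) \sum_(b : A)
      ((delta_mx ord0 i : Zn n) + (ffun_Zn a - ffun_Zn b) == 0)%R +
    \sum_(a : A) (a i == ord_max))%N.
Proof.
rewrite -big_split/= -sum1_card; apply: leq_sum => a _.
have [|ai] := eqVneq (a i) ord_max; first by rewrite leq_addl.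
rewrite addn0.
have ai' : ((a i).+1 < N.+1)%N.
  rewrite ltn_neqAle ltn_ord andbT; apply: contra ai => /eqP [ai].
  by apply/eqP/val_inj.
pose b : A := [ffun j => if j == i then Ordinal ai' else a j].
rewrite (bigD1 b)//= (_ : _ == 0) ?leq_addr//.
apply/eqP/rowP => j; rewrite !mxE ffunE eqxx/=.
case: ifPn => [/eqP ->|_]; first (rewrite /= (intS (a i));
  move: (Posz (a i)) => q; by rewrite addrA; exact: (subrr (1 + q))).
by rewrite subrr addr0.
Qed.

Lemma Re_nat (m : nat) : complex.Re (m%:R : R[i]) = m%:R.
Proof. by rewrite -(rmorph_nat (real_complex R)). Qed.

(** Second moment of the kernel in direction i. As |1 - e|^2 = 2 - e - conj(e), the integral is
    twice [#|A|] minus the count of shifted pairs, and that count misses at most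
    [#|A| / (N + 1)]. *)
Lemma Re_cintegral_fejer_dist (i : 'I_n) x :
  complex.Re (cintegral haar (fun y =>
    (1 - echar (delta_mx ord0 i) (y - x)) *
    conjc (1 - echar (delta_mx ord0 i) (y - x)) * fejer x y)) <=
  2 * #|A|%:R / N.+1%:R.
Proof.
set e := fun y : T => echar (delta_mx ord0 i : Zn n) (y - x).
have be : blip (fun y => e y * fejer x y).
  by apply: blipM; [exact: blip_echarB|exact: blip_fejer].
have conjf y : conjc (fejer x y) = fejer x y.
  by rewrite /fejer conjcM conjcK mulrC.
have -> : cintegral haar (fun y => (1 - e y) * conjc (1 - e y) * fejer x y) =
    cintegral haar (fun y => (fejer x y + fejer x y) -
      (e y * fejer x y + conjc (e y * fejer x y))).
  apply: eq_cintegral => y; rewrite conjcM conjf conjcB conjc1.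
  have : e y * conjc (e y) = 1 by rewrite mul_conjc cmod_echar expr1n.
  set u := conjc (e y) => eu.
  rewrite !mulrBl !mulrBr !mul1r !mulr1 eu; ring.
have bF := blip_fejer x.
rewrite cintegralB; [|exact/blip_cintegrable/blipD|]; last first.
  by apply: blip_cintegrable; apply: blipD => //; exact: blip_conj.
rewrite !cintegralD ?cintegral_conj; try exact: blip_cintegrable; last first.
  by apply: blip_cintegrable; exact: blip_conj.
rewrite cintegral_echar_fejer cintegral_fejer.
set c := (\sum_(a : A) _)%N.
rewrite !cReD cReN cReD cRe_conj !Re_nat.
have := fejer_shift_count i; rewrite -/c.
have := card_ffun_max i; set m := (\sum_(a : A) (a i == ord_max))%N => mA.
rewrite -(ler_nat R) natrD => cA.
have -> : 2 * #|A|%:R / N.+1%:R = 2 * m%:R :> R.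
  by rewrite -mA natrM mulrCA mulrAC divff ?mul1r ?pnatr_eq0.
lra.
Qed.

End fejer_kernel.

Section uniqueness.
Variables (R : realType) (n : nat).

(** Integrating (f(x) - f(y)) against the Fejér kernel gives [#|A|] f(x), because f is orthogonal to
    every character. The second moments bound the same integral by [#|A|] (e/2 + O(1/N)). *)
Lemma fourier_uniqueness (f : Tn R n -> R[i]) : blip f -> Defs.periodic f ->
  (forall k, cintegral (haar R n) (fun x => f x * echar k x) = 0) ->
  forall x, f x = 0.
Proof.
move=> bf pf f0 x; apply: cmod_eq0; apply/eqP; rewrite eq_le cmod_ge0 andbT.
apply/ler_addgt0Pl => e e0; rewrite addr0.
have e2 : 0 < e / 2 by rewrite divr_gt0.
have [C C0 fC] := periodic_blip_dist x bf pf e2.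
have bound (N : nat) : cmod (f x) <= e / 2 + C * (n%:R * (2 / N.+1%:R)).
  pose A := {ffun 'I_n -> 'I_N.+1}.
  have A0 : (0 : R) < #|{: A}|%:R by rewrite ltr0n card_ffun card_ord expn_gt0.
  have bF := @blip_fejer R n N x.
  rewrite -(ler_pM2r A0).
  pose H y := (f x - f y) * fejer N x y.
  pose W i y := (1 - echar (delta_mx ord0 i) (y - x)) *
    conjc (1 - echar (delta_mx ord0 i) (y - x)) * fejer N x y.
  (* Majorant of |H| given by [periodic_blip_dist]; its integral is controlled by the mass and the
     second moments of the kernel. *)
  pose G y := real_complex R (e / 2) * fejer N x y + real_complex R C * \sum_(i
    < n) W i y.
  have bW i : blip (W i).
    apply: blipM => //; apply: blipM; last apply: blip_conj;
    by apply: blipB; [exact: blip_cst|exact: blip_echarB].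
  have bH : blip H by apply: blipM => //; apply: blipB => //; exact: blip_cst.
  have bSW : blip (fun y => \sum_(i < n) W i y) by exact: blip_sum.
  have bG : blip G.
    by apply: blipD; apply: blipM => //; exact: blip_cst.
  have -> : cmod (f x) * #|{: A}|%:R = cmod (cintegral (haar R n) H).
    have bfF : blip (fun y => f y * fejer N x y) by exact: blipM.
    rewrite /H; under eq_cintegral do rewrite mulrBl.
    rewrite cintegralB; last 2 first.
    - by apply: blip_cintegrable; apply: blipM => //; exact: blip_cst.
    - exact: blip_cintegrable.
    rewrite cintegralZ ?cintegral_fejer; last exact: blip_cintegrable.
    (* The kernel is a finite sum of characters in y, so f integrates to 0 against it. *)
    rewrite [X in _ - X](_ : _ = 0) ?subr0.
      by rewrite cmodM -(rmorph_nat (real_complex R)) cmod_real ger0_norm.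
    transitivity (cintegral (haar R n) (fun y => \sum_(a : A) \sum_(b : A)
        (f y * echar (ffun_Zn a - ffun_Zn b) (y - x)))).
      apply: eq_cintegral => y; rewrite fejerE mulr_sumr; apply: eq_bigr => a _.
      by rewrite mulr_sumr.
    rewrite cintegral_sum; last first.
      by move=> a; apply: blip_sum => b; apply: blipM => //; exact: blip_echarB.
    rewrite big1// => a _; rewrite cintegral_sum; last first.
      by move=> b; apply: blipM => //; exact: blip_echarB.
    rewrite big1// => b _; under eq_cintegral do rewrite echarB mulrCA.
    rewrite cintegralZ ?f0 ?mulr0//; apply: blip_cintegrable.
    by apply: blipM => //; exact: blip_echar.
  apply: (@le_trans _ _ (complex.Re (cintegral (haar R n) G))).
    apply: cmod_cintegral_le_Re; try exact: blip_cintegrable.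
    move=> y; rewrite /H /G /W cmodM.
    have FE : fejer N x y = real_complex R (cmod (fejer N x y)).
      rewrite {1}/fejer mul_conjc /fejer mul_conjc cmod_real ger0_norm
        ?sqr_ge0//.
    rewrite -mulr_suml [real_complex R C * _]mulrA -mulrDl [in leRHS]FE cReM/=
      mulr0 subr0.
    rewrite ler_wpM2r ?cmod_ge0//.
    apply: (le_trans (fC y)); rewrite le_eqVlt; apply/orP; left; apply/eqP.
    rewrite cReD cReM/= mul0r subr0; congr (_ + _ * _).
    rewrite (eq_bigr (fun i => real_complex R
       (cmod (1 - expi ((y : 'rV[R]_n) ord0 i - (x : 'rV[R]_n) ord0 i)) ^+ 2))).
      by rewrite -(rmorph_sum (real_complex R)).
    move=> i _; rewrite mul_conjc /echar; congr (real_complex R (cmod (1 - expi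
      _) ^+ 2)).
    rewrite /dotp (bigD1 i)//= !mxE !eqxx mulr1 big1 ?addr0// => j /negPf ji.
    by rewrite !mxE ji andbF mulr0.
  rewrite /G cintegralD; try (apply: blip_cintegrable; apply: blipM => //;
    exact: blip_cst).
  rewrite !cintegralZ; try exact: blip_cintegrable.
  rewrite cintegral_fejer cintegral_sum// cReD !cReM/= !mul0r !subr0 Re_nat.
  rewrite mulrDl lerD2l -mulrA ler_wpM2l//.
  apply: (@le_trans _ _ (\sum_(i < n) (2 * #|{: A}|%:R / N.+1%:R))).
    rewrite (big_morph (@complex.Re R) (@cReD R) (erefl _)).
    by apply: ler_sum => i _; exact: Re_cintegral_fejer_dist.
  rewrite sumr_const card_ord -mulr_natl; set a := #|_|%:R; set b := _^-1.
  by rewrite le_eqVlt; apply/orP; left; apply/eqP; ring.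
have K0 : 0 <= C * (n%:R * 2) / (e / 2) by rewrite divr_ge0 ?mulr_ge0// ltW.
pose N := Num.bound (C * (n%:R * 2) / (e / 2)).
apply: (le_trans (bound N)); rewrite [leRHS]splitr lerD2l.
have : C * (n%:R * 2) / (e / 2) <= N.+1%:R.
  by apply: ltW; apply: (lt_trans (archi_boundP K0)); rewrite ltr_nat.
rewrite ler_pdivrMr// => CN.
rewrite (_ : C * _ = C * (n%:R * 2) / N.+1%:R); last by rewrite !mulrA.
by rewrite ler_pdivrMr// [leRHS]mulrC.
Qed.

End uniqueness.

(** * Fourier series *)

Section fourier_series.
Variables (R : realType) (n : nat).
Local Notation T := (Tn R n).
Local Notation haar := (haar R n).
Local Notation muZ := (@countZ R n).
Implicit Types (c : Zn n -> R[i]) (f : T -> R[i]) (k l : Zn n).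

Definition fseries c : T -> R[i] := fun x => cintegral muZ (fun k =>
  c k * echar k x).

Definition wsummable (N : nat) c (B : R) : Prop :=
  (\int[muZ]_k ((1 + absZ R k) ^+ N * cmod (c k))%:E <= B%:E)%E.

Lemma wsummable_ge0 N c B : wsummable N c B -> 0 <= B.
Proof.
move=> cB; rewrite -lee_fin; apply: le_trans cB; apply: integral_ge0 => k _.
by rewrite lee_fin mulr_ge0 ?cmod_ge0// exprn_ge0// ltW// weight_gt0.
Qed.

Lemma wsummable_le N M c B : (M <= N)%N -> wsummable N c B -> wsummable M c B.
Proof.
move=> MN; apply: le_trans; apply: ge0_le_integral => //.
  by move=> k _; rewrite lee_fin mulr_ge0 ?cmod_ge0// exprn_ge0// ltW//
    weight_gt0.
move=> k _; rewrite lee_fin ler_wpM2r ?cmod_ge0//.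
by apply: ler_weXn2l => //; exact: weight_ge1.
Qed.

Lemma wsummable0E c B : wsummable 0 c B = (\int[muZ]_k (cmod (c k))%:E <=
  B%:E)%E.
Proof. by rewrite /wsummable; under eq_integral do rewrite expr0 mul1r. Qed.

Lemma wsummable0 N c B : wsummable N c B -> (\int[muZ]_k (cmod (c k))%:E <=
  B%:E)%E.
Proof. by move=> /(wsummable_le (leq0n N)); rewrite wsummable0E. Qed.

Section summable.
Variables (c : Zn n -> R[i]) (B : R).
Hypothesis cB : (\int[muZ]_k (cmod (c k))%:E <= B%:E)%E.

Lemma fseries_cintegrable x : cintegrable muZ (fun k => c k * echar k x).
Proof.
apply/cintegrable_countZP; under eq_integral do rewrite cmodM cmod_echar mulr1.
by rewrite (le_lt_trans cB)// ltry.
Qed.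

Lemma fseries_bounded x : cmod (fseries c x) <= B.
Proof.
apply: cmod_cintegral_le_bound; first exact: fseries_cintegrable.
by under eq_integral do rewrite cmodM cmod_echar mulr1.
Qed.

Lemma cmeasurable_echar k : cmeasurable (@echar R n k).
Proof. exact/blip_measurable/blip_echar. Qed.

Lemma fseries_pair_cintegrable f (M : R) : cmeasurable f ->
  (forall x, cmod (f x) <= M) ->
  cintegrable (haar \x muZ)%E (fun z => c z.2 * echar z.2 z.1 * f z.1).
Proof.
move=> mf fM; have M0 : 0 <= M by rewrite (le_trans (cmod_ge0 _) (fM 0)).
have mF : cmeasurable (fun z : T * Zn n => c z.2 * echar z.2 z.1 * f z.1).
  apply: cmeasurable_prodZn => k /=; apply: cmeasurableM => //.
  by apply: cmeasurableM; [exact: cmeasurable_cst|exact: cmeasurable_echar].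
apply/cintegrableP; split => //.
rewrite (fubini_tonelli1 (m1 := haar) (m2 := muZ)) ?/fubini_F/=; last 2 first.
- exact: measurable_ecmod.
- by move=> z; rewrite lee_fin cmod_ge0.
apply: (@le_lt_trans _ _ (\int[haar]_x (M * B)%:E)%E).
  apply: ge0_le_integral => //.
  - by move=> x _; apply: integral_ge0 => k _; rewrite lee_fin cmod_ge0.
  - apply: (measurable_fun_fubini_tonelli_F (m2 := muZ)
      (fun z : T * Zn n => (cmod (c z.2 * echar z.2 z.1 * f z.1))%:E)).
      exact: measurable_ecmod.
    by move=> z; rewrite lee_fin cmod_ge0.
  - move=> x _; apply: (@le_trans _ _ (\int[muZ]_k (M%:E * (cmod (c k))%:E))%E).
      apply: ge0_le_integral => //; first by move=> k _;
        rewrite lee_fin cmod_ge0.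
      move=> k _; rewrite -EFinM lee_fin !cmodM cmod_echar mulr1 mulrC.
      by rewrite ler_wpM2r ?cmod_ge0.
    rewrite ge0_integralZl_EFin//; last by move=> k _; rewrite lee_fin cmod_ge0.
    by rewrite EFinM; apply: lee_wpmul2l; rewrite ?lee_fin.
rewrite integral_cst// lte_mul_pinfty ?lee_fin ?mulr_ge0//.
  by rewrite -lee_fin; apply: le_trans cB; apply: integral_ge0 => k _;
    rewrite lee_fin cmod_ge0.
by rewrite ltey_eq fin_num_measure.
Qed.

(** Under mere summability the series need not be Lipschitz. Measurability comes from Fubini
    instead, with the constant 1 as bounded factor. *)
Lemma cmeasurable_fseries : cmeasurable (fseries c).
Proof.
have /fseries_pair_cintegrable : cmeasurable (fun _ : T => 1 : R[i]).
  exact: cmeasurable_cst.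
move=> /(_ 1) -[_|h1 h2]; first by rewrite cmod1.
have cc x : cintegrable muZ (fun k => c k * echar k x * 1).
  by under eq_fun do rewrite mulr1; exact: fseries_cintegrable.
have : cintegrable haar (fun x => cintegral muZ (fun k => c k * echar k x * 1)).
  by apply: (cintegrable_fubini1 (m1 := haar) (m2 := muZ)
    (f := fun z : T * Zn n => c z.2 * echar z.2 z.1 * 1)).
move=> /cintegrableP[+ _]; congr cmeasurable; apply/funext => x.
by apply: eq_cintegral => k; rewrite mulr1.
Qed.

Lemma cintegral_fseriesM f (M : R) : cmeasurable f ->
  (forall x, cmod (f x) <= M) ->
  cintegral haar (fun x => fseries c x * f x) =
  cintegral muZ (fun k => c k * cintegral haar (fun x => echar k x * f x)).
Proof.
move=> mf fM; have fi k : cintegrable haar (fun x => echar k x * f x).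
  apply: (@bounded_cintegrable _ _ haar _ M).
    by apply: cmeasurableM => //; exact: cmeasurable_echar.
  by move=> x; rewrite cmodM cmod_echar mul1r.
transitivity (cintegral haar (fun x => cintegral muZ (fun k =>
  c k * echar k x * f x))).
  apply: eq_cintegral => x; rewrite mulrC -cintegralZ;
    last exact: fseries_cintegrable.
  by apply: eq_cintegral => k; rewrite mulrC.
rewrite (cFubini (m1 := haar) (m2 := muZ)
    (f := fun z : T * Zn n => c z.2 * echar z.2 z.1 * f z.1))/=.
- by apply: eq_cintegral => k; rewrite -cintegralZ//; apply: eq_cintegral => x;
  rewrite mulrA.
- exact: fseries_pair_cintegrable.
- move=> x; under eq_fun do rewrite mulrC; apply: cintegrableZ.
  exact: fseries_cintegrable.
- by move=> k; under eq_fun do rewrite -mulrA; exact: cintegrableZ.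
Qed.

(** The product is not conjugated, so the l-th character picks the coefficient at -l. *)
Lemma fseries_coef l : cintegral haar (fun x => fseries c x * echar l x)
  = c (- l).
Proof.
rewrite (@cintegral_fseriesM _ 1); last 2 first.
- exact: cmeasurable_echar.
- by move=> x; rewrite cmod_echar.
have E k : cintegral haar (fun x => echar k x * echar l x) = (k + l == 0)%:R.
  by under eq_cintegral do rewrite -echarD; exact: cintegral_echar.
under eq_cintegral do rewrite E.
have [|_ ->] := @cintegral_countZ_point R n (fun k => c k * (k + l == 0)%:R)
  (- l).
  by move=> k; rewrite -addr_eq0 => /negPf ->; rewrite mulr0.
by rewrite addNr eqxx mulr1.
Qed.

Lemma fseries_periodic : Defs.periodic (fseries c).
Proof. by move=> x z; apply: eq_cintegral => k; rewrite echar_periodic. Qed.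

End summable.

Lemma fseriesD c c' B B' x : wsummable 0 c B -> wsummable 0 c' B' ->
  fseries (fun k => c k + c' k) x = fseries c x + fseries c' x.
Proof.
rewrite !wsummable0E => cB cB'.
rewrite /fseries -(cintegralD (fseries_cintegrable cB x)
  (fseries_cintegrable cB' x)).
by apply: eq_cintegral => k; rewrite mulrDl.
Qed.

Lemma fseriesZ c B (a : R[i]) x : wsummable 0 c B ->
  fseries (fun k => a * c k) x = a * fseries c x.
Proof.
rewrite !wsummable0E => cB; rewrite /fseries -(cintegralZ _
  (fseries_cintegrable cB x)).
by apply: eq_cintegral => k; rewrite mulrA.
Qed.

Lemma fseries_blip c B : wsummable 1 c B -> blip (fseries c).
Proof.
move=> cB; have B0 := wsummable_ge0 cB; have cB0 := wsummable0 cB.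
have p0 := pi_ge0 R.
exists (B + 4 * pi * B); split=> [x|x y].
  by rewrite (le_trans (fseries_bounded cB0 _))// lerDl !mulr_ge0.
apply: (@le_trans _ _ (4 * pi * B * l1norm (x - y))); last first.
  by rewrite ler_wpM2r ?l1norm_ge0// lerDr.
have ix := fseries_cintegrable cB0 x; have iy := fseries_cintegrable cB0 y.
rewrite /fseries -cintegralB//; apply: cmod_cintegral_le_bound.
  exact: cintegrableB.
apply: (@le_trans _ _ (\int[muZ]_k ((4 * pi * l1norm (x - y))%:E *
    ((1 + absZ R k) ^+ 1 * cmod (c k))%:E))%E).
  apply: ge0_le_integral => //; first by move=> k _; rewrite lee_fin cmod_ge0.
  move=> k _; rewrite -EFinM lee_fin -mulrBr cmodM mulrC mulrA ler_wpM2r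
    ?cmod_ge0//.
  apply: (le_trans (echar_lipschitz _ _ _)); rewrite expr1 mulrAC.
  by rewrite ler_wpM2l ?lerDr// !mulr_ge0// l1norm_ge0.
rewrite ge0_integralZl_EFin//; last 2 first.
- by move=> k _; rewrite lee_fin mulr_ge0 ?cmod_ge0// exprn_ge0// ltW//
  weight_gt0.
- by rewrite !mulr_ge0// l1norm_ge0.
by rewrite (mulrAC _ B) [leRHS]EFinM; apply: lee_wpmul2l => //;
  rewrite lee_fin !mulr_ge0// l1norm_ge0.
Qed.

Lemma wsummable_dfactor i N c B : wsummable N.+1 c B ->
  wsummable N (fun k => dfactor R i k * c k) (2 * pi * B).
Proof.
move=> cB; have p0 := pi_ge0 R; rewrite /wsummable.
apply: (@le_trans _ _ (\int[muZ]_k ((2 * pi)%:E *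
    ((1 + absZ R k) ^+ N.+1 * cmod (c k))%:E))%E).
  have w0 k : 0 <= 1 + absZ R k by rewrite ltW// weight_gt0.
  apply: ge0_le_integral => //.
    by move=> k _; rewrite lee_fin mulr_ge0 ?cmod_ge0// exprn_ge0.
  move=> k _; rewrite -EFinM lee_fin cmodM exprS.
  rewrite [leRHS](_ : _ = (1 + absZ R k) ^+ N * (2 * pi * (1 + absZ R k)
    * cmod (c k))); last by ring.
  rewrite ler_wpM2l ?exprn_ge0// ler_wpM2r ?cmod_ge0//.
  by rewrite (le_trans (cmod_dfactor_le _ _ _))// ler_wpM2l ?mulr_ge0// lerDr.
rewrite ge0_integralZl_EFin ?mulr_ge0//; last first.
  by move=> k _; rewrite lee_fin mulr_ge0 ?cmod_ge0// exprn_ge0// ltW//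
    weight_gt0.
by rewrite [leRHS]EFinM; apply: lee_wpmul2l => //; rewrite lee_fin mulr_ge0.
Qed.

(** The remainder of each character is at most 8 pi^2 |k|^2 h^2, so a weight of order 2 makes the
    remainders summable. *)
Lemma fseries_cderive i c B : wsummable 2 c B ->
  cderive i (fseries c) (fseries (fun k => dfactor R i k * c k)).
Proof.
move=> cB; have cB0 := wsummable0 cB; have dB := wsummable_dfactor i cB.
have dB0 := wsummable0 dB.
apply: (cderive_quadratic (C := 8 * pi ^+ 2 * B)) => x h.
have q0 : 0 <= 8 * pi ^+ 2 * h ^+ 2.
  by apply: mulr_ge0; rewrite ?sqr_ge0//; apply: mulr_ge0; rewrite ?sqr_ge0.
set y : T := h *: _ + _.
have ix := fseries_cintegrable cB0 x; have iy := fseries_cintegrable cB0 y.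
have id := fseries_cintegrable dB0 x.
rewrite /fseries -cintegralB// -cintegralZ// -cintegralB//; last 2 first.
- exact: cintegrableB.
- exact: cintegrableZ.
apply: cmod_cintegral_le_bound.
  by apply: cintegrableB; [exact: cintegrableB|exact: cintegrableZ].
apply: (@le_trans _ _ (\int[muZ]_k ((8 * pi ^+ 2 * h ^+ 2)%:E *
    ((1 + absZ R k) ^+ 2 * cmod (c k))%:E))%E).
  apply: ge0_le_integral => //; first by move=> k _; rewrite lee_fin cmod_ge0.
  move=> k _; rewrite -EFinM lee_fin.
  rewrite (_ : _ - _ = c k * (echar k y - echar k x -
    real_complex R h * (dfactor R i k * echar k x))); last by ring.
  rewrite cmodM [leLHS]mulrC [leRHS]mulrA ler_wpM2r ?cmod_ge0//.
  apply: (le_trans (echar_quadratic _ _ _ _)); rewrite [leLHS]mulrAC.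
  rewrite ler_wpM2l//.
  rewrite ler_pXn2r ?nnegrE ?absZ_ge0//; last by rewrite ltW// weight_gt0.
  by rewrite lerDr.
rewrite ge0_integralZl_EFin//; last first.
  by move=> k _; rewrite lee_fin mulr_ge0 ?cmod_ge0 ?sqr_ge0.
by rewrite (mulrAC _ B) [leRHS]EFinM; apply: lee_wpmul2l.
Qed.

End fourier_series.

(** * Schwartz functions *)

Section rapid_decay.
Variables (R : realType) (n : nat).
Local Notation T := (Tn R n).
Local Notation ZT := (Zn n * Tn R n)%type.
Local Notation haar := (haar R n).
Local Notation muZ := (@countZ R n).
Implicit Types (j k : Zn n) (l : seq (ordinal n)).

Definition wconst : R := fine (\int[muZ]_k ((1 + absZ R k) ^- (n + 2))%:E).

Lemma wconstE : (\int[muZ]_k ((1 + absZ R k) ^- (n + 2))%:E = wconst%:E)%E.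
Proof.
rewrite fineK// ge0_fin_numE; first exact: weight_integral_lty.
apply: integral_ge0 => k _.
by rewrite lee_fin invr_ge0 exprn_ge0// ltW// weight_gt0.
Qed.

Lemma wconst_ge0 : 0 <= wconst.
Proof.
rewrite -lee_fin -wconstE; apply: integral_ge0 => k _.
by rewrite lee_fin invr_ge0 exprn_ge0// ltW// weight_gt0.
Qed.

Lemma weightX_gt0 N k : 0 < (1 + absZ R k) ^+ N.
Proof. by rewrite exprn_gt0// weight_gt0. Qed.

Lemma weightX_ge1 N k : 1 <= (1 + absZ R k) ^+ N.
Proof. by rewrite exprn_ege1// weight_ge1. Qed.

Lemma weightX_le M N k : (M <= N)%N -> (1 + absZ R k) ^+ M <= (1 + absZ R k)
  ^+ N.
Proof. by move=> MN; apply: ler_weXn2l => //; exact: weight_ge1. Qed.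

Lemma integral_decay (a : Zn n -> R) (B : R) : (forall k, 0 <= a k) ->
  (forall k, (1 + absZ R k) ^+ (n + 2) * a k <= B) ->
  (\int[muZ]_k (a k)%:E <= (B * wconst)%:E)%E.
Proof.
move=> a0 aB; have B0 : 0 <= B by rewrite (le_trans _ (aB 0))// mulr_ge0//
  ltW// weightX_gt0.
rewrite EFinM -wconstE -ge0_integralZl_EFin//; last first.
  by move=> k _; rewrite lee_fin invr_ge0 ltW// weightX_gt0.
apply: ge0_le_integral => //; first by move=> k _; rewrite lee_fin.
by move=> k _; rewrite -EFinM lee_fin ler_pdivlMr ?weightX_gt0// mulrC.
Qed.

Lemma wsummable_decay N (c : Zn n -> R[i]) B :
  (forall k, (1 + absZ R k) ^+ (N + (n + 2)) * cmod (c k) <= B) ->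
  wsummable N c (B * wconst).
Proof.
move=> cB; apply: integral_decay => k.
  by rewrite mulr_ge0 ?cmod_ge0// ltW// weightX_gt0.
by rewrite mulrA -exprD addnC.
Qed.

(** Counterpart of [schwartzZT] on the coefficient side: decay in the position j and in the
    frequency k. *)
Definition rapid (c : Zn n -> Zn n -> R[i]) : Prop := forall N, exists B : R,
  forall j k, (1 + absZ R j) ^+ N * (1 + absZ R k) ^+ N * cmod (c j k) <= B.

Definition synth (c : Zn n -> Zn n -> R[i]) : ZT -> R[i] :=
  fun y => fseries (c y.1) y.2.

Lemma rapid_le c c' (M : R) :
  (forall j k, cmod (c' j k) <= M * cmod (c j k)) -> rapid c -> rapid c'.
Proof.
move=> cc rc N; have [B cB] := rc N; exists (`|M| * B) => j k.
have w0 : 0 <= (1 + absZ R j) ^+ N * (1 + absZ R k) ^+ N.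
  by rewrite mulr_ge0// ltW// weightX_gt0.
apply: (@le_trans _ _ (`|M| * ((1 + absZ R j) ^+ N * (1 + absZ R k)
  ^+ N * cmod (c j k)))).
  rewrite [leRHS]mulrCA ler_wpM2l// (le_trans (cc j k))//.
  by rewrite ler_wpM2r ?cmod_ge0// ler_norm.
by rewrite ler_wpM2l.
Qed.

Lemma rapid_wsummable c j : rapid c -> forall N, exists B, wsummable N (c j) B.
Proof.
move=> rc N; have [B cB] := rc (N + (n + 2))%N; exists (B * wconst).
apply: wsummable_decay => k; apply: le_trans (cB j k).
by rewrite ler_wpM2r ?cmod_ge0// ler_peMl ?weightX_ge1// ltW// weightX_gt0.
Qed.

Definition dprod (l : seq 'I_n) (k : Zn n) : R[i] := \prod_(i <- l)
  dfactor R i k.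

Lemma cmod_dprod_le l k : cmod (dprod l k) <= (2 * pi * (1 + absZ R k))
  ^+ size l.
Proof.
have p0 := pi_ge0 R.
rewrite /dprod; elim: l => [|i l IH]; first by rewrite big_nil cmod1 expr0.
rewrite big_cons cmodM exprS ler_pM ?cmod_ge0//.
by rewrite (le_trans (cmod_dfactor_le _ _ _))// ler_wpM2l ?mulr_ge0// lerDr.
Qed.

Lemma dweight_ge1 k : 1 <= 2 * pi * (1 + absZ R k).
Proof.
have := weight_ge1 R k; set a := 1 + _ => a1.
have p2 : 2 <= pi :> R by exact: pi_ge2.
nra.
Qed.

Lemma partials_fseries (c : Zn n -> R[i]) (l : seq 'I_n) :
  (forall N, exists B, wsummable N c B) ->
  partials l (fseries c) = fseries (fun k => dprod l k * c k) /\
  forall N, exists B, wsummable N (fun k => dprod l k * c k) B.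
Proof.
move=> cs; elim: l => [|i l [IH ls]].
  have E : (fun k => dprod [::] k * c k) = c.
    by apply/funext => k; rewrite /dprod big_nil mul1r.
  by rewrite E.
have E : (fun k => dprod (i :: l) k * c k) = (fun k =>
  dfactor R i k * (dprod l k * c k)).
  by apply/funext => k; rewrite /dprod big_cons mulrA.
rewrite E; split=> [|N].
  rewrite /= -/(partials l _) IH; apply: cderive_partial.
  by have [B lB] := ls 2%N; exact: fseries_cderive lB.
by have [B lB] := ls N.+1; exists (2 * pi * B); exact: wsummable_dfactor.
Qed.

(** At most N derivatives cost (2 pi (1 + |k|))^N, and n + 2 further powers in k pay for the
    summation, which yields [wconst]. *)
Lemma pZT_synth N c B : rapid c ->
  (forall j k, (1 + absZ R j) ^+ N * (1 + absZ R k) ^+ (N + (n + 2))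
    * cmod (c j k) <= B) ->
  pZT N (synth c) ((2 * pi) ^+ N * B * wconst).
Proof.
move=> rc cB l lN j eta.
have p0 := pi_ge0 R.
have [-> _] := partials_fseries l (rapid_wsummable j rc).
have wj := weightX_gt0 N j.
rewrite -ler_pdivlMl//; apply: fseries_bounded.
rewrite mulrA; apply: integral_decay => k; first exact: cmod_ge0.
rewrite ler_pdivlMl// cmodM.
apply: (@le_trans _ _ ((2 * pi) ^+ N * ((1 + absZ R j) ^+ N *
   (1 + absZ R k) ^+ (N + (n + 2)) * cmod (c j k)))); last first.
  by rewrite ler_wpM2l// exprn_ge0// mulr_ge0.
rewrite [(N + _)%N]addnC [(1 + absZ R k) ^+ (n + 2 + N)]exprD.
rewrite [leRHS](_ : _ = (1 + absZ R j) ^+ N * ((1 + absZ R k) ^+ (n + 2) *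
   ((2 * pi * (1 + absZ R k)) ^+ N * cmod (c j k)))); last first.
  rewrite !exprMn. ring.
do 2 (rewrite ler_wpM2l//; first exact/ltW/weightX_gt0).
rewrite ler_wpM2r ?cmod_ge0// (le_trans (cmod_dprod_le _ _))//.
by apply: ler_weXn2l => //; exact: dweight_ge1.
Qed.

Lemma rapid_schwartz c : rapid c -> schwartzZT (synth c).
Proof.
move=> rc; split.
- by move=> j; exact: (@fseries_periodic R n (c j)).
- move=> j l i.
  have [-> ls] := partials_fseries l (rapid_wsummable j rc).
  have [B lB] := ls 2%N.
  exact: (cderive_has_partial (fseries_cderive i lB)).
- move=> N; have [B cB] := rc (N + (n + 2))%N.
  exists ((2 * pi) ^+ N * B * wconst); apply: pZT_synth => // j k.
  apply: le_trans (cB j k); rewrite ler_wpM2r ?cmod_ge0//.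
  rewrite ler_wpM2r ?(ltW (weightX_gt0 _ _))//.
  by apply: weightX_le; rewrite leq_addr.
Qed.

Lemma synthD c c' y : rapid c -> rapid c' ->
  synth (fun j k => c j k + c' j k) y = synth c y + synth c' y.
Proof.
move=> rc rc'; have [B cB] := rapid_wsummable y.1 rc 0%N.
by have [B' cB'] := rapid_wsummable y.1 rc' 0%N; exact: fseriesD cB cB'.
Qed.

Lemma synthZ c (a : R[i]) y : rapid c ->
  synth (fun j k => a * c j k) y = a * synth c y.
Proof.
by move=> rc; have [B cB] := rapid_wsummable y.1 rc 0%N; exact: fseriesZ cB.
Qed.

End rapid_decay.

(** * Regularity and integration by parts from partial derivatives *)

Section partial_derivatives.
Variables (R : realType) (n : nat).
Local Notation T := (Tn R n).
Local Notation ZT := (Zn n * Tn R n)%type.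
Local Notation haar := (haar R n).
Implicit Types (f g : T -> R[i]).

Lemma cderive_lipschitz i f f' (B : R) (x : 'rV[R]_n) (h : R) :
  cderive i f f' -> (forall y, cmod (f' y) <= B) ->
  cmod (f (h *: (delta_mx ord0 i : 'rV[R]_n) + x) - f x) <= (B + B) * `|h|.
Proof.
move=> df f'B.
have H (g g' : T -> R) : (forall y : 'rV[R]_n,
  is_derive y (delta_mx ord0 i : 'rV[R]_n) g (g' y)) ->
    (forall y, `|g' y| <= B) ->
    `|g (h *: (delta_mx ord0 i : 'rV[R]_n) + x) - g x| <= B * `|h|.
  move=> dg gB.
  pose F (t : R) := g (t *: (delta_mx ord0 i : 'rV[R]_n) + x).
  have dF (t : R) : is_derive t 1 F (g' (t *: (delta_mx ord0 i : 'rV[R]_n)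
    + x)).
    apply: is_derive_transport (dg (t *: (delta_mx ord0 i : 'rV[R]_n) + x)) =>
      s.
    by rewrite /F /GRing.scale/= mulr1 addrA -scalerDl.
  have := @lipschitz_is_derive1 R F _ B dF 0 h (fun u _ => gB _).
  by rewrite subr0 /F scale0r add0r.
apply: (le_trans (cmod_le_ReIm _)); rewrite cReD cImD cReN cImN mulrDl;
  apply: lerD.
  apply: (H (fun y => complex.Re (f y)) (fun y => complex.Re (f' y))) => y.
    by have [] := df y.
  by rewrite (le_trans (normr_Re_le _)).
apply: (H (fun y => complex.Im (f y)) (fun y => complex.Im (f' y))) => y.
  by have [] := df y.
by rewrite (le_trans (normr_Im_le _)).
Qed.

(** Move from y to x one coordinate at a time along the points [z m], so that only partial
    derivatives, and no total differentiability, enter. *)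
Lemma cderive_blip f (f' : 'I_n -> T -> R[i]) (B : R) :
  (forall i, cderive i f (f' i)) -> (forall i y, cmod (f' i y) <= B) ->
  (forall y, cmod (f y) <= B) -> blip f.
Proof.
move=> df f'B fB; have B0 : 0 <= B by rewrite (le_trans (cmod_ge0 _) (fB 0)).
exists (B + B); split=> [x|x y]; first by rewrite (le_trans (fB x))// lerDl.
pose z (m : nat) : 'rV[R]_n :=
  \row_(i < n) if (i < m)%N then (x : 'rV[R]_n) ord0 i else (y : 'rV[R]_n)
    ord0 i.
have zn : z n = x by apply/rowP => i; rewrite mxE ltn_ord.
have z0 : z 0%N = y by apply/rowP => i; rewrite mxE.
have H m : (m <= n)%N -> cmod (f (z m) - f y) <=
    (B + B) * \sum_(i < n | (i < m)%N) `|(x - y : 'rV[R]_n) ord0 i|.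
  elim: m => [_|m IH mn]; first by rewrite z0 subrr cmod0 big1// mulr0.
  have zS : z m.+1 = ((x - y : 'rV[R]_n) ord0 (Ordinal mn))
    *: delta_mx ord0 (Ordinal mn) + z m.
    apply/rowP => i; rewrite !mxE/=; have [->|im] := eqVneq i (Ordinal mn).
      by rewrite /= ltnSn ltnn mulr1 subrK.
    rewrite mulr0 add0r ltnS leq_eqVlt.
    by rewrite (_ : (i == m :> nat) = false)//; apply/negP => /eqP e;
      move/eqP: im; apply; apply: val_inj; exact: e.
  rewrite (_ : _ - _ = (f (z m.+1) - f (z m)) + (f (z m) - f y));
    last by rewrite subrKA.
  apply: (le_trans (cmodD _ _)).
  rewrite (bigD1 (Ordinal mn))/=; last exact: ltnSn.
  rewrite mulrDr; apply: lerD; first by rewrite zS; exact: cderive_lipschitz.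
  rewrite (eq_bigl (fun i : 'I_n => (i < m)%N)); first by apply: IH;
    exact: ltnW.
  move=> i /=; rewrite ltnS [in RHS]ltn_neqAle andbC; congr (_ && _).
by have := H n (leqnn n); rewrite zn; under eq_bigl do rewrite ltn_ord.
Qed.

Lemma periodic_partial i f : Defs.periodic f -> Defs.periodic (partial i f).
Proof.
move=> pf x z; have shiftD (g : 'rV[R]_n -> R) (v y : 'rV[R]_n) :
    (forall u, g (u + y) = g u) -> 'D_v g ((x : 'rV[R]_n) + y)
      = 'D_v g (x : 'rV[R]_n).
  move=> gy; rewrite /derive gy.
  suff -> : g \o shift ((x : 'rV[R]_n) + y) = g \o shift (x : 'rV[R]_n) by [].
  by apply/funext => u; rewrite /= addrA gy.
by rewrite /partial !shiftD// => u; rewrite pf.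
Qed.

(** Integration by parts: the derivative of the periodic product of f and the character of -k has
    integral 0. *)
Lemma cintegral_cderive i f f' k : cderive i f f' -> blip f -> blip f' ->
  Defs.periodic f ->
  cintegral haar (fun x => f' x * echar (- k) x) =
  dfactor R i k * cintegral haar (fun x => f x * echar (- k) x).
Proof.
move=> df bf bf' pf.
have b1 : blip (fun x => f' x * echar (- k) x) by apply: blipM => //;
  exact: blip_echar.
have b2 : blip (fun x => f x * echar (- k) x) by apply: blipM => //;
  exact: blip_echar.
have dN : dfactor R i (- k) = - dfactor R i k.
  by rewrite /dfactor mxE mulrNz mulrN; apply: complexP;
    rewrite ?cReN ?cImN/= ?oppr0.
have E x : f' x * echar (- k) x + f x * (dfactor R i (- k) * echar (- k) x) =
    f' x * echar (- k) x - dfactor R i k * (f x * echar (- k) x).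
  by rewrite dN; ring.
have := haar_cderive0 (cderiveM df (@cderive_echar R n i (- k))).
under eq_fun do rewrite E.
have b3 : blip (fun x => dfactor R i k * (f x * echar (- k) x)).
  by apply: blipM => //; exact: blip_cst.
rewrite cintegralB; try exact: blip_cintegrable.
rewrite cintegralZ; last exact: blip_cintegrable.
move=> /(_ (blipB b1 b3)) H; apply/eqP; rewrite -subr_eq0; apply/eqP; apply: H.
by apply: periodic_delta => x z; rewrite pf echar_periodic.
Qed.

End partial_derivatives.

(** * Fourier expansion of Schwartz functions *)

Section schwartz_expansion.
Variables (R : realType) (n : nat).
Local Notation T := (Tn R n).
Local Notation ZT := (Zn n * Tn R n)%type.
Local Notation haar := (haar R n).

(** A largest entry dominates the sum. Hence derivatives in a single direction, chosen depending on
    k, give decay in |k|; for small k none are needed. *)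
Lemma weight_coord_le (k : Zn n) : 1 + absZ R k <= 1 + n%:R \/
  exists i, 1 + absZ R k <= (1 + n%:R) * `|((k : 'rV[int]_n) ord0 i)%:~R|.
Proof.
have [small|/existsNP [i0 /negP]] :=
    pselect (forall i, (`|(k : 'rV[int]_n) ord0 i| <= 1)%N).
  left; rewrite absZE lerD2l ler_nat /normZ.
  apply: (@leq_trans (\sum_(i < n) 1)%N); first by apply: leq_sum.
  by rewrite sum1_card card_ord.
rewrite -ltnNge => ki0; right.
have [i _ imax] := arg_maxnP (fun i => `|(k : 'rV[int]_n) ord0 i|%N)
  (isT : xpredT i0).
exists i; set m := `|(k : 'rV[int]_n) ord0 i|%N in imax.
have m1 : (1 <= m)%N by rewrite (leq_trans _ (imax i0 isT))// ltnW.
have -> : `|((k : 'rV[int]_n) ord0 i)%:~R| = m%:R :> R.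
  by rewrite -intr_norm natr_absz.
rewrite absZE mulrDl mul1r; apply: lerD; first by rewrite ler1n.
rewrite -natrM ler_nat /normZ.
apply: (@leq_trans (\sum_(i < n) m)%N); first by apply: leq_sum => j _;
  exact: imax.
by rewrite sum_nat_const card_ord.
Qed.

(** N derivatives in the direction of a largest entry of k give the decay of the coefficients. F(j,
    .) minus its series is then Lipschitz with vanishing coefficients, so [fourier_uniqueness]
    applies. *)
Lemma schwartz_expansion (F : ZT -> R[i]) : schwartzZT F ->
  exists c, rapid c /\ F = synth c.
Proof.
move=> [Fper Fpart Fsemi].
pose D (l : seq 'I_n) j : T -> R[i] := partials l (fun x => F (j, x)).
have Dd l j i : cderive i (D l j) (D (i :: l) j).
  by apply: has_partialP; exact: Fpart.
have Dper l j : Defs.periodic (D l j).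
  by elim: l => [|i l IH]; [exact: Fper|exact: periodic_partial].
have Dbound N : exists B, forall l j x, (size l <= N)%N ->
    (1 + absZ R j) ^+ N * cmod (D l j x) <= B.
  by have [B FB] := Fsemi N; exists B => l j x lN; exact: FB.
(* One seminorm of order [size l + 1] bounds the derivative together with its first partials. *)
have Dblip l j : blip (D l j).
  have [B DB] := Dbound (size l).+1.
  have le_DB l' x : (size l' <= (size l).+1)%N -> cmod (D l' j x) <= B.
    move=> ll; apply: le_trans (DB l' j x ll).
    by rewrite ler_peMl ?cmod_ge0// weightX_ge1.
  apply: (@cderive_blip R n (D l j) (fun i => D (i :: l) j) B).
  - by move=> i; exact: Dd.
  - by move=> i x; exact: le_DB.
  - by move=> x; apply: le_DB.
pose c j k := cintegral haar (fun x => D [::] j x * echar (- k) x).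
have cD M i j k : cintegral haar (fun x => D (nseq M i) j x * echar (- k) x) =
    dfactor R i k ^+ M * c j k.
  elim: M => [|M IH]; first by rewrite expr0 mul1r.
  rewrite exprS -mulrA -IH; exact: (cintegral_cderive k (Dd (nseq M i) j i)).
have Dint (l : seq 'I_n) j k B : (forall x, cmod (D l j x) <= B) ->
    cmod (cintegral haar (fun x => D l j x * echar (- k) x)) <= B.
  move=> DB; apply: cmod_cintegral_le_bound.
    by apply: blip_cintegrable; apply: blipM => //; exact: blip_echar.
  apply: (@le_trans _ _ (\int[haar]_x (cst B%:E x))%E).
    apply: ge0_le_integral => //.
    - by move=> x _; rewrite lee_fin cmod_ge0.
    - by apply: measurable_ecmod; apply: blip_measurable; apply: blipM => //;
      exact: blip_echar.
    - by move=> x _; rewrite lee_fin cmodM cmod_echar mulr1.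
  rewrite integral_cst// [X in (_ * X)%E](_ : _ = 1%E) ?mule1//.
  exact: probability_setT.
have rc : rapid c.
  move=> N; have [B DB] := Dbound N; exists ((1 + n%:R) ^+ N * B) => j k.
  have n0 : 0 <= 1 + n%:R :> R by rewrite addr_ge0.
  have wj := weightX_gt0 R N j.
  have DB' l x : (size l <= N)%N -> cmod (D l j x) <= ((1 + absZ R j)
    ^+ N)^-1 * B.
    by move=> lN; rewrite ler_pdivlMl//; exact: DB.
  have w0 : 0 <= 1 + absZ R k by rewrite ltW// weight_gt0.
  rewrite -mulrA -ler_pdivlMl// mulrCA.
  have [k1|[i ki]] := weight_coord_le k.
    apply: ler_pM; rewrite ?cmod_ge0 ?exprn_ge0//.
      by rewrite lerXn2r ?nnegrE.
    by apply: Dint => x; exact: DB'.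
  apply: (@le_trans _ _ ((1 + n%:R) ^+ N * (cmod (dfactor R i k)
    ^+ N * cmod (c j k)))).
    rewrite mulrA ler_wpM2r ?cmod_ge0// -exprMn.
    rewrite lerXn2r ?nnegrE ?mulr_ge0 ?cmod_ge0//.
    apply: (le_trans ki); rewrite ler_wpM2l// cmod_dfactor ler_peMl//.
    by have := pi_ge2 R; lra.
  rewrite ler_wpM2l ?exprn_ge0// -cmodX -cmodM -cD.
  by apply: Dint => x; apply: DB'; rewrite size_nseq.
exists c; split => //; apply/funext => -[j x]; rewrite /synth/=.
have [B1 cB1] := rapid_wsummable j rc 1%N; have cB0 := wsummable0 cB1.
have bs := fseries_blip cB1.
apply/eqP; rewrite -subr_eq0; apply/eqP.
apply: (@fourier_uniqueness R n (fun x => F (j, x) - fseries (c j) x)).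
- exact: (blipB (Dblip [::] j) bs).
- by move=> y z; rewrite (Fper j) (@fseries_periodic R n (c j)).
- move=> k; under eq_cintegral do rewrite mulrBl.
  rewrite cintegralB; last 2 first.
  + by apply: blip_cintegrable; apply: (blipM (Dblip [::] j));
    exact: blip_echar.
  + by apply: blip_cintegrable; apply: (blipM bs); exact: blip_echar.
  rewrite (fseries_coef cB0) /c; apply/eqP; rewrite subr_eq0; apply/eqP.
  by apply: eq_cintegral => y; rewrite opprK.
Qed.

End schwartz_expansion.

(** * Tempered distributions *)

Section double_sums.
Variables (R : realType) (n : nat).
Local Notation muZ := (@countZ R n).
Implicit Types (a b c : Zn n -> Zn n -> R[i]).

Definition sum2 a : R[i] := cintegral muZ (fun j => cintegral muZ (fun k =>
  a j k)).

Definition summable2 a (B : R) : Prop :=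
  (\int[muZ]_j \int[muZ]_k (cmod (a j k))%:E <= B%:E)%E.

Lemma summable2_row a B j : summable2 a B ->
  (\int[muZ]_k (cmod (a j k))%:E <= B%:E)%E.
Proof.
apply: le_trans; apply: (@le_integral_countZ R n (fun j =>
  \int[muZ]_k (cmod (a j k))%:E)%E).
by move=> i; apply: integral_ge0 => k _; rewrite lee_fin cmod_ge0.
Qed.

Lemma summable2_cintegrable_row a B j : summable2 a B ->
  cintegrable muZ (fun k => a j k).
Proof.
move=> aB; apply/cintegrable_countZP.
by rewrite (le_lt_trans (summable2_row j aB))// ltry.
Qed.

Lemma summable2_cintegrable a B : summable2 a B ->
  cintegrable muZ (fun j => cintegral muZ (fun k => a j k)).
Proof.
move=> aB; apply/cintegrable_countZP; apply: le_lt_trans (ltry B).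
apply: (le_trans _ aB); apply: ge0_le_integral => //.
  by move=> j _; rewrite lee_fin cmod_ge0.
by move=> j _; apply: cmod_cintegral_le; exact: summable2_cintegrable_row aB.
Qed.

Lemma cmod_sum2_le a B : summable2 a B -> cmod (sum2 a) <= B.
Proof.
move=> aB; apply: cmod_cintegral_le_bound; first exact: summable2_cintegrable
  aB.
apply: (le_trans _ aB); apply: ge0_le_integral => //.
  by move=> j _; rewrite lee_fin cmod_ge0.
by move=> j _; apply: cmod_cintegral_le; exact: summable2_cintegrable_row aB.
Qed.

Lemma sum2D a b A B : summable2 a A -> summable2 b B ->
  sum2 (fun j k => a j k + b j k) = sum2 a + sum2 b.
Proof.
move=> aA bB; rewrite /sum2 -(cintegralD (summable2_cintegrable aA)
  (summable2_cintegrable bB)).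
apply: eq_cintegral => j; apply: cintegralD;
by [exact: summable2_cintegrable_row aA|exact: summable2_cintegrable_row bB].
Qed.

Lemma summable2_decay a B :
  (forall j k, (1 + absZ R j) ^+ (n + 2) * (1 + absZ R k) ^+ (n + 2)
    * cmod (a j k) <= B) ->
  summable2 a (B * wconst R n * wconst R n).
Proof.
move=> aB.
have row j : (\int[muZ]_k (cmod (a j k))%:E <=
    (((1 + absZ R j) ^+ (n + 2))^-1 * B * wconst R n)%:E)%E.
  apply: integral_decay => k; first exact: cmod_ge0.
  by rewrite ler_pdivlMl ?weightX_gt0// mulrA.
apply: (@le_trans _ _ (\int[muZ]_j (((1 + absZ R j)
  ^+ (n + 2))^-1 * B * wconst R n)%:E)%E).
  apply: ge0_le_integral => // j _; apply: integral_ge0 => k _.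
  by rewrite lee_fin cmod_ge0.
apply: integral_decay => [j|j].
  by rewrite -lee_fin; apply: le_trans (row j); apply: integral_ge0 => k _;
    rewrite lee_fin cmod_ge0.
by rewrite !mulrA divff ?mul1r// gt_eqF// weightX_gt0.
Qed.

Lemma eq_summable2 a b B : (forall j k, cmod (a j k) = cmod (b j k)) ->
  summable2 a B -> summable2 b B.
Proof.
move=> ab; rewrite /summable2.
suff -> : (fun j => \int[muZ]_k (cmod (a j k))%:E)%E =
          (fun j => \int[muZ]_k (cmod (b j k))%:E)%E by [].
by apply/funext => j; apply: eq_integral => k _; rewrite ab.
Qed.

Lemma sum2_point a j0 k0 : (forall j k, (j, k) != (j0, k0) -> a j k = 0) ->
  sum2 a = a j0 k0.
Proof.
move=> a0; rewrite /sum2.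
have [_ ->] : cintegrable muZ (fun j => cintegral muZ (fun k => a j k)) /\
    cintegral muZ (fun j => cintegral muZ (fun k => a j k))
      = cintegral muZ (fun k => a j0 k).
  apply: cintegral_countZ_point => j jj.
  rewrite -[RHS](@cintegral0 _ _ _ muZ); apply: eq_cintegral => k.
  by apply: a0; rewrite xpair_eqE negb_and jj.
apply: (@cintegral_countZ_point R n (fun k => a j0 k) k0 _).2 => k kk.
by apply: a0; rewrite xpair_eqE negb_and kk orbT.
Qed.

End double_sums.

(** * Expansion of a tempered distribution in its coefficients *)

Section tempered_expansion.
Variables (R : realType) (n : nat).
Local Notation ZT := (Zn n * Tn R n)%type.
Implicit Types (c : Zn n -> Zn n -> R[i]).
Variable U : (ZT -> R[i]) -> R[i].
Hypothesis UT : temperedZT U.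

Definition point2 (j0 k0 : Zn n) : Zn n -> Zn n -> R[i] :=
  fun j k => ((j, k) == (j0, k0))%:R.

(* the value of U on delta_j (x) e_k, hence the (j, -k)-th Fourier coefficient *)
Definition dcoef (j k : Zn n) : R[i] := U (synth (point2 j k)).

Lemma cmod_bool (b : bool) : cmod (b%:R : R[i]) = b%:R.
Proof. by case: b; rewrite ?cmod0 ?cmod1. Qed.

Lemma point2_decay N M j0 k0 j k :
  (1 + absZ R j) ^+ N * (1 + absZ R k) ^+ M * cmod (point2 j0 k0 j k) <=
  (1 + absZ R j0) ^+ N * (1 + absZ R k0) ^+ M.
Proof.
rewrite /point2 cmod_bool; have [[-> ->]|_] := eqVneq (j, k) (j0, k0).
  by rewrite mulr1.
by rewrite mulr0 mulr_ge0// ltW// weightX_gt0.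
Qed.

Lemma rapid_point2 j0 k0 : rapid (point2 j0 k0).
Proof.
by move=> N; exists ((1 + absZ R j0) ^+ N * (1 + absZ R k0) ^+ N) => j k;
  exact: point2_decay.
Qed.

(** Continuity bounds U on an atom by a Schwartz seminorm, which is polynomial in j and k; rapid
    coefficients beat this growth. *)
Lemma dcoef_growth : exists (N : nat) (K : R), 0 <= K /\ forall j k,
  cmod (dcoef j k) <= K * ((1 + absZ R j) ^+ N * (1 + absZ R k) ^+ N).
Proof.
have [_ [N [K UK]]] := UT; have p0 := pi_ge0 R; have W0 := wconst_ge0 R n.
have q0 : 0 <= (2 * pi) ^+ N * wconst R n by rewrite mulr_ge0// exprn_ge0//
  mulr_ge0.
exists (N + (n + 2))%N, (`|K| * ((2 * pi) ^+ N * wconst R n)); split=> [|j k].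
  by rewrite mulr_ge0.
have := UK (synth (point2 j k)) _ (rapid_schwartz (rapid_point2 j k))
  (pZT_synth (rapid_point2 j k) (point2_decay N (N + (n + 2)) j k)).
move=> /le_trans; apply.
set A := (1 + absZ R j) ^+ N; set B := _ ^+ (N + (n + 2)).
have A0 : 0 <= A by rewrite ltW// weightX_gt0.
have B0 : 0 <= B by rewrite ltW// weightX_gt0.
apply: (@le_trans _ _ (`|K| * ((2 * pi) ^+ N * wconst R n) * (A * B))).
  rewrite [leRHS](_ : _ = `|K| * ((2 * pi) ^+ N * (A * B) * wconst R n));
    last by ring.
  rewrite ler_wpM2r ?ler_norm//.
  by apply: mulr_ge0 => //; apply: mulr_ge0; [rewrite exprn_ge0//
    mulr_ge0|exact: mulr_ge0].
have Kq0 : 0 <= `|K| * ((2 * pi) ^+ N * wconst R n) by rewrite mulr_ge0.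
rewrite ler_wpM2l//.
rewrite ler_wpM2r//; apply: weightX_le; exact: leq_addr.
Qed.

Lemma rapid_dcoef_decay c : rapid c -> exists B, forall j k,
  (1 + absZ R j) ^+ (n + 2) * (1 + absZ R k) ^+ (n + 2)
    * cmod (c j k * dcoef j k) <= B.
Proof.
move=> rc; have [N [K [K0 bK]]] := dcoef_growth.
have [B cB] := rc (n + 2 + N)%N; exists (K * B) => j k.
apply: (@le_trans _ _ (K * ((1 + absZ R j) ^+ (n + 2 + N) *
    (1 + absZ R k) ^+ (n + 2 + N) * cmod (c j k)))); last by rewrite ler_wpM2l.
rewrite cmodM !(exprD _ (n + 2) N).
set a := _ ^+ (n + 2); set b := _ ^+ (n + 2).
apply: (@le_trans _ _ (a * b * (cmod (c j k) *
   (K * ((1 + absZ R j) ^+ N * (1 + absZ R k) ^+ N))))).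
  rewrite ler_wpM2l//; first by rewrite mulr_ge0// ltW// weightX_gt0.
  by rewrite ler_wpM2l ?cmod_ge0.
by rewrite le_eqVlt; apply/orP; left; apply/eqP; ring.
Qed.

Lemma rapid_dcoef_summable2 c : rapid c ->
  exists B, summable2 (fun j k => c j k * dcoef j k) B.
Proof.
move=> /rapid_dcoef_decay [B cB]; exists (B * wconst R n * wconst R n).
exact: summable2_decay.
Qed.

Lemma tempered_add c c' : rapid c -> rapid c' ->
  U (synth (fun j k => c j k + c' j k)) = U (synth c) + U (synth c').
Proof.
move=> rc rc'; have [Ulin _] := UT.
rewrite -[U (synth c)]mul1r -(Ulin 1 _ _ (rapid_schwartz rc)
  (rapid_schwartz rc')).
by congr U; apply/funext => y; rewrite synthD// mul1r.
Qed.

Lemma rapid0 : rapid (fun _ _ : Zn n => 0 : R[i]).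
Proof. by move=> N; exists 0 => j k; rewrite cmod0 mulr0. Qed.

Lemma synth0 (y : ZT) : synth (fun _ _ : Zn n => 0 : R[i]) y = 0.
Proof.
rewrite /synth /fseries -[RHS](@cintegral0 _ _ _ (@countZ R n)).
by apply: eq_cintegral => k; rewrite mul0r.
Qed.

Lemma tempered0 : U (synth (fun _ _ : Zn n => 0)) = 0.
Proof.
have := tempered_add rapid0 rapid0.
under [X in U (synth X)]funext do under eq_fun do rewrite addr0.
by move=> /eqP; rewrite -subr_eq0 opprD addrA subrr sub0r oppr_eq0 => /eqP.
Qed.

Lemma tempered_scale (a : R[i]) c : rapid c ->
  U (synth (fun j k => a * c j k)) = a * U (synth c).
Proof.
move=> rc; have [Ulin _] := UT.
rewrite -[RHS]addr0 -tempered0 -(Ulin a _ _ (rapid_schwartz rc)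
  (rapid_schwartz rapid0)).
by congr U; apply/funext => y; rewrite synthZ// synth0 addr0.
Qed.

Lemma tempered_finite (s : seq (Zn n * Zn n)) c : rapid c ->
  (forall j k, (j, k) \notin s -> c j k = 0) ->
  U (synth c) = sum2 (fun j k => c j k * dcoef j k).
Proof.
elim: s c => [|[j0 k0] s IH] c rc cs.
  have -> : c = fun _ _ => 0 by apply/funext => j; apply/funext => k;
    rewrite cs.
  rewrite tempered0 (@sum2_point R n _ 0 0) ?mul0r// => j k _; exact: mul0r.
pose c1 j k := c j0 k0 * point2 j0 k0 j k.
pose c2 j k := if (j, k) == (j0, k0) then 0 else c j k.
have cE : c = fun j k => c1 j k + c2 j k.
  apply/funext => j; apply/funext => k; rewrite /c1 /c2 /point2.
  by have [[-> ->]|_] := eqVneq (j, k) (j0, k0);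
    rewrite ?mulr1 ?addr0 ?mulr0 ?add0r.
have r1 : rapid c1.
  by apply: (@rapid_le R n (point2 j0 k0) c1 (cmod (c j0 k0)))
    (rapid_point2 j0 k0) => j k; rewrite cmodM.
have r2 : rapid c2.
  apply: (@rapid_le R n c c2 1) rc => j k; rewrite mul1r /c2.
  by case: ifP => // _; rewrite cmod0 cmod_ge0.
have IH2 : U (synth c2) = sum2 (fun j k => c2 j k * dcoef j k).
  apply: IH => // j k jks; rewrite /c2; case: ifPn => // jk.
  by apply: cs; rewrite inE negb_or jk.
have [B1 s1] := rapid_dcoef_summable2 r1; have [B2 s2] :=
  rapid_dcoef_summable2 r2.
rewrite cE tempered_add// IH2 /c1 tempered_scale; last exact: rapid_point2.
have -> : c j0 k0 * U (synth (point2 j0 k0)) = sum2 (fun j k =>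
  c1 j k * dcoef j k).
  rewrite (@sum2_point R n _ j0 k0); first by rewrite /c1 /point2 eqxx mulr1.
  by move=> j k /negPf jk; rewrite /c1 /point2 jk mulr0 mul0r.
rewrite -(sum2D s1 s2); congr sum2; apply/funext => j; apply/funext => k.
by rewrite -mulrDl.
Qed.

(** The cube [-M, M]^n as a list. Truncation uses only that points outside it have [normZ] above
    M. *)
Definition ballZ (M : nat) : seq (Zn n) :=
  [seq (\row_i ((t ord0 i : nat)%:Z - M%:Z) : Zn n)
    | t : 'rV['I_(M.*2.+1)]_n <- enum 'rV['I_(M.*2.+1)]_n].

Lemma mem_ballZ M k : k \notin ballZ M -> (M < normZ k)%N.
Proof.
move=> kM; rewrite ltnNge; apply: contra kM => kM.
have kb j : (`|(k : 'rV[int]_n) ord0 j| <= M)%N.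
  by rewrite (leq_trans _ kM)// /normZ (bigD1 j)//= leq_addr.
have lt j : (`|((k : 'rV[int]_n) ord0 j + M%:Z)%R| < M.*2.+1)%N.
  by have := kb j; lia.
apply/mapP; exists (\row_j (Ordinal (lt j))); first by rewrite mem_enum.
apply/rowP => i; rewrite !mxE/=.
by move: (kb i); set a := (fun_of_matrix _ _ _) => ?; rewrite gez0_abs; lia.
Qed.

(** Cut c off to a cube. The truncation [c1] is covered by finite linearity; the tail satisfies (M +
    1) |c2| <= (1 + |j|) (1 + |k|) |c|, so its seminorm and its double sum are both O(1/M). *)
Lemma tempered_expansion c : rapid c ->
  U (synth c) = sum2 (fun j k => c j k * dcoef j k).
Proof.
move=> rc; apply/eqP; rewrite -subr_eq0; apply/eqP; apply: cmod_eq0.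
have [_ [N [K UK]]] := UT.
set L := cmod _; have L0 : 0 <= L by exact: cmod_ge0.
(* One power more than [pZT_synth] needs; it pays for the factor M + 1 gained on the tail. *)
have [B1 cB1] := rc (N + (n + 2)).+1.
have rcw : rapid (fun j k => real_complex R ((1 + absZ R j) * (1 + absZ R k))
  * c j k).
  move=> N'; have [B cB] := rc N'.+1; exists B => j k; apply: le_trans (cB j k).
  rewrite cmodM cmod_real ger0_norm ?mulr_ge0//; last 2 first.
  - by rewrite ltW// weight_gt0.
  - by rewrite ltW// weight_gt0.
  by rewrite !exprSr le_eqVlt; apply/orP; left; apply/eqP; ring.
have [B2 cB2] := rapid_dcoef_decay rcw.
pose C := `|K| * ((2 * pi) ^+ N * `|B1| * wconst R n)
  + `|B2| * wconst R n * wconst R n.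
have W0 := wconst_ge0 R n; have p0 := pi_ge0 R.
have C0 : 0 <= C by rewrite addr_ge0// !mulr_ge0// exprn_ge0// mulr_ge0.
have LC M : L <= C / M.+1%:R.
  pose c1 j k := if (j \in ballZ M) && (k \in ballZ M) then c j k else 0.
  pose c2 j k := if (j \in ballZ M) && (k \in ballZ M) then 0 else c j k.
  have cE : c = fun j k => c1 j k + c2 j k.
    apply/funext => j; apply/funext => k; rewrite /c1 /c2.
    by case: ifP; rewrite ?addr0 ?add0r.
  have r1 : rapid c1.
    apply: (@rapid_le R n c c1 1) rc => j k; rewrite mul1r /c1.
    by case: ifP => // _; rewrite cmod0 cmod_ge0.
  have r2 : rapid c2.
    apply: (@rapid_le R n c c2 1) rc => j k; rewrite mul1r /c2.
    by case: ifP => // _; rewrite cmod0 cmod_ge0.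
  have c2le j k : M.+1%:R * cmod (c2 j k) <= (1 + absZ R j) * (1 + absZ R k)
    * cmod (c j k).
    have wj := weight_ge1 R j; have wk := weight_ge1 R k.
    rewrite /c2; case: ifPn => [_|].
      by rewrite cmod0 mulr0 !mulr_ge0 ?cmod_ge0// ltW// weight_gt0.
    rewrite negb_and => /orP jk; rewrite ler_wpM2r ?cmod_ge0//.
    have aux (k' : Zn n) : k' \notin ballZ M -> M.+1%:R <= 1 + absZ R k'.
      by move=> /mem_ballZ kM; rewrite absZE -natr1 addrC lerD2l ler_nat ltnW.
    case: jk => /aux h.
      by rewrite (le_trans h)// ler_peMr// ltW// weight_gt0.
    by rewrite (le_trans h)// ler_peMl// ltW// weight_gt0.
  have e1 : U (synth c1) = sum2 (fun j k => c1 j k * dcoef j k).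
    apply: (@tempered_finite [seq (j, k) | j <- ballZ M, k <- ballZ M]) =>
      // j k.
    rewrite /c1; case: ifP => // /andP[jM kM] /negP[].
    by apply/allpairsP; exists (j, k).
  have [A1 s1] := rapid_dcoef_summable2 r1; have [A2 s2'] :=
    rapid_dcoef_summable2 r2.
  have m0 : (0 : R) < M.+1%:R by [].
  have s2 : summable2 (fun j k => c2 j k * dcoef j k)
    (`|B2| / M.+1%:R * wconst R n * wconst R n).
    apply: summable2_decay => j k; rewrite ler_pdivlMr//.
    apply: le_trans (le_trans (cB2 j k) (ler_norm _)).
    set a := _ ^+ (n + 2); set b := _ ^+ (n + 2).
    rewrite [leLHS](_ : _ = a * b * cmod (dcoef j k)
      * (M.+1%:R * cmod (c2 j k))); last first.
      by rewrite cmodM; ring.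
    rewrite [leRHS](_ : _ = a * b * cmod (dcoef j k) *
        ((1 + absZ R j) * (1 + absZ R k) * cmod (c j k))); last first.
      rewrite !cmodM cmod_real ger0_norm; first by ring.
      by rewrite mulr_ge0// ltW// weight_gt0.
    rewrite ler_wpM2l//.
    by rewrite !mulr_ge0 ?cmod_ge0// ltW// weightX_gt0.
  have p2 : pZT N (synth c2) ((2 * pi) ^+ N * (`|B1| / M.+1%:R) * wconst R n).
    apply: pZT_synth => // j k; rewrite ler_pdivlMr//.
    apply: le_trans (le_trans (cB1 j k) (ler_norm _)).
    rewrite !exprSr.
    apply: (@le_trans _ _ ((1 + absZ R j) ^+ (N + (n + 2)) * (1 + absZ R k)
      ^+ (N + (n + 2)) *
      (M.+1%:R * cmod (c2 j k)))).
      set b := _ ^+ (N + (n + 2)).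
      rewrite [leLHS](_ : _ = (1 + absZ R j) ^+ N * (b * (M.+1%:R * cmod (c2 j
        k)))); last by ring.
      rewrite -[leRHS]mulrA ler_wpM2r//.
        by rewrite !mulr_ge0 ?cmod_ge0// ltW// weightX_gt0.
      by apply: weightX_le; exact: leq_addr.
    rewrite [leRHS](_ : _ = (1 + absZ R j) ^+ (N + (n + 2)) * (1 + absZ R k)
      ^+ (N + (n + 2)) *
      ((1 + absZ R j) * (1 + absZ R k) * cmod (c j k))); last by ring.
    by rewrite ler_wpM2l// mulr_ge0// ltW// weightX_gt0.
  have LE : L <= cmod (U (synth c2)) + cmod (sum2 (fun j k =>
    c2 j k * dcoef j k)).
    rewrite /L {1}cE tempered_add// e1.
    rewrite [sum2 (fun j k => c j k * _)](_ : _ = sum2 (fun j k =>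
      c1 j k * dcoef j k) +
       sum2 (fun j k => c2 j k * dcoef j k)).
      by rewrite opprD addrACA subrr add0r cmodB.
    rewrite -(sum2D s1 s2'); congr sum2; apply/funext => j; apply/funext => k.
    by rewrite -mulrDl {1}cE.
  apply: (le_trans LE).
  rewrite /C mulrDl; apply: lerD; last first.
    by apply: (le_trans (cmod_sum2_le s2)); rewrite le_eqVlt; apply/orP; left;
      apply/eqP; ring.
  apply: (le_trans (UK _ _ (rapid_schwartz r2) p2)).
  rewrite [leRHS](_ : _ = `|K| * ((2 * pi) ^+ N * (`|B1| / M.+1%:R)
    * wconst R n)); last by ring.
  rewrite ler_wpM2r ?ler_norm//.
  by rewrite !mulr_ge0 ?divr_ge0// exprn_ge0// mulr_ge0.
apply/eqP; rewrite eq_le L0 andbT; apply/ler_addgt0Pl => e e0; rewrite addr0.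
have h0 : 0 <= C / e by rewrite divr_ge0// ltW.
apply: (le_trans (LC (Num.bound (C / e)))); rewrite ler_pdivrMr// mulrC
  -ler_pdivrMr//.
by apply: ltW; apply: (lt_trans (archi_boundP h0)); rewrite ltr_nat.
Qed.

End tempered_expansion.

Section reindexing.
Variables (R : realType) (n : nat).
Local Notation muZ := (@countZ R n).

Lemma cintegral_countZ_bij (f : Zn n -> R[i]) (s t : Zn n -> Zn n) :
  cancel s t -> cancel t s ->
  cintegral muZ (fun k => f (s k)) = cintegral muZ f.
Proof.
move=> st ts.
have H (g : Zn n -> R) : (\int[muZ]_k (g (s k))%:E = \int[muZ]_k (g k)%:E)%E.
  rewrite integralE [RHS]integralE; congr (_ - _)%E.
    transitivity (\int[muZ]_k (((fun k : Zn n => (g k)%:E)^\+)%E (s k)))%E.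
      by apply: eq_integral => k _; rewrite !funeposE.
    by apply: (integral_countZ_bij st ts) => k; exact: funepos_ge0.
  transitivity (\int[muZ]_k (((fun k : Zn n => (g k)%:E)^\-)%E (s k)))%E.
    by apply: eq_integral => k _; rewrite !funenegE.
  by apply: (integral_countZ_bij st ts) => k; exact: funeneg_ge0.
by rewrite /cintegral /Rintegral (H (fun k => complex.Re (f k))) (H (fun k =>
  complex.Im (f k))).
Qed.

(** Peetre's inequality moves the weights to the new indices, at a cost depending only on m and
    k. *)
Lemma rapid_shift (c : Zn n -> Zn n -> R[i]) m k : rapid c ->
  rapid (fun j l => c (j - m) (- (l + k))).
Proof.
move=> rc N; have [B cB] := rc N.
exists ((1 + absZ R m) ^+ N * (1 + absZ R k) ^+ N * B) => j l.
apply: (@le_trans _ _ ((1 + absZ R m) ^+ N * (1 + absZ R k) ^+ N *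
  ((1 + absZ R (j - m)) ^+ N * (1 + absZ R (- (l + k))) ^+ N * cmod (c (j - m)
    (- (l + k)))))).
  rewrite [leRHS]mulrA ler_wpM2r ?cmod_ge0//.
  have wp i : 0 <= 1 + absZ R i by rewrite ltW// weight_gt0.
  have hj : (1 + absZ R j) ^+ N <= (1 + absZ R m) ^+ N * (1 + absZ R (j - m))
    ^+ N.
    rewrite -exprMn lerXn2r ?nnegrE ?mulr_ge0//.
    by rewrite mulrC; have := weightD R (j - m) m; rewrite subrK.
  have hl : (1 + absZ R l) ^+ N <= (1 + absZ R k)
    ^+ N * (1 + absZ R (- (l + k))) ^+ N.
    rewrite -exprMn lerXn2r ?nnegrE ?mulr_ge0//.
    by rewrite mulrC absZN; have := weightD R (l + k) (- k);
      rewrite addrK absZN.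
  by rewrite [leRHS]mulrACA; apply: ler_pM; rewrite ?exprn_ge0.
by rewrite ler_wpM2l// mulr_ge0// ltW// weightX_gt0.
Qed.

End reindexing.

Section fourier_coefficient_bound.
Variables (R : realType) (n : nat).
Local Notation muZ := (@countZ R n).
Local Notation haar := (haar R n).

Lemma fseries_coef_le (c : Zn n -> R[i]) B l :
  (\int[muZ]_k (cmod (c k))%:E <= B%:E)%E ->
  ((cmod (c l))%:E <= \int[haar]_x (cmod (fseries c x))%:E)%E.
Proof.
move=> cB; rewrite -[l]opprK -(fseries_coef cB).
have mf : cmeasurable (fun x => fseries c x * echar (- l) x).
  apply: cmeasurableM; first exact: cmeasurable_fseries cB.
  exact/blip_measurable/blip_echar.
apply: (le_trans (cmod_cintegral_le _)).
  apply: (@bounded_cintegrable _ _ haar _ B) => // x.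
  by rewrite cmodM cmod_echar mulr1; exact: fseries_bounded.
by under eq_integral do rewrite cmodM cmod_echar mulr1.
Qed.

End fourier_coefficient_bound.

(** * Short-time Fourier transform of a distribution and its coefficients *)

Section stft_of_distributions.
Variables (R : realType) (n : nat).
Local Notation ZT := (Zn n * Tn R n)%type.
Local Notation TZ := (Tn R n * Zn n)%type.
Local Notation muZ := (@countZ R n).
Local Notation haar := (haar R n).
Variables (d : Zn n -> Zn n -> R[i]) (rd : rapid d).
Variable U : (ZT -> R[i]) -> R[i].
Hypothesis UT : temperedZT U.
Local Notation b := (dcoef U).

(** Coefficients of the time-frequency shifted conjugate window: conjugation reflects a frequency p
    to -p and the modulation moves it to l = -(p + k), whence p = -(l + k). *)
Definition atom_coef (z : ZT * TZ) : Zn n -> Zn n -> R[i] := fun j l =>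
  expi (- dotp z.2.1 j) *
  (conjc (d (j - z.1.1) (- (l + z.2.2))) * expi (- dotp z.1.2 (l + z.2.2))).

Lemma rapid_atom z : rapid (atom_coef z).
Proof.
apply: (@rapid_le R n (fun j l => d (j - z.1.1) (- (l + z.2.2))) _ 1).
  by move=> j l; rewrite /atom_coef !cmodM !cmod_expi cmod_conj mulr1 !mul1r.
exact: rapid_shift.
Qed.

Lemma atom_synth (z : ZT * TZ) :
  (fun y : ZT => expi (- dotp z.2.1 y.1) * expi (- dotp y.2 z.2.2) *
     conjc (synth d (y.1 - z.1.1, y.2 - z.1.2))) = synth (atom_coef z).
Proof.
case: z => [[m om] [xi k]]; apply/funext => -[j eta].
rewrite -[LHS]/(expi (- dotp xi j) * expi (- dotp eta k) *
  conjc (fseries (d (j - m)) (eta - om))).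
rewrite -[RHS]/(fseries (atom_coef ((m, om), (xi, k)) j) eta) /fseries.
have [B dB] := rapid_wsummable (j - m) rd 0%N; rewrite wsummable0E in dB.
have di x := fseries_cintegrable dB x.
rewrite -(cintegral_conj (di _)).
rewrite -cintegralZ; last exact/cintegrable_conj/di.
pose s (p : Zn n) : Zn n := - (p + k).
have ss : cancel s s by move=> p; rewrite /s opprD opprK addrK.
rewrite -[RHS](cintegral_countZ_bij _ ss ss); apply: eq_cintegral => p.
rewrite /atom_coef -[(_, _).1.1]/m -[(_, _).1.2]/om -[(_, _).2.1]/xi -[(_,
  _).2.2]/k.
have spk : s p + k = - p by rewrite /s opprD subrK.
rewrite spk /s opprK conjcM /echar conj_expi !dotpBl !dotpNr dotpDr !opprK.
rewrite (_ : - (dotp eta p - dotp om p) = - dotp eta p + dotp om p);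
  last by rewrite opprB addrC.
by rewrite !opprD !expiD; ring.
Qed.

Lemma stftZT_synth z : stftZT (synth d) U z = sum2 (fun j l =>
  atom_coef z j l * b j l).
Proof.
rewrite -(tempered_expansion UT (rapid_atom z)) -atom_synth.
by case: z => [[m om] [xi k]].
Qed.

Lemma stftZT_scale (c : R) z :
  stftZT (scale_window c (synth d)) U z = real_complex R c * stftZT (synth d)
    U z.
Proof.
have -> : stftZT (synth d) U z = U (synth (atom_coef z)).
  by rewrite -atom_synth; case: z => [[m om] [xi k]].
rewrite -(tempered_scale UT _ (rapid_atom z)).
transitivity (U (fun y => real_complex R c * synth (atom_coef z) y)).
  rewrite -atom_synth; case: z => [[m om] [xi k]].
  rewrite -[LHS]/(U (fun y => expi (- dotp xi y.1) * expi (- dotp y.2 k) *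
    conjc (real_complex R c * synth d (y.1 - m, y.2 - om)))).
  by congr U; apply/funext => y; rewrite conjcM conjc_real mulrCA.
by congr U; apply/funext => y; rewrite synthZ//; exact: rapid_atom.
Qed.

(* The coefficients in [omega], [xi] of the trigonometric series V(m, ., ., k). *)
Let a (m k j l : Zn n) : R[i] := d (j - m) (- (l + k)) * conjc (b j l).

Let a_summable m k : exists B, summable2 (a m k) B.
Proof.
have [B aB] := rapid_dcoef_summable2 UT (rapid_shift m k rd); exists B.
by apply: eq_summable2 aB => j l; rewrite !cmodM cmod_conj.
Qed.

(** The conjugate is taken because [fseries] uses the characters of positive sign; it is an iterated
    series, over l in omega and then over j in xi. *)
Let stft_conj m om xi k : conjc (stftZT (synth d) U ((m, om), (xi, k))) =
  fseries (fun j => echar k om * fseries (a m k j) om) xi.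
Proof.
have [B aB] := a_summable m k.
rewrite stftZT_synth /sum2.
have sB : summable2 (fun j l => atom_coef ((m, om), (xi, k)) j l * b j l) B.
  apply: eq_summable2 aB => j l.
  by rewrite /atom_coef /a !cmodM !cmod_expi !cmod_conj mulr1 mul1r.
rewrite -cintegral_conj; last exact: summable2_cintegrable sB.
apply: eq_cintegral => j.
rewrite -cintegral_conj; last exact: summable2_cintegrable_row sB.
have ri := fseries_cintegrable (summable2_row j aB) om.
rewrite /fseries mulrC mulrA -cintegralZ//; apply: eq_cintegral => l.
rewrite /atom_coef /a /echar /= !conjcM conjcK !conj_expi !opprK dotpDr expiD.
by ring.
Qed.

(** A coefficient is at most the L^1 norm: apply this in omega to isolate l, then in xi to isolate
    j. The factor [echar k om] has modulus 1. *)
Lemma dcoef_le (m k j l : Zn n) :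
  cmeasurable (stftZT (synth d) U) ->
  ((cmod (d (j - m) (- (l + k))) * cmod (b j l))%:E <=
   \int[haar]_om \int[haar]_xi (cmod (stftZT (synth d) U ((m, om), (xi,
     k))))%:E)%E.
Proof.
move=> mV; have [B aB] := a_summable m k.
rewrite -(cmod_conj (b j l)) -cmodM -/(a m k j l).
have rowB := summable2_row j aB.
apply: (le_trans (fseries_coef_le l rowB)).
have mF : cmeasurable (fseries (a m k j)) := cmeasurable_fseries rowB.
apply: ge0_le_integral => //.
- by move=> om _; rewrite lee_fin cmod_ge0.
- exact: measurable_ecmod.
- apply: (measurable_fun_fubini_tonelli_F (m2 := haar)
    (fun y : Tn R n * Tn R n => (cmod (stftZT (synth d) U ((m, y.1), (y.2,
      k))))%:E)).
    apply: measurable_ecmod.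
    apply: (cmeasurable_comp (h := fun y : Tn R n * Tn R n => ((m, y.1), (y.2,
      k)))) mV.
    by apply: measurable_fun_pair; apply: measurable_fun_pair => //;
      exact: measurable_cst.
  by move=> y; rewrite lee_fin cmod_ge0.
move=> om _; set c := fun j => echar k om * fseries (a m k j) om.
have cB : (\int[muZ]_j (cmod (c j))%:E <= B%:E)%E.
  apply: (le_trans _ aB); apply: ge0_le_integral => //.
    by move=> i _; rewrite lee_fin cmod_ge0.
  move=> i _; rewrite /c cmodM cmod_echar mul1r.
  apply: (le_trans (cmod_cintegral_le _)).
    exact: fseries_cintegrable (summable2_row i aB) om.
  by under eq_integral do rewrite cmodM cmod_echar mulr1.
have -> : cmod (fseries (a m k j) om) = cmod (c j).
  by rewrite /c cmodM cmod_echar mul1r.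
apply: (le_trans (fseries_coef_le j cB)).
by under eq_integral do rewrite -stft_conj cmod_conj.
Qed.

Lemma dcoef_summable2 j0 k0 : cmeasurable (stftZT (synth d) U) ->
  ((cmod (d j0 k0))%:E * \int[muZ]_j \int[muZ]_l (cmod (b j l))%:E <=
   normMZT (synth d) 1 U)%E.
Proof.
move=> mV; set V := stftZT (synth d) U.
have mE := measurable_ecmod mV.
have E0 z : (0 <= (cmod (V z))%:E)%E by rewrite lee_fin cmod_ge0.
pose I m k := (\int[haar]_om \int[haar]_xi (cmod (V ((m, om), (xi, k))))%:E)%E.
have I0 m k : (0 <= I m k)%E.
  by apply: integral_ge0 => om _; apply: integral_ge0.
(* Tonelli puts both torus variables inside, as in the bound [dcoef_le]. *)
have -> : normMZT (synth d) 1 U = (\int[muZ]_m \int[muZ]_k I m k)%E.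
  rewrite /normMZT LpNorm1 -/V.
  rewrite (fubini_tonelli1 (m1 := @muZT R n) (m2 := @muTZ R n) (fun z =>
    (cmod (V z))%:E))//.
  have mF := measurable_fun_fubini_tonelli_F (m2 := @muTZ R n) _ mE E0.
  rewrite (fubini_tonelli1 (m1 := muZ) (m2 := haar)
    (fubini_F (@muTZ R n) (fun z => (cmod (V z))%:E)))//; last first.
    by move=> x; apply: integral_ge0.
  apply: eq_integral => m _; rewrite /fubini_F /I.
  have sect (om : Tn R n) : measurable_fun setT (fun y : TZ => (cmod (V ((m,
    om), y)))%:E).
    apply: (measurableT_comp mE); exact: pair1_measurable.
  have mG : measurable_fun setT (fun w : Tn R n * Zn n =>
      \int[haar]_xi (cmod (V ((m, w.1), (xi, w.2))))%:E)%E.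
    apply: measurable_fun_prodZn => k.
    apply: (measurable_fun_fubini_tonelli_F (m2 := haar)
      (fun y : Tn R n * Tn R n => (cmod (V ((m, y.1), (y.2, k))))%:E)) => //.
    apply: measurable_ecmod.
    apply: (cmeasurable_comp (h := fun y : Tn R n * Tn R n => ((m, y.1), (y.2,
      k)))) mV.
    by apply: measurable_fun_pair; apply: measurable_fun_pair => //;
      exact: measurable_cst.
  transitivity (\int[haar]_om \int[muZ]_k \int[haar]_xi (cmod (V ((m, om), (xi,
    k))))%:E)%E.
    apply: eq_integral => om _.
    by rewrite (fubini_tonelli2 (m1 := haar) (m2 := muZ) (fun y : TZ =>
      (cmod (V ((m, om), y)))%:E)).
  rewrite (fubini_tonelli (m1 := haar) (m2 := muZ) (fun w : Tn R n * Zn n =>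
      \int[haar]_xi (cmod (V ((m, w.1), (xi, w.2))))%:E)%E)//.
  by move=> w; apply: integral_ge0.
(* With m = j - j0 and k = -(l + k0) the window coefficient in [dcoef_le] is always d(j0, k0), and
   (m, k) runs once through all pairs. *)
apply: (@le_trans _ _ (\int[muZ]_j \int[muZ]_l I (j - j0)%R (- (l + k0))%R)%E);
  last first.
  have shiftE := @integral_countZ_shift R n
    (fun j => \int[muZ]_l I j (- (l + k0))%R)%E j0 (fun j =>
      integral_ge0 muZ (fun l _ => I0 _ _)).
  apply: lee_of_eq; apply: (etrans shiftE); apply: eq_integral => m _.
  pose s (p : Zn n) : Zn n := - (p + k0).
  have ss : cancel s s by move=> p; rewrite /s opprD opprK addrK.
  exact: (@integral_countZ_bij R n (I m) s s ss ss (I0 m)).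
rewrite -ge0_integralZl_EFin ?cmod_ge0//; last first.
  by move=> j _; apply: integral_ge0 => l _; rewrite lee_fin cmod_ge0.
apply: ge0_le_integral => //.
  move=> j _; rewrite mule_ge0 ?lee_fin ?cmod_ge0//.
  by apply: integral_ge0 => l _; rewrite lee_fin cmod_ge0.
move=> j _; rewrite -ge0_integralZl_EFin ?cmod_ge0//; last first.
  by move=> l _; rewrite lee_fin cmod_ge0.
apply: ge0_le_integral => //.
  by move=> l _; rewrite mule_ge0 ?lee_fin ?cmod_ge0.
move=> l _; rewrite -EFinM.
have := @dcoef_le (j - j0) (- (l + k0)) j l mV.
by rewrite subKr opprB addrAC subrr add0r.
Qed.

End stft_of_distributions.

(** * The symbol as a function with summable row bounds *)

Section symbol.
Variables (R : realType) (n : nat).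
Local Notation ZT := (Zn n * Tn R n)%type.
Local Notation muZ := (@countZ R n).
Local Notation haar := (haar R n).

Lemma synth_neq0 (d : Zn n -> Zn n -> R[i]) y : synth d y <> 0 ->
  exists j k, d j k <> 0.
Proof.
move=> dy; apply: contrapT => H; apply: dy.
rewrite /synth /fseries -[RHS](@cintegral0 _ _ _ muZ); apply: eq_cintegral => k.
have [->|d0] := eqVneq (d y.1 k) 0; first by rewrite mul0r.
by exfalso; apply: H; exists y.1, k; apply/eqP.
Qed.

Section represents.
Variable U : (ZT -> R[i]) -> R[i].
Hypothesis UT : temperedZT U.
Variable B : R.
Hypothesis bB : summable2 (dcoef U) B.
Local Notation b := (dcoef U).

(* \sum_k b(j, k) e_{-k}(eta): the conjugations turn the e_k of [fseries] into
   e_{-k}. *)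
Definition symbol : ZT -> R[i] :=
  fun y => conjc (fseries (fun k => conjc (b y.1 k)) y.2).

Definition row_sum (j : Zn n) : R := fine (\int[muZ]_k (cmod (b j k))%:E)%E.

Lemma row_sumE j : (\int[muZ]_k (cmod (b j k))%:E = (row_sum j)%:E)%E.
Proof.
rewrite fineK// ge0_fin_numE; last by apply: integral_ge0 => k _;
  rewrite lee_fin cmod_ge0.
by rewrite (le_lt_trans (summable2_row j bB))// ltry.
Qed.

Lemma row_sum_ge0 j : 0 <= row_sum j.
Proof. by rewrite fine_ge0//; apply: integral_ge0 => k _;
  rewrite lee_fin cmod_ge0. Qed.

Lemma integral_row_sum : (\int[muZ]_j (row_sum j)%:E = \int[muZ]_j \int[muZ]_k
  (cmod (b j k))%:E)%E.
Proof. by apply: eq_integral => j _; rewrite row_sumE. Qed.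

Let conjB j : (\int[muZ]_k (cmod (conjc (b j k)))%:E <= (row_sum j)%:E)%E.
Proof. by under eq_integral do rewrite cmod_conj; rewrite row_sumE. Qed.

Lemma cmod_symbol_le y : cmod (symbol y) <= row_sum y.1.
Proof. by rewrite /symbol cmod_conj; exact: fseries_bounded (conjB _) _. Qed.

Lemma symbol_periodic j : Defs.periodic (fun x => symbol (j, x)).
Proof. by move=> x z; rewrite /symbol fseries_periodic. Qed.

Lemma cmeasurable_symbol : cmeasurable symbol.
Proof.
apply: cmeasurable_Znprod => j; apply: cmeasurable_conj.
exact: cmeasurable_fseries (conjB j).
Qed.

Lemma integral_fst_muZT (G : Zn n -> \bar R) : (forall k, 0 <= G k)%E ->
  (\int[@muZT R n]_y G y.1 = \int[muZ]_k G k)%E.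
Proof.
move=> G0; rewrite (fubini_tonelli1 (m1 := muZ) (m2 := haar) (fun y =>
  G y.1))//; last first.
  by apply: measurable_fun_Znprod => k /=; exact: measurable_cst.
apply: eq_integral => k _; rewrite /fubini_F/= integral_cst//.
by rewrite [X in (_ * X)%E](_ : _ = 1%E) ?mule1//; exact: probability_setT.
Qed.

Lemma cintegrable_symbolM (F : ZT -> R[i]) (M : R) : cmeasurable F ->
  (forall y, cmod (F y) <= M) ->
  cintegrable (@muZT R n) (fun y => symbol y * F y).
Proof.
move=> mF FM; have M0 : 0 <= M by rewrite (le_trans (cmod_ge0 _) (FM (0, 0))).
apply: (cintegrable_le (g := fun y : ZT => (M * row_sum y.1)%:E)).
- exact: cmeasurableM cmeasurable_symbol mF.
- by apply: measurable_fun_Znprod => k /=; exact: measurable_cst.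
- move=> y; rewrite lee_fin cmodM mulrC.
  by apply: ler_pM; rewrite ?cmod_ge0//; exact: cmod_symbol_le.
- rewrite (@integral_fst_muZT (fun k => (M * row_sum k)%:E)); last first.
    by move=> k; rewrite lee_fin mulr_ge0// row_sum_ge0.
  under eq_integral do rewrite EFinM.
  rewrite ge0_integralZl_EFin//; last by move=> k _;
    rewrite lee_fin row_sum_ge0.
  rewrite integral_row_sum; apply: le_lt_trans (ltry (M * B)); rewrite EFinM.
  by apply: lee_wpmul2l; rewrite ?lee_fin.
Qed.

(** Parseval in each row j, then Fubini in j; [row_sum] gives the domination. *)
Lemma symbol_represents : represents U symbol.
Proof.
split; [exact: symbol_periodic|exact: cmeasurable_symbol|].
move=> F /schwartz_expansion [c [rc ->]].
have [B0 cB] := rc (0 + (n + 2))%N.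
have Fbd y : cmod (synth c y) <= B0 * wconst R n.
  apply: fseries_bounded; rewrite -wsummable0E; apply: wsummable_decay => k.
  apply: le_trans (cB y.1 k); rewrite ler_wpM2r ?cmod_ge0//.
  by rewrite ler_peMl ?weightX_ge1// ltW// weightX_gt0.
have mrow j : cmeasurable (fun x => synth c (j, x)).
  have [A cA] := rapid_wsummable j rc 0%N; rewrite wsummable0E in cA.
  exact: (cmeasurable_fseries cA).
have mF : cmeasurable (synth c) by exact: cmeasurable_Znprod.
have iF := cintegrable_symbolM mF Fbd.
split=> //; rewrite tempered_expansion//.
have irow j : cintegrable haar (fun x => symbol (j, x) * synth c (j, x)).
  apply: (@bounded_cintegrable _ _ haar _ (row_sum j * (B0 * wconst R n))).
    apply: cmeasurableM (mrow j); apply: cmeasurable_conj.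
    exact: cmeasurable_fseries (conjB j).
  move=> x; rewrite cmodM; apply: ler_pM; rewrite ?cmod_ge0//.
  exact: (cmod_symbol_le (j, x)).
have E j : cintegral haar (fun x => symbol (j, x) * synth c (j, x)) =
    cintegral muZ (fun k => c j k * b j k).
  have [A cA] := rapid_wsummable j rc 0%N; rewrite wsummable0E in cA.
  have ir : cintegrable muZ (fun k => c j k * b j k).
    by have [C cC] := rapid_dcoef_summable2 UT rc;
      exact: summable2_cintegrable_row cC.
  (* After conjugation the symbol becomes a plain [fseries], to which [cintegral_fseriesM]
     applies. *)
  rewrite -[LHS]conjcK -(cintegral_conj (irow j))
    -[RHS]conjcK -(cintegral_conj ir).
  congr conjc.
  transitivity (cintegral haar (fun x => fseries (fun k => conjc (b j k))
    x * conjc (fseries (c j) x))).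
    by apply: eq_cintegral => x; rewrite conjcM /symbol conjcK.
  rewrite (cintegral_fseriesM (conjB j) (M := A)); first last.
  - by move=> x; rewrite cmod_conj; exact: fseries_bounded.
  - exact: cmeasurable_conj (mrow j).
  apply: eq_cintegral => k; rewrite conjcM mulrC; congr (_ * _).
  rewrite -[k in conjc (c j k)]opprK -(fseries_coef cA) -cintegral_conj;
    last first.
    apply: (@bounded_cintegrable _ _ haar _ A).
      by apply: cmeasurableM (mrow j) _; exact: cmeasurable_echar.
    by move=> x; rewrite cmodM cmod_echar mulr1; exact: fseries_bounded.
  by apply: eq_cintegral => x; rewrite conjcM echar_conj opprK mulrC.
rewrite /sum2; under eq_cintegral do rewrite -E.
have cst0 y : cintegrable muZ (fun j => symbol (j, y) * synth c (j, y)).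
  apply/cintegrable_countZP; apply: le_lt_trans (ltry (B * (B0 * wconst R n))).
  apply: (@le_trans _ _ (\int[muZ]_j ((row_sum j)%:E * (B0 * wconst R
    n)%:E))%E).
    apply: ge0_le_integral => //; first by move=> j _; rewrite lee_fin cmod_ge0.
    move=> j _; rewrite -EFinM lee_fin cmodM; apply: ler_pM;
      rewrite ?cmod_ge0//.
    exact: (cmod_symbol_le (j, y)).
  rewrite ge0_integralZr//; last 2 first.
  - by move=> j _; rewrite lee_fin row_sum_ge0.
  - by rewrite lee_fin (le_trans (cmod_ge0 _) (Fbd (0, 0))).
  rewrite [leRHS]EFinM; apply: lee_wpmul2r.
    by rewrite lee_fin (le_trans (cmod_ge0 _) (Fbd (0, 0))).
  by rewrite integral_row_sum.
by rewrite (cintegral12 (m1 := muZ) (m2 := haar) (f := fun y : ZT =>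
  symbol y * synth c y)).
Qed.

End represents.

(** K is the modulus of a non-zero Fourier coefficient of Phi, fixed before c and U. Scaling the
    window by c scales the norm by c. *)
Lemma symbol_of_MZT (Phi : ZT -> R[i]) : schwartzZT Phi ->
  (exists x, Phi x <> 0) ->
  exists2 K : R, 0 < K & forall (c : R) (U : (ZT -> R[i]) -> R[i]), 0 < c ->
    MZT (scale_window c Phi) 1 U ->
    exists (s : ZT -> R[i]) (beta : Zn n -> R),
      [/\ represents U s, forall j, 0 <= beta j,
          forall y, cmod (s y) <= beta y.1 &
          ((c * K)%:E * \int[muZ]_j (beta j)%:E <= normMZT (scale_window c Phi)
            1 U)%E].
Proof.
move=> /schwartz_expansion [d [rd ->]] [y dy].
have [j0 [k0 d0]] := synth_neq0 dy.
exists (cmod (d j0 k0)).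
  rewrite lt_neqAle cmod_ge0 andbT eq_sym; apply/eqP => /cmod_eq0; exact: d0.
move=> c U c0 [UT [mVc Voo]].
have VcE z : stftZT (synth d) U z =
    real_complex R c^-1 * stftZT (scale_window c (synth d)) U z.
  rewrite (stftZT_scale rd UT) mulrA -rmorphM mulVf ?gt_eqF//.
  by rewrite rmorph1 mul1r.
have mV : cmeasurable (stftZT (synth d) U).
  rewrite (_ : stftZT _ _ = fun z => real_complex R c^-1 * stftZT (scale_window
    c (synth d)) U z).
    by apply: cmeasurableM => //; exact: cmeasurable_cst.
  by apply/funext => z; exact: VcE.
have normE : normMZT (scale_window c (synth d)) 1 U = (c%:E * normMZT (synth d)
  1 U)%E.
  rewrite /normMZT !LpNorm1 -ge0_integralZl_EFin//; last 3 first.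
  - by move=> z _; rewrite lee_fin cmod_ge0.
  - exact: measurable_ecmod.
  - exact: ltW.
  apply: eq_integral => z _.
  by rewrite (stftZT_scale rd UT) cmodM cmod_real ger0_norm ?ltW// EFinM.
have sumb := dcoef_summable2 rd UT j0 k0 mV.
have dgt0 : 0 < cmod (d j0 k0).
  rewrite lt_neqAle cmod_ge0 andbT eq_sym; apply/eqP => /cmod_eq0; exact: d0.
have Noo : (normMZT (synth d) 1 U < +oo)%E.
  move: Voo; rewrite -/(normMZT _ _ _) normE.
  have : (0 <= normMZT (synth d) 1 U)%E by exact: LpNorm_ge0.
  by case: (normMZT _ _ _) => [r||]//= _; rewrite ?ltry// gt0_muley.
have [B bB] : exists B, summable2 (dcoef U) B.
  exists (fine (normMZT (synth d) 1 U) / cmod (d j0 k0)).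
  rewrite /summable2 mulrC EFinM lee_pdivlMl// fineK// ge0_fin_numE//.
  exact: LpNorm_ge0.
exists (symbol U), (row_sum U); split.
- exact: symbol_represents bB.
- exact: row_sum_ge0.
- by move=> z; exact: cmod_symbol_le bB z.
- rewrite normE (integral_row_sum bB) EFinM -muleA.
  by apply: lee_wpmul2l; [rewrite lee_fin ltW|exact: sumb].
Qed.

End symbol.

(** * Modulation spaces of Z^n *)

Section stft_Zn.
Variables (R : realType) (n : nat).
Local Notation ZT := (Zn n * Tn R n)%type.
Local Notation muZ := (@countZ R n).
Local Notation muZT := (@muZT R n).
Local Notation haar := (haar R n).
Implicit Types (f g h phi : Zn n -> R[i]) (p : \bar R).

(** Common ground of the two situations below: tempered f with a Schwartz window, and f, g in dual
    l^p spaces. *)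
Definition stft_summable g f : Prop := forall m, exists B : R,
  (\int[muZ]_k (cmod (f k) * cmod (g (k - m)%R))%:E <= B%:E)%E.

Lemma cmod_tfshift g (x : ZT) k : cmod (tfshift g x k) = cmod (g (k - x.1)).
Proof. by rewrite /tfshift cmodM cmod_expi mul1r. Qed.

Section summable.
Variables g f : Zn n -> R[i].
Hypothesis gf : stft_summable g f.

Let coef m k := conjc (f k) * g (k - m).

Let coefB m : exists B : R, (\int[muZ]_k (cmod (coef m k))%:E <= B%:E)%E.
Proof.
have [B fB] := gf m; exists B.
by under eq_integral do rewrite /coef cmodM cmod_conj.
Qed.

Lemma stft_cintegrable (x : ZT) : cintegrable muZ (fun k =>
  f k * conjc (tfshift g x k)).
Proof.
apply/cintegrable_countZP; have [B fB] := gf x.1.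
under eq_integral do rewrite cmodM cmod_conj cmod_tfshift.
by rewrite (le_lt_trans fB)// ltry.
Qed.

Lemma stft_fseries m w : stft g f (m, w) = conjc (fseries (coef m) w).
Proof.
rewrite -[LHS]conjcK; congr conjc.
rewrite /stft /pairing -cintegral_conj; last exact: (stft_cintegrable (m, w)).
apply: eq_cintegral => k; rewrite conjcM conjcK /tfshift /coef /echar/=.
by ring.
Qed.

Lemma cmeasurable_stft : cmeasurable (stft g f).
Proof.
apply: cmeasurable_Znprod => m; have [B cB] := coefB m.
rewrite (_ : (fun x => _) = fun x => conjc (fseries (coef m) x)).
  apply: cmeasurable_conj; exact: cmeasurable_fseries cB.
by apply/funext => w; rewrite stft_fseries.
Qed.

Lemma cmod_stft_le (x : ZT) :
  ((cmod (stft g f x))%:E <= \int[muZ]_k (cmod (f k)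
    * cmod (g (k - x.1)%R))%:E)%E.
Proof.
apply: (le_trans (cmod_cintegral_le (stft_cintegrable x))).
by under eq_integral do rewrite cmodM cmod_conj cmod_tfshift.
Qed.

Lemma le_integral_stft m k : ((cmod (f k) * cmod (g (k - m)))%:E <=
  \int[haar]_w (cmod (stft g f (m, w)))%:E)%E.
Proof.
have [B cB] := coefB m; have := fseries_coef_le k cB.
rewrite /coef cmodM cmod_conj => /le_trans; apply; apply: lee_of_eq.
by apply: eq_integral => w _; rewrite stft_fseries cmod_conj.
Qed.

End summable.

Lemma schwartzZ_summable phi : schwartzZ phi ->
  exists2 B : R, 0 < B & (\int[muZ]_k (cmod (phi k))%:E <= B%:E)%E.
Proof.
move=> sphi; have [B phiB] := sphi (n + 2)%N.
have B0 : 0 <= B by rewrite (le_trans _ (phiB 0))// mulr_ge0 ?cmod_ge0// ltW//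
  weightX_gt0.
exists (B * wconst R n + 1); first by rewrite ltr_wpDl// mulr_ge0// wconst_ge0.
apply: (@le_trans _ _ (B * wconst R n)%:E); last by rewrite lee_fin lerDl.
by apply: integral_decay => k; [exact: cmod_ge0|exact: phiB].
Qed.

(** Peetre's inequality transfers the growth of f to k - m, where the decay of phi absorbs N powers
    for f and n + 2 for summation. *)
Lemma tempered_stft_summable phi f : schwartzZ phi -> temperedZ f ->
  stft_summable phi f.
Proof.
move=> sphi [N [B fB]] m; have [C phiC] := sphi (N + (n + 2))%N.
exists (`|B| * (1 + absZ R m) ^+ N * C * (1 + absZ R m) ^+ (n + 2)
  * wconst R n).
have wm M : 0 <= (1 + absZ R m) ^+ M by rewrite ltW// weightX_gt0.
have wk M k : 0 <= (1 + absZ R k) ^+ M by rewrite ltW// weightX_gt0.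
have wP M k : (1 + absZ R k) ^+ M <= (1 + absZ R (k - m)) ^+ M * (1 + absZ R m)
  ^+ M.
  have w0 i : 0 <= 1 + absZ R i by rewrite ltW// weight_gt0.
  rewrite -exprMn lerXn2r ?nnegrE ?mulr_ge0//.
  by have := weightD R (k - m) m; rewrite subrK.
apply: integral_decay => k; first by rewrite mulr_ge0 ?cmod_ge0.
apply: (@le_trans _ _ ((1 + absZ R (k - m)) ^+ (n + 2) * (1 + absZ R m)
  ^+ (n + 2) *
   (`|B| * ((1 + absZ R (k - m)) ^+ N * (1 + absZ R m) ^+ N)
     * cmod (phi (k - m))))).
  apply: ler_pM; rewrite ?mulr_ge0 ?cmod_ge0//.
  rewrite ler_wpM2r ?cmod_ge0// (le_trans (fB k))//.
  apply: (@le_trans _ _ (`|B| * (1 + absZ R k) ^+ N));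
    first by rewrite ler_wpM2r// ler_norm.
  by rewrite ler_wpM2l.
rewrite [leLHS](_ : _ = `|B| * (1 + absZ R m) ^+ N * (1 + absZ R m) ^+ (n + 2) *
  ((1 + absZ R (k - m)) ^+ (N + (n + 2)) * cmod (phi (k - m)))); last first.
  by rewrite [X in _ = _ * (X * _)]exprD; ring.
rewrite [leRHS](_ : _ = `|B| * (1 + absZ R m) ^+ N * (1 + absZ R m) ^+ (n + 2)
  * C); last by ring.
by rewrite ler_wpM2l// !mulr_ge0.
Qed.

Lemma LpNorm_shift_le p f m : (1 <= p)%E ->
  (LpNorm muZ p (fun k => f (k - m)%R) <= LpNorm muZ p f)%E.
Proof.
case: p => [r||//] p1; last first.
  apply: LpNorm_infty_le; first exact: LpNorm_ge0.
  by move=> k; exact: cmod_le_LpNorm.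
rewrite !LpNormE (@integral_countZ_shift R n (fun k => (cmod (f k) `^ r)%:E))//.
by move=> k; rewrite lee_fin powR_ge0.
Qed.

Lemma hoelder_stft p f g m : (1 <= p)%E ->
  (LpNorm muZ p f < +oo)%E -> (LpNorm muZ (hoelder_conjugate p) g < +oo)%E ->
  (\int[muZ]_k (cmod (f k) * cmod (g (k - m)%R))%:E <=
     LpNorm muZ p f * LpNorm muZ (hoelder_conjugate p) g)%E.
Proof.
move=> p1 foo goo; have q1 := hoelder_conj_ge1 p1.
have gm := LpNorm_shift_le g m q1.
apply: (le_trans (@hoelder_countZ R n p f (fun k => g (k - m))
  p1 foo (le_lt_trans gm goo))).
by apply: lee_wpmul2l => //; exact: LpNorm_ge0.
Qed.

Lemma lp_stft_summable p f g : (1 <= p)%E ->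
  (LpNorm muZ p f < +oo)%E -> (LpNorm muZ (hoelder_conjugate p) g < +oo)%E ->
  stft_summable g f.
Proof.
move=> p1 foo goo m.
exists (fine (LpNorm muZ p f * LpNorm muZ (hoelder_conjugate p) g))%E.
rewrite fineK; first exact: hoelder_stft.
by rewrite fin_numM// ge0_fin_numE// LpNorm_ge0.
Qed.

(** Uniformly in w, |V_phi f(m, w)| is at most the convolution of |f| with the reflected window
    |phi(-k)|, so Young's inequality applies along the first projection. *)
Lemma normMZ_le phi p f (B : R) : (1 <= p)%E ->
  (\int[muZ]_k (cmod (phi k))%:E <= B%:E)%E -> (LpNorm muZ p f < +oo)%E ->
  stft_summable phi f -> (normMZ phi p f <= B%:E * LpNorm muZ p f)%E.
Proof.
move=> p1 phiB foo phif.
apply: (@young_countZ R n _ _ muZT fst (fun m => cmod (phi (- m)))) => //.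
- by move=> G G0; exact: integral_fst_muZT.
- exact: cmeasurable_stft.
- by move=> k; exact: cmod_ge0.
- apply: le_trans phiB; apply: lee_of_eq.
  apply: (@integral_countZ_bij R n (fun k => (cmod (phi k))%:E) -%R -%R) => k;
    rewrite ?opprK//.
  by rewrite lee_fin cmod_ge0.
- move=> y; apply: (le_trans (cmod_stft_le phif y)); apply: lee_of_eq.
  rewrite -(@integral_countZ_subl R n (fun k => (cmod (f k)
    * cmod (phi (k - y.1)%R))%:E) y.1).
    by apply: eq_integral => k _; rewrite mulrC addrAC subrr add0r.
  by move=> k; rewrite lee_fin mulr_ge0 ?cmod_ge0.
Qed.

Lemma integral_muZT (G : ZT -> \bar R) : measurable_fun setT G -> (forall x,
  0 <= G x)%E ->
  (\int[muZT]_x G x = \int[muZ]_m \int[haar]_w G (m, w))%E.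
Proof. by move=> mG G0; rewrite (fubini_tonelli1 (m1 := muZ) (m2 := haar)
  G mG G0). Qed.

Lemma integral_haar_cst (M : \bar R) : (\int[haar]_w M = M)%E.
Proof.
by rewrite integral_cst// [X in (_ * X)%E](_ : _ = 1%E) ?mule1//;
  exact: probability_setT.
Qed.

(** Each m has mass 1, so a null set has null sections and the essential bound holds almost
    everywhere on every row. *)
Lemma LpNorm_infty_row (V : ZT -> R[i]) m : cmeasurable V ->
  (\int[haar]_w (cmod (V (m, w)))%:E <= LpNorm muZT +oo V)%E.
Proof.
move=> mV; rewrite /LpNorm unlock; have muT : (0 < muZT [set: ZT])%E.
  have := @integral_muZT (cst 1%E); rewrite integral_cst// mul1e => -> //.
  under eq_integral do rewrite integral_haar_cst.
  by rewrite integral_cst// mul1e; exact: countZT_gt0.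
rewrite muT; set M := ess_sup _ _.
have [A [mA A0 fA]] := ess_sup_ge muZT (abse \o (fun x => (cmod (V x))%:E)).
have Am : haar (xsection A m) = 0%E.
  apply/eqP; rewrite eq_le measure_ge0 andbT -A0.
  apply: (@le_integral_countZ R n (fun m => haar (xsection A m))) => k.
  exact: measure_ge0.
rewrite -[leRHS]integral_haar_cst.
have M0 : (0 <= M)%E.
  by apply: ess_sup_gee => //; apply: nearW => x /=.
apply: ae_ge0_le_integral => //.
- by move=> w _; rewrite lee_fin cmod_ge0.
- apply: measurable_ecmod; apply: (cmeasurable_comp (h := fun w => (m, w))) mV.
  exact: pair1_measurable.
exists (xsection A m); split => //; first exact: measurable_xsection.
move=> w /= nw; rewrite /xsection/= inE; apply: fA => /= H; apply: nw => _.
by move: H; rewrite ger0_norm// cmod_ge0.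
Qed.

(** In the row m = k - k0 the k-th coefficient has modulus |f(k)| |phi(k0)|. Its bound by a mean
    over the torus is raised to the power r by Jensen with weight 1, and k is then summed. *)
Lemma LpNorm_le_normMZ phi p f k0 : (1 <= p)%E -> stft_summable phi f ->
  0 < cmod (phi k0) ->
  ((cmod (phi k0))%:E * LpNorm muZ p f <= normMZ phi p f)%E.
Proof.
move=> p1 phif phi0; have mV := cmeasurable_stft phif.
have point k : ((cmod (f k) * cmod (phi k0))%:E <=
    \int[haar]_w (cmod (stft phi f (k - k0, w)))%:E)%E.
  have := le_integral_stft phif (k - k0) k.
  by rewrite opprB addrCA subrr addr0.
case: p p1 => [r||//] p1; last first.
  rewrite muleC -lee_pdivlMr//; apply: LpNorm_infty_le.
    by apply: mule_ge0; [exact: LpNorm_ge0|rewrite lee_fin invr_ge0 cmod_ge0].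
  move=> k; rewrite lee_pdivlMr// -EFinM; apply: (le_trans (point k)).
  exact: LpNorm_infty_row.
move: p1; rewrite lee_fin => r1; have r0 : 0 < r by rewrite (lt_le_trans ltr01).
rewrite /normMZ !LpNormE.
have -> : (cmod (phi k0))%:E = ((cmod (phi k0) `^ r)%:E `^ r^-1)%E.
  by rewrite poweR_EFin -powRrM divff ?gt_eqF// powRr1// cmod_ge0.
rewrite -poweRM ?lee_fin ?powR_ge0//; last first.
  by apply: integral_ge0 => k _; rewrite lee_fin powR_ge0.
have mVr : measurable_fun setT (fun x => (cmod (stft phi f x) `^ r)%:E).
  apply/measurable_EFinP; apply: (measurableT_comp (measurable_powR r)).
  exact: measurable_cmod.
apply: poweR_le; first by rewrite invr_ge0 ltW.
  apply: mule_ge0; first by rewrite lee_fin powR_ge0.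
  by apply: integral_ge0 => k _; rewrite lee_fin powR_ge0.
rewrite integral_muZT//; last by move=> x; rewrite lee_fin powR_ge0.
rewrite -(@integral_countZ_shift R n (fun m =>
  \int[haar]_w (cmod (stft phi f (m, w)) `^ r)%:E)%E k0); last first.
  by move=> m; apply: integral_ge0 => w _; rewrite lee_fin powR_ge0.
rewrite -ge0_integralZl_EFin ?powR_ge0//; last by move=> k _;
  rewrite lee_fin powR_ge0.
apply: ge0_le_integral => //.
  by move=> k _; rewrite mule_ge0 ?lee_fin ?powR_ge0.
move=> k _; rewrite -EFinM -powRM ?cmod_ge0// -poweR_EFin mulrC.
apply: (@le_trans _ _ ((\int[haar]_w (1 * cmod (stft phi f (k - k0, w)))%:E)
  `^ r)%E).
  apply: poweR_le; [exact: ltW|by rewrite lee_fin mulr_ge0 ?cmod_ge0|].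
  by under eq_integral do rewrite mul1r; exact: point.
have mrow : cmeasurable (fun w => stft phi f (k - k0, w)).
  apply: (cmeasurable_comp (h := fun w => (k - k0, w))) mV.
  exact: pair1_measurable.
have := @jensen_powR R _ _ haar (fun=> 1) (fun w => cmod (stft phi f (k - k0,
  w))) 1 r r1.
rewrite powR1 mul1e => /(_ (measurable_cst _) (measurable_cmod mrow) (fun=>
  ler01)).
move=> /(_ (fun w => cmod_ge0 _)); rewrite integral_haar_cst => /(_ (lexx _)).
by under [X in (_ <= X)%E -> _]eq_integral do rewrite mul1r.
Qed.

End stft_Zn.

(** * Localization operators *)

Section localization_operator.
Variables (R : realType) (n : nat).
Local Notation ZT := (Zn n * Tn R n)%type.
Local Notation muZ := (@countZ R n).
Local Notation muZT := (@muZT R n).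
Local Notation haar := (haar R n).
Implicit Types (f h : Zn n -> R[i]).
Variables (s : ZT -> R[i]) (beta : Zn n -> R) (b : R).
Hypothesis ms : cmeasurable s.
Hypothesis beta0 : forall j, 0 <= beta j.
Hypothesis s_le : forall y, cmod (s y) <= beta y.1.
Hypothesis beta_b : (\int[muZ]_j (beta j)%:E <= b%:E)%E.
Variables (p : \bar R) (g1 g2 : Zn n -> R[i]).
Hypothesis p1 : (1 <= p)%E.
Local Notation p' := (hoelder_conjugate p).
(** Real majorants of the norms keep the estimates out of extended arithmetic. *)
Variables (a1 a2 : R).
Hypothesis g1a : (LpNorm muZ p' g1 <= a1%:E)%E.
Hypothesis g2a : (LpNorm muZ p g2 <= a2%:E)%E.

Let g1oo : (LpNorm muZ p' g1 < +oo)%E. Proof. exact: le_lt_trans g1a (ltry _).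
  Qed.
Let g2oo : (LpNorm muZ p g2 < +oo)%E. Proof. exact: le_lt_trans g2a (ltry _).
  Qed.

Let a1_ge0 : 0 <= a1. Proof. by rewrite -lee_fin (le_trans (LpNorm_ge0 _ _ _)
  g1a). Qed.
Let a2_ge0 : 0 <= a2. Proof. by rewrite -lee_fin (le_trans (LpNorm_ge0 _ _ _)
  g2a). Qed.

Let g2_le k : cmod (g2 k) <= a2.
Proof. by rewrite -lee_fin (le_trans (cmod_le_LpNorm _ _ p1) g2a). Qed.

Lemma cmeasurable_tfshift k : cmeasurable (fun x : ZT => tfshift g2 x k).
Proof.
apply: cmeasurable_Znprod => m; apply: cmeasurableM => /=;
  last exact: cmeasurable_cst.
exact/blip_measurable/blip_echar.
Qed.

Section one_function.
Variables (f : Zn n -> R[i]) (a : R).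
Hypothesis fa : (LpNorm muZ p f <= a%:E)%E.

Let foo : (LpNorm muZ p f < +oo)%E. Proof. exact: le_lt_trans fa (ltry _). Qed.
Let a_ge0 : 0 <= a. Proof. by rewrite -lee_fin (le_trans (LpNorm_ge0 _ _ _)
  fa). Qed.
Let summ : stft_summable g1 f. Proof. exact: lp_stft_summable p1 foo g1oo. Qed.

Lemma stft_le x : cmod (stft g1 f x) <= a * a1.
Proof.
rewrite -lee_fin; apply: (le_trans (cmod_stft_le summ x)).
apply: (le_trans (hoelder_stft x.1 p1 foo g1oo)); rewrite EFinM.
by apply: lee_pmul => //; exact: LpNorm_ge0.
Qed.

Lemma cmod_symbol_stft_le x : cmod (s x * stft g1 f x) <= a * a1 * beta x.1.
Proof.
by rewrite cmodM mulrC; apply: ler_pM; rewrite ?cmod_ge0//; exact: stft_le.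
Qed.

Lemma cmeasurable_symbol_stft : cmeasurable (fun x => s x * stft g1 f x).
Proof. exact: cmeasurableM ms (cmeasurable_stft summ). Qed.

Lemma symbol_stft_cintegrable (h : ZT -> R[i]) (M : R) : cmeasurable h ->
  (forall x, cmod (h x) <= M) ->
  cintegrable muZT (fun x => s x * stft g1 f x * h x).
Proof.
move=> mh hM; have M0 : 0 <= M by rewrite (le_trans (cmod_ge0 _) (hM (0, 0))).
apply: (cintegrable_le (g := fun y : ZT => ((a * a1 * M)%:E * (beta
  y.1)%:E)%E)).
- exact: cmeasurableM cmeasurable_symbol_stft mh.
- by apply: measurable_fun_Znprod => k /=; exact: measurable_cst.
- move=> x; rewrite -EFinM lee_fin cmodM [leRHS]mulrAC.
  by apply: ler_pM; rewrite ?cmod_ge0//; exact: cmod_symbol_stft_le.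
- rewrite (@integral_fst_muZT R n (fun k => (a * a1 * M)%:E * (beta k)%:E)%E);
  last first.
    by move=> k; rewrite -EFinM lee_fin !mulr_ge0.
  rewrite ge0_integralZl_EFin ?mulr_ge0//; last by move=> k _; rewrite lee_fin.
  apply: le_lt_trans (ltry (a * a1 * M * b)); rewrite [leRHS]EFinM.
  by apply: lee_wpmul2l => //; rewrite lee_fin !mulr_ge0.
Qed.

Lemma locop_cintegrable k :
  cintegrable muZT (fun x => s x * stft g1 f x * tfshift g2 x k).
Proof.
apply: (@symbol_stft_cintegrable _ a2); first exact: cmeasurable_tfshift.
by move=> x; rewrite cmod_tfshift g2_le.
Qed.

(** The integrand is at most a a1 beta(m) |g2(k - m)|, free of w: a convolution with an l^1 weight,
    to which Young's inequality on Z^n itself applies. *)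
Lemma LpNorm_locop_le : (LpNorm muZ p (locop s g1 g2 f)
  <= (a * a1 * b * a2)%:E)%E.
Proof.
have aa : 0 <= a * a1 by rewrite mulr_ge0.
have b0 : 0 <= b.
  by rewrite -lee_fin; apply: (le_trans _ beta_b); apply: integral_ge0 => k _;
    rewrite lee_fin.
apply: (@le_trans _ _ ((a * a1 * b)%:E * LpNorm muZ p g2)%E); last first.
  by rewrite [leRHS]EFinM; apply: lee_wpmul2l => //; rewrite lee_fin mulr_ge0.
apply: (@young_countZ R n _ _ muZ id (fun m => a * a1 * beta m)) => //.
- by move=> k; rewrite mulr_ge0.
- under eq_integral do rewrite EFinM.
  rewrite ge0_integralZl_EFin//; last by move=> k _; rewrite lee_fin.
  by rewrite [leRHS]EFinM; apply: lee_wpmul2l; rewrite ?lee_fin.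
- move=> k; apply: (le_trans (cmod_cintegral_le (locop_cintegrable k))).
  rewrite -(@integral_fst_muZT R n (fun m => (a * a1 * beta m * cmod (g2 (k -
    m)))%:E)); last first.
    by move=> m; rewrite lee_fin !mulr_ge0 ?cmod_ge0.
  apply: ge0_le_integral => //.
  + by move=> x _; rewrite lee_fin cmod_ge0.
  + by apply: measurable_ecmod; have [] := (cintegrableP _ _).1
    (locop_cintegrable k).
  + by apply: measurable_fun_Znprod => m /=; exact: measurable_cst.
  + move=> x _; rewrite lee_fin cmodM cmod_tfshift.
    by rewrite ler_wpM2r ?cmod_ge0// cmod_symbol_stft_le.
Qed.

(** Fubini over k and (m, w). The integrand is dominated by a a1 beta(m) |g2(k - m)| |h(k)|, summed
    in k by Hölder and in m through beta. *)
Lemma locop_weak h : (LpNorm muZ p' h < +oo)%E ->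
  cintegrable muZT (fun x => s x * stft g1 f x * conjc (stft g2 h x)) /\
  pairing (locop s g1 g2 f) h =
    cintegral muZT (fun x => s x * stft g1 f x * conjc (stft g2 h x)).
Proof.
move=> hoo.
have [H hH] : exists H : R, (LpNorm muZ p' h <= H%:E)%E.
  by exists (fine (LpNorm muZ p' h)); rewrite fineK// ge0_fin_numE// LpNorm_ge0.
have H0 : 0 <= H by rewrite -lee_fin (le_trans (LpNorm_ge0 _ _ _) hH).
have q1 := hoelder_conj_ge1 p1.
have pp : hoelder_conjugate p' = p by exact: hoelder_conjugateK.
have g2h m : (\int[muZ]_k (cmod (g2 (k - m)%R)
  * cmod (h k))%:E <= (H * a2)%:E)%E.
  have := @hoelder_stft R n p' h g2 m q1 hoo; rewrite pp => /(_ g2oo) hg.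
  apply: (@le_trans _ _ (LpNorm muZ p' h * LpNorm muZ p g2)%E).
    by apply: le_trans hg; apply: lee_of_eq; apply: eq_integral => k _;
      rewrite mulrC.
  by rewrite EFinM; apply: lee_pmul => //; exact: LpNorm_ge0.
have summ2 : stft_summable g2 h.
  by apply: (@lp_stft_summable R n p') => //; rewrite pp.
have stft2_le x : cmod (stft g2 h x) <= H * a2.
  rewrite -lee_fin; apply: (le_trans (cmod_stft_le summ2 x)).
  apply: (le_trans _ (g2h x.1)); apply: lee_of_eq.
  by apply: eq_integral => k _; rewrite mulrC.
have iw : cintegrable muZT (fun x => s x * stft g1 f x * conjc (stft g2 h x)).
  apply: (@symbol_stft_cintegrable _ (H * a2)).
    by apply: cmeasurable_conj; exact: cmeasurable_stft.
  by move=> x; rewrite cmod_conj.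
split=> //.
pose F (z : Zn n * ZT) := s z.2 * stft g1 f z.2 * tfshift g2 z.2 z.1 * conjc (h
  z.1).
have irow k : cintegrable muZT (fun x => F (k, x)).
  rewrite /F/=; under eq_fun do rewrite mulrC.
  by apply: cintegrableZ; exact: locop_cintegrable.
have mF : cmeasurable F.
  by apply: cmeasurable_Znprod => k; have [] := (cintegrableP _ _).1 (irow k).
have bcol x : (\int[muZ]_k (cmod (F (k, x)))%:E <= (a * a1 * beta x.1 * (H *
  a2))%:E)%E.
  apply: (@le_trans _ _ (\int[muZ]_k ((a * a1 * beta x.1)%:E *
      (cmod (g2 (k - x.1)%R) * cmod (h k))%:E))%E).
    apply: ge0_le_integral => //; first by move=> k _; rewrite lee_fin cmod_ge0.
    move=> k _; rewrite -EFinM lee_fin /F cmodM cmodM cmod_tfshift cmod_conj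
      -mulrA.
    by rewrite ler_wpM2r ?mulr_ge0 ?cmod_ge0// cmod_symbol_stft_le.
  rewrite ge0_integralZl_EFin ?mulr_ge0//; last first.
    by move=> k _; rewrite lee_fin mulr_ge0 ?cmod_ge0.
  by rewrite [leRHS]EFinM; apply: lee_wpmul2l; rewrite ?lee_fin ?mulr_ge0.
have icol x : cintegrable muZ (fun k => F (k, x)).
  by apply/cintegrable_countZP; apply: le_lt_trans (bcol x) (ltry _).
have iF : cintegrable (muZ \x muZT)%E F.
  apply/cintegrableP; split => //.
  rewrite (fubini_tonelli2 (m1 := muZ) (m2 := muZT) (fun z => (cmod (F z))%:E));
    last 2 first.
  - exact: measurable_ecmod.
  - by move=> z; rewrite lee_fin cmod_ge0.
  apply: (@le_lt_trans _ _ (\int[muZT]_x ((a * a1 * (H * a2))%:E * (beta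
    x.1)%:E))%E).
    apply: ge0_le_integral => //.
    + by move=> x _; apply: integral_ge0 => k _; rewrite lee_fin cmod_ge0.
    + apply: (measurable_fun_fubini_tonelli_G (m1 := muZ) (fun z =>
      (cmod (F z))%:E)).
        exact: measurable_ecmod.
      by move=> z; rewrite lee_fin cmod_ge0.
    + by apply: measurable_fun_Znprod => m /=; exact: measurable_cst.
    + move=> x _; apply: (le_trans (bcol x)); rewrite -EFinM lee_fin.
      by rewrite [leLHS]mulrAC.
  rewrite (@integral_fst_muZT R n (fun k => (a * a1 * (H * a2))%:E * (beta
    k)%:E)%E); last first.
    by move=> k; rewrite -EFinM lee_fin !mulr_ge0.
  rewrite ge0_integralZl_EFin ?mulr_ge0//; last by move=> k _; rewrite lee_fin.
  apply: le_lt_trans (ltry (a * a1 * (H * a2) * b)); rewrite [leRHS]EFinM.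
  by apply: lee_wpmul2l => //; rewrite lee_fin !mulr_ge0.
transitivity (cintegral muZ (fun k => cintegral muZT (fun x => F (k, x)))).
  apply: eq_cintegral => k; rewrite /locop mulrC -cintegralZ;
    last exact: locop_cintegrable.
  by apply: eq_cintegral => x; rewrite /F mulrC.
rewrite (cFubini (m1 := muZ) (m2 := muZT) iF irow icol).
apply: eq_cintegral => x; have ig := stft_cintegrable summ2 x.
have -> : stft g2 h x = cintegral muZ (fun k => h k * conjc (tfshift g2 x k))
  by [].
rewrite -(cintegral_conj ig) -cintegralZ; last exact: cintegrable_conj.
by apply: eq_cintegral => k; rewrite /F conjcM conjcK -mulrA [conjc _ * _]mulrC.
Qed.

End one_function.

Lemma locop_linear (a : R[i]) f h :
  (LpNorm muZ p f < +oo)%E -> (LpNorm muZ p h < +oo)%E ->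
  locop s g1 g2 (fun k => a * f k + h k) =
  (fun k => a * locop s g1 g2 f k + locop s g1 g2 h k).
Proof.
move=> foo hoo; apply/funext => k.
have fin u : (LpNorm muZ p u < +oo)%E -> (LpNorm muZ p u <= (fine (LpNorm muZ p
  u))%:E)%E.
  by move=> uoo; rewrite fineK// ge0_fin_numE// LpNorm_ge0.
have sf := lp_stft_summable p1 foo g1oo; have sh :=
  lp_stft_summable p1 hoo g1oo.
have iF := locop_cintegrable (fin f foo) k.
have iH := locop_cintegrable (fin h hoo) k.
rewrite /locop -cintegralZ// -cintegralD//; last exact: cintegrableZ.
apply: eq_cintegral => x.
have -> : stft g1 (fun k => a * f k + h k) x = a * stft g1 f x + stft g1 h x.
  have i1 := stft_cintegrable sf x; have i2 := stft_cintegrable sh x.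
  rewrite /stft /pairing -cintegralZ// -cintegralD//; last exact: cintegrableZ.
  by apply: eq_cintegral => l; rewrite mulrDl mulrA.
by ring.
Qed.

End localization_operator.

(* phi and Phi are arbitrary non-zero windows on Z^n and Z^n x T^n; the norm
   inequality with constant 1 depends on the normalization of the windows, and
   holds once Phi is multiplied by a constant depending only on phi and Phi.
   Equivalently, for the windows phi and Phi it holds with the constant c. *)
Theorem proposition4p10 (R : realType) (n : nat)
    (phi : Zn n -> R[i]) (Phi : Zn n * Tn R n -> R[i])
    (phi_schwartz : schwartzZ phi) (phi_neq0 : exists k, phi k <> 0)
    (Phi_schwartz : schwartzZT Phi) (Phi_neq0 : exists x, Phi x <> 0) :
  exists c : R, 0 < c /\
  forall sigma : (Zn n * Tn R n -> R[i]) -> R[i],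
  MZT (scale_window c Phi) 1%E sigma ->
  exists s : Zn n * Tn R n -> R[i], represents sigma s /\
  forall (p : \bar R) (g1 g2 : Zn n -> R[i]), (1 <= p)%E ->
  MZ phi (hoelder_conjugate p) g1 -> MZ phi p g2 ->
  [/\ locop_well_defined phi p s g1 g2,
      bounded_operator phi p (locop s g1 g2) &
      (opnorm phi p (locop s g1 g2) <=
         normMZT (scale_window c Phi) 1 sigma *
         normMZ phi (hoelder_conjugate p) g1 * normMZ phi p g2)%E].
Proof.
have [K K0 symb] := symbol_of_MZT Phi_schwartz Phi_neq0.
have [k0 phi0] := phi_neq0.
have [u u0 phiu] := schwartzZ_summable phi_schwartz.
set q := cmod (phi k0).
have q0 : 0 < q.
  by rewrite lt_neqAle cmod_ge0 andbT eq_sym; apply/eqP => /cmod_eq0.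
(* Then c K = u / q^3: the norm bound in [opM] closes with an equality. *)
pose c := u / q ^+ 3 / K.
have c0 : 0 < c by rewrite !divr_gt0// exprn_gt0.
exists c; split => // sigma sigmaM.
have [s [beta [sr beta0 s_le beta_le]]] := symb c sigma c0 sigmaM.
exists s; split => // p g1 g2 p1 g1M g2M.
have [_ ms _] := sr.
have noo : (normMZT (scale_window c Phi) 1 sigma < +oo)%E by have [_ []] :=
  sigmaM.
have cK0 : 0 < c * K by rewrite mulr_gt0.
have int0 : (0 <= \int[@countZ R n]_j (beta j)%:E)%E.
  by apply: integral_ge0 => j _; rewrite lee_fin.
(* Finiteness is inherited from the M^1 norm, since c K > 0. *)
have [b bE] : exists b : R, (\int[@countZ R n]_j (beta j)%:E = b%:E)%E.
  move: beta_le noo int0; case: (\int[_]_j _)%E => [b _ _ _||//];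
    first by exists b.
  by rewrite gt0_muley ?lte_fin// leye_eq => /eqP ->; rewrite ltxx.
have b0 : 0 <= b by rewrite -lee_fin -bE.
have bB : (\int[@countZ R n]_j (beta j)%:E <= b%:E)%E by rewrite bE.
have MZ_lp (r : \bar R) f : (1 <= r)%E -> MZ phi r f -> exists a : R,
    [/\ 0 <= a, normMZ phi r f = a%:E & (LpNorm (@countZ R n)
      r f <= (a / q)%:E)%E].
  move=> r1 [ft [_ foo]]; have nf0 : (0 <= normMZ phi r f)%E by exact:
    LpNorm_ge0.
  exists (fine (normMZ phi r f)); rewrite fine_ge0// fineK ?ge0_fin_numE//;
    split=> //.
  rewrite EFinM fineK ?ge0_fin_numE// lee_pdivlMr// muleC.
  by apply: LpNorm_le_normMZ => //; exact: tempered_stft_summable.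
have [a1 [a10 g1E g1a]] := MZ_lp _ _ (hoelder_conj_ge1 p1) g1M.
have [a2 [a20 g2E g2a]] := MZ_lp _ _ p1 g2M.
(* [a] stands for the M^p norm of f; this l^p estimate yields both membership in M^p and the
   operator bound. *)
have opM f a : 0 <= a -> (LpNorm (@countZ R n) p f <= (a / q)%:E)%E ->
    MZ phi p (locop s g1 g2 f) /\
    (normMZ phi p (locop s g1 g2 f) <= (c * K * b * a1 * a2 * a)%:E)%E.
  move=> a0 fa; have Lf := LpNorm_locop_le ms beta0 s_le bB p1 g1a g2a fa.
  set M := (a / q * (a1 / q) * b * (a2 / q)) in Lf.
  have Loo : (LpNorm (@countZ R n) p (locop s g1 g2 f) < +oo)%E.
    by rewrite (le_lt_trans Lf)// ltry.
  (* An l^p sequence is bounded, so growth order 0 suffices. *)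
  have Lt : temperedZ (locop s g1 g2 f).
    exists 0%N, M => k; rewrite expr0 mulr1 -lee_fin.
    exact: le_trans (cmod_le_LpNorm _ _ p1) Lf.
  have Ls := tempered_stft_summable phi_schwartz Lt.
  have nL : (normMZ phi p (locop s g1 g2 f) <= (c * K * b * a1 * a2 * a)%:E)%E.
    apply: (le_trans (normMZ_le p1 phiu Loo Ls)).
    apply: (@le_trans _ _ (u%:E * M%:E)%E).
      by apply: lee_wpmul2l; [rewrite lee_fin ltW|exact: Lf].
    rewrite -EFinM lee_fin le_eqVlt; apply/orP; left; apply/eqP.
    by rewrite /M /c; field; rewrite !gt_eqF.
  split=> //; split=> //; split; first exact: cmeasurable_stft.
  exact: le_lt_trans nL (ltry _).
split.
- move=> f fM; have [a [a0 _ fa]] := MZ_lp _ _ p1 fM; split.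
    exact: (locop_cintegrable ms beta0 s_le bB p1 g1a g2a fa).
  move=> h hM; apply: (locop_weak ms beta0 s_le bB p1 g1a g2a fa).
  have [d [_ _ hd]] := MZ_lp _ _ (hoelder_conj_ge1 p1) hM.
  exact: le_lt_trans hd (ltry _).
- split.
  + by move=> f fM; have [a [a0 _ fa]] := MZ_lp _ _ p1 fM;
    have [] := opM f a a0 fa.
  + move=> a f h fM hM; apply: (locop_linear ms beta0 s_le bB p1 g1a g2a).
      by have [d [_ _ fd]] := MZ_lp _ _ p1 fM; exact: le_lt_trans fd (ltry _).
    by have [d [_ _ hd]] := MZ_lp _ _ p1 hM; exact: le_lt_trans hd (ltry _).
  + exists (c * K * b * a1 * a2) => f fM; have [a [a0 -> fa]] :=
    MZ_lp _ _ p1 fM.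
    by rewrite -EFinM; have [] := opM f a a0 fa.
- apply: ge_ereal_sup => _ [f [fM f1] <-].
  have [a [a0 fE fa]] := MZ_lp _ _ p1 fM.
  have [_ nL] := opM f a a0 fa; apply: (le_trans nL).
  rewrite g1E g2E; apply: (@le_trans _ _ ((c * K * b)%:E * a1%:E * a2%:E)%E).
    have a_le1 : a <= 1 by rewrite -lee_fin -fE.
    have C0 : 0 <= c * K * b * a1 * a2.
      by do 3 (apply: mulr_ge0 => //); exact: ltW.
    by rewrite -!EFinM lee_fin ler_piMr.
  apply: lee_wpmul2r; rewrite ?lee_fin//; apply: lee_wpmul2r;
    rewrite ?lee_fin//.
  by rewrite EFinM -bE.
Qed.
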